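(* Let $d\in\{1,2,3\}$. Consider the $P^1$ finite element method with vertex quadrature on a family of unstructured simplicial meshes of $\Omega$ that is shape regular (with a constant $\sigma$ independent of $h$) and satisfies the monotonicity mesh constraint. Let $u^*$ and $\lambda^*$ be the (positive) ground state and the corresponding eigenvalue of the continuous energy $E$, and let $u_h^*$ and $\lambda_h^*$ be the (positive) ground state and the corresponding eigenvalue of the discrete energy $E_h$, with $\mathbf u^*$ the vector of nodal values of $u_h^*$. Suppose that $u^*\in H^2(\Omega)\cap H_0^1(\Omega)$, that $V\in C^1(\bar\Omega)$, and that the multiplicity of the eigenvalue $\lambda^*$ of the linear problem $$-\Delta u+Vu+\beta|u^*|^2u=\lambda u\ \text{ in }\Omega,\qquad u=0\ \text{ on }\partial\Omega,$$ is one. Let $(\lambda_h^1,\mathbf u^1)$ with $\langle\mathbf u^1,\mathbf u^1\rangle_h=1$ be the second eigenpair (second smallest eigenvalue) of the linearized discrete problem $-\Delta_h\mathbf u+\mathbb V\mathbf u+\beta(\mathbf u^* )^2\mathbf u=\lambda_h\mathbf u$. Then $$\liminf_{h\to0}\,(\lambda_h^1-\lambda_h^* )>0.$$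
   Context: Let $L>0$, $\Omega=[-L,L]^d$, $\beta>0$, $V:\Omega\to\mathbb R$ with $V\ge c>0$ for a constant $c$. Continuous problem. $E(\phi)=\frac12\int_\Omega(|\nabla\phi|^2+V|\phi|^2)\,d\mathbf x+\frac\beta4\int_\Omega|\phi|^4\,d\mathbf x$ on $\{\phi\in H_0^1(\Omega):\int_\Omega|\phi|^2=1\}$. It has a unique positive minimizer $u^*$ (the ground state), and $\lambda^*$ is the number such that $-\Delta u^*+Vu^*+\beta|u^*|^2u^*=\lambda^*u^*$ weakly in $H_0^1(\Omega)$. Discrete problem. $\Omega_h$ is a conforming simplicial mesh of $\Omega$, $h_K$ is the size (diameter) of a simplex $K$, $h=\sup_Kh_K$. $V_0^h$ is the space of continuous functions vanishing on $\partial\Omega$ that are affine on each simplex. $\langle f,g\rangle$ denotes $\int_\Omega fg$ (or $\int_\Omega f\cdot g$) computed with the quadrature $\int_Kf\approx\frac{|K|}{d+1}\sum_{\mathbf x_i\text{ vertex of }K}f(\mathbf x_i)$ on each simplex. $\mathbf x_1,\dots,\mathbf x_N$ are the interior vertices, $\phi_i$ the nodal basis, $w_i$ the total quadrature weight at $\mathbf x_i$; $\mathbf u\in\mathbb R^N$ is identified with $u_h=\Pi\mathbf u=\sum_iu_i\phi_i$. $\mathbb M=\mathrm{diag}(w_i)$, $\langle\mathbf u,\mathbf v\rangle_h=\mathbf u^\top\mathbb M\mathbf v$, $\mathbb S_{ij}=\langle\nabla\phi_i,\nabla\phi_j\rangle$, $\mathbb V=\mathrm{diag}(V(\mathbf x_i))$,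 $\Delta_h=-\mathbb M^{-1}\mathbb S$. Products and powers of vectors are entrywise. The discrete energy is $E_h(u_h)=\frac12\langle\nabla u_h,\nabla u_h\rangle+\frac12\langle Vu_h,u_h\rangle+\frac\beta4\langle u_h^2,u_h^2\rangle$ on $\{u_h\in V_0^h:\langle u_h,u_h\rangle=1\}$. The discrete ground state $u_h^*$ is the minimizer that is positive at all interior vertices, and $\lambda_h^*$ is the number with $-\Delta_h\mathbf u^*+\mathbb V\mathbf u^*+\beta(\mathbf u^* )^3=\lambda_h^*\mathbf u^*$. The matrices $-\Delta_h+\mathbb V+\beta\,\mathrm{diag}(\mathbf u^2)$ are irreducible. Shape regularity: there is $\sigma>0$ independent of $h$ with $h_K/\rho_K\le\sigma$ for all simplices $K$, where $\rho_K$ is the diameter of the largest ball contained in $K$. Monotonicity mesh constraint (for $d\ge2$; void for $d=1$): for each edge $E$ of the mesh, $\sum_{T\supset E}\frac1{d(d-1)}|\kappa_E^T|\cot\theta_E^T\ge0$, the sum being over simplices $T$ containing $E$, where $\kappa_E^T$ is the $(d-2)$-dimensional face of $T$ opposite to $E$ (with $|\kappa_E^T|=1$ if $d=2$) and $\theta_E^T$ is the dihedral angle of $T$ at $\kappa_E^T$, i.e. between the two $(d-1)$-dimensional faces of $T$ opposite to the two endpoints of $E$. *)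

(* Defs.v *)
From HB Require Import structures.
From mathcomp Require Import all_boot all_order all_algebra.
From mathcomp Require Import all_classical all_reals all_analysis.
Set Implicit Arguments. Unset Strict Implicit. Unset Printing Implicit Defensive.
Import Order.TTheory GRing.Theory Num.Theory.
Import numFieldNormedType.Exports.
Local Open Scope classical_set_scope.
Local Open Scope ring_scope.

Definition measure_rV_display : measure_display -> measure_display.
Proof. exact. Qed.

Section measurable_rV.
Context {d} {T : measurableType d} (n : nat).
Definition rV_coord (i : 'I_n) (x : 'rV[T]_n) : T := x ord0 i.

HB.instance Definition _ := @isMeasurable.Build (measure_rV_display d)
  'rV[T]_n (g_sigma_preimage rV_coord) (@sigma_algebra0 _ _ _)
  (@sigma_algebraC _ _) (@sigma_algebra_bigcup _ _ _).

Lemma measurable_rV_coord i : measurable_fun setT (rV_coord i).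
Proof.
move=> _ Y mY; rewrite setTI; apply: sub_sigma_algebra => /=.
rewrite -bigcup_seq/=; exists i => /=; first by rewrite mem_index_enum.
by exists Y => //; rewrite setTI.
Qed.

Lemma measurable_fun_rV d1 (T1 : measurableType d1) (f : T1 -> 'rV[T]_n) :
  (forall i, measurable_fun setT (rV_coord i \o f)) -> measurable_fun setT f.
Proof.
move=> mf.
have : g_sigma_preimage (fun i => rV_coord i \o f) `<=` measurable.
  apply: smallest_sub; first exact: sigma_algebra_measurable.
  rewrite -bigcup_seq; apply: bigcup_sub => i _ A [B mB <-]; exact: mf.
rewrite g_sigma_preimage_comp => prefS.
by move=> _ A mA; apply: prefS; exists A.
Qed.
End measurable_rV.

Lemma sigma_finite_prod d1 d2 (T1 : measurableType d1) (T2 : measurableType d2)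
    (R : realType) (m1 : {sigma_finite_measure set T1 -> \bar R})
    (m2 : {sigma_finite_measure set T2 -> \bar R}) :
  sigma_finite setT (m1 \x m2)%E.
Proof.
have /sigma_finiteP[F [TF ndF Foo]] := sigma_finiteT m1.
have /sigma_finiteP[G [TG ndG Goo]] := sigma_finiteT m2.
exists (fun n => F n `*` G n).
  rewrite -setXTT TF TG predeqE => -[x y]; split.
    move=> [/= [n _ Fnx] [k _ Gky]]; exists (maxn n k) => //; split.
    - by move: x Fnx; exact/subsetPset/ndF/leq_maxl.
    - by move: y Gky; exact/subsetPset/ndG/leq_maxr.
  by move=> [n _ []/= ? ?]; split; exists n.
move=> k; have [? ?] := Foo k; have [? ?] := Goo k.
split; first exact: measurableX.
by rewrite product_measure1E// lte_mul_pinfty// ge0_fin_numE.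
Qed.

Section lebesgue_rV.
Context {R : realType}.

Definition cons_rV n (p : R * 'rV[R]_n) : 'rV[R]_n.+1 :=
  \row_j oapp (fun k => p.2 ord0 k) p.1 (unlift ord0 j).

Lemma measurable_cons_rV n : measurable_fun setT (@cons_rV n).
Proof.
apply: measurable_fun_rV => i; case: (unliftP ord0 i) => [k|] ->.
- rewrite (_ : _ \o _ = rV_coord k \o snd); last first.
    by apply/funext => p; rewrite /rV_coord /= mxE liftK.
  by apply: measurableT_comp => //; exact: measurable_rV_coord.
- rewrite (_ : _ \o _ = fst) //.
  by apply/funext => p; rewrite /rV_coord /= mxE unlift_none.
Qed.

Definition uncons_rV n (x : 'rV[R]_n.+1) : R * 'rV[R]_n :=
  (x ord0 ord0, \row_j x ord0 (lift ord0 j)).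

Lemma cons_rVK n : cancel (@cons_rV n) (@uncons_rV n).
Proof.
move=> [x y]; rewrite /uncons_rV mxE unlift_none; congr pair.
by apply/rowP => j; rewrite !mxE liftK.
Qed.

Lemma measurable_uncons_rV n : measurable_fun setT (@uncons_rV n).
Proof.
apply/measurable_fun_pairP; split; first exact: (measurable_rV_coord ord0).
apply: measurable_fun_rV => i.
rewrite (_ : _ \o _ = rV_coord (lift ord0 i)); first exact: measurable_rV_coord.
by apply/funext => x; rewrite /rV_coord /= mxE.
Qed.

Section step.
Variables (n : nat) (mu : {sigma_finite_measure set 'rV[R]_n -> \bar R}).

Definition cons_measure : set 'rV[R]_n.+1 -> \bar R :=
  pushforward (@lebesgue_measure R \x mu)%E (@cons_rV n).

Let mcons A : measurable A -> measurable (@cons_rV n @^-1` A).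
Proof.
by move=> mA; rewrite -[X in measurable X]setTI; exact: measurable_cons_rV.
Qed.

Let cons0 : cons_measure set0 = 0%E.
Proof. by rewrite /cons_measure /pushforward preimage_set0 measure0. Qed.

Let cons_ge0 A : (0 <= cons_measure A)%E.
Proof. exact: (measure_ge0 (@lebesgue_measure R \x mu)%E). Qed.

Let cons_sigma_additive : semi_sigma_additive cons_measure.
Proof.
move=> F mF tF mUF; rewrite /cons_measure /pushforward preimage_bigcup.
apply: (@measure_semi_sigma_additive _ _ _ (@lebesgue_measure R \x mu)%E).
- by move=> k; exact: mcons.
- apply/trivIsetP => /= i j _ _ ij; rewrite -preimage_setI.
  by move/trivIsetP : tF => /(_ _ _ _ _ ij) ->//; rewrite preimage_set0.
- by rewrite -preimage_bigcup; exact: mcons.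
Qed.

HB.instance Definition _ :=
  isMeasure.Build _ _ _ cons_measure cons0 cons_ge0 cons_sigma_additive.

Let cons_sigma_finite : sigma_finite setT cons_measure.
Proof.
have [F TF mF] := sigma_finite_prod (@lebesgue_measure R) mu.
exists (fun k => @uncons_rV n @^-1` F k).
  by rewrite -preimage_bigcup -TF preimage_setT.
move=> k; have [mFk Fkoo] := mF k; split.
  by rewrite -[X in measurable X]setTI; exact: measurable_uncons_rV.
rewrite /cons_measure /pushforward -comp_preimage.
by rewrite (_ : _ \o _ = id)//; apply/funext => p; exact: cons_rVK.
Qed.

HB.instance Definition _ :=
  Measure_isSigmaFinite.Build _ _ _ cons_measure cons_sigma_finite.
End step.

(* Lebesgue measure on the Borel sets of R^n, as an iterated product. *)
Fixpoint lebesgue_rV n : {sigma_finite_measure set 'rV[R]_n -> \bar R} :=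
  if n is k.+1 then cons_measure (lebesgue_rV k) else \d_(0 : 'rV[R]_0).

Lemma measurable_box n (A : 'I_n -> set R) : (forall i, measurable (A i)) ->
  measurable [set x : 'rV[R]_n | forall i, A i (x ord0 i)].
Proof.
move=> mA.
rewrite (_ : mkset _ = \bigcap_(i in [set: 'I_n]) (rV_coord i @^-1` A i)).
  apply: fin_bigcap_measurable => // i _.
  by rewrite -[X in measurable X]setTI; exact: measurable_rV_coord.
by apply/seteqP; split=> [x Ax i _|x Ax i]; [exact: Ax|exact: Ax i I].
Qed.

Lemma lebesgue_rV_box n (A : 'I_n -> set R) : (forall i, measurable (A i)) ->
  lebesgue_rV n [set x | forall i, A i (x ord0 i)] =
  (\prod_(i < n) lebesgue_measure (A i))%E.
Proof.
elim: n A => [A mA|n IHn A mA].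
  by rewrite big_ord0 /= diracE mem_set// => -[].
rewrite big_ord_recl -IHn//=.
rewrite /cons_measure /pushforward -product_measure1E//; last first.
  exact: (measurable_box (fun i => mA (lift ord0 i))).
  exact: mA.
congr (_ _); apply/seteqP; split=> [[x y] Axy|[x y] [Ax Ay] i].
- split=> /=; first by have := Axy ord0; rewrite /= mxE unlift_none.
  by move=> i; have := Axy (lift ord0 i); rewrite /= mxE liftK.
- by case: (unliftP ord0 i) => [k|] ->; rewrite mxE ?liftK ?unlift_none//=.
Qed.

End lebesgue_rV.

Section euclid.
Context {R : realType} {d : nat}.
Implicit Types (x y : 'rV[R]_d) (A D : set 'rV[R]_d) (f g u v : 'rV[R]_d -> R).

Definition dotp x y : R := \sum_i x ord0 i * y ord0 i.

(* The norm of the library on ['rV_d] is the sup norm. *)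
Definition enorm x : R := Num.sqrt (dotp x x).

Definition cube (L : R) : set 'rV[R]_d := [set x | forall i, - L <= x ord0 i <= L].

Definition diam A : R := sup [set enorm (p.1 - p.2) | p in A `*` A].

Definition inball_diam A : R :=
  sup [set 2 * r | r in
    [set r | 0 <= r /\ exists x, [set y | enorm (y - x) <= r] `<=` A]].

Definition e_ (i : 'I_d) : 'rV[R]_d := delta_mx ord0 i.

Definition pd (i : 'I_d) f : 'rV[R]_d -> R := fun x => 'D_(e_ i) f x.

Fixpoint C_k (k : nat) f : Prop :=
  continuous f /\
  if k is k'.+1 then forall i, (forall x, derivable f x (e_ i)) /\ C_k k' (pd i f)
  else True.

(* C^1 up to the boundary: the partial derivatives exist in the interior of D
   and extend continuously to D. *)
Definition C1_closure D f :=
  {within D, continuous f} /\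
  forall i, exists2 g : 'rV[R]_d -> R, {within D, continuous g} &
    forall x, D° x -> is_derive x (e_ i) f (g x).

End euclid.

Section sobolev.
Context {R : realType} {d : nat} (D : set 'rV[R]_d).
Implicit Types (f g u v w psi V : 'rV[R]_d -> R) (lam beta : R).

Local Notation mu := (@lebesgue_rV R d).

Definition test_fun psi :=
  [/\ forall k, C_k k psi, compact (closure [set x | psi x != 0])
    & closure [set x | psi x != 0] `<=` D°].

Definition L2 f :=
  measurable_fun D f /\ mu.-integrable D (EFin \o (fun x => f x ^+ 2)).

Definition weak_pd (i : 'I_d) f g :=
  forall psi, test_fun psi ->
    \int[mu]_(x in D) (f x * pd i psi x) = - \int[mu]_(x in D) (g x * psi x).

Definition H1 f := L2 f /\ forall i, exists2 g, L2 g & weak_pd i f g.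

(* The weak gradient, determined almost everywhere on D when [H1 f] holds. *)
Definition wgrad f : 'rV[R]_d -> 'rV[R]_d :=
  fun x => \row_i xget (fun=> 0) [set g | L2 g /\ weak_pd i f g] x.

Definition H2 f := H1 f /\ forall i, H1 (fun x => wgrad f x ord0 i).

Definition H1_norm f : R :=
  Num.sqrt (\int[mu]_(x in D) (f x ^+ 2 + dotp (wgrad f x) (wgrad f x))).

Definition H10 f :=
  H1 f /\ forall e : R, 0 < e -> exists2 psi, test_fun psi & H1_norm (f \- psi) < e.

Definition energy V beta f : \bar R :=
  ((2^-1)%:E *
     \int[mu]_(x in D) (dotp (wgrad f x) (wgrad f x) + V x * f x ^+ 2)%:E +
   (beta / 4)%:E * \int[mu]_(x in D) (f x ^+ 4)%:E)%E.

Definition ground_state V beta u :=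
  [/\ H10 u,
      \int[mu]_(x in D) (u x ^+ 2) = 1,
      forall v, H10 v -> \int[mu]_(x in D) (v x ^+ 2) = 1 ->
        (energy V beta u <= energy V beta v)%E
    & {ae mu, forall x, D x -> 0 < u x}].

(* [- Delta u + W u = lam u] weakly in H^1_0 *)
Definition weak_eigenfun W lam u :=
  H10 u /\ forall v, H10 v ->
    \int[mu]_(x in D) (dotp (wgrad u x) (wgrad v x) + W x * u x * v x) =
    lam * \int[mu]_(x in D) (u x * v x).

(* The space of weak solutions of [- Delta u + W u = lam u] in H^1_0 (functions
   being identified when they are equal almost everywhere) has dimension 1. *)
Definition multiplicity_one W lam :=
  exists w, [/\ weak_eigenfun W lam w,
                ~ {ae mu, forall x, D x -> w x = 0}
              & forall u, weak_eigenfun W lam u ->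
                  exists a : R, {ae mu, forall x, D x -> u x = a * w x}].

End sobolev.

(* A mesh is given by its vertices and by the vertex sets of its simplices. *)
Record mesh (R : realType) (d : nat) := Mesh {
  nvert : nat;
  vert : 'I_nvert -> 'rV[R]_d;
  cells : {set {set 'I_nvert}} }.

Section mesh.
Context {R : realType} {d : nat} (T : mesh R d).
Local Notation X := (@vert R d T).
Implicit Types (i j : 'I_(nvert T)) (K F : {set 'I_(nvert T)}).
Implicit Types (f g V : 'rV[R]_d -> R).

Definition hull F : set 'rV[R]_d :=
  [set x | exists t : 'I_(nvert T) -> R,
    [/\ forall i, 0 <= t i, \sum_(i in F) t i = 1 & x = \sum_(i in F) t i *: X i]].

Definition aff_indep F :=
  forall a : 'I_(nvert T) -> R, \sum_(i in F) a i = 0 ->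
    \sum_(i in F) a i *: X i = 0 -> forall i, i \in F -> a i = 0.

Definition conforming_mesh (D : set 'rV[R]_d) :=
  [/\ injective X,
      forall i, exists2 K, K \in cells T & i \in K,
      forall K, K \in cells T -> #|K| = d.+1 /\ aff_indep K,
      D = \bigcup_(K in [set K | K \in cells T]) hull K
    & forall K K', K \in cells T -> K' \in cells T ->
        hull K `&` hull K' = hull (K :&: K')].

Definition mesh_size : R := \big[Num.max/0]_(K in cells T) diam (hull K).

Definition shape_regular (sigma : R) :=
  forall K, K \in cells T -> diam (hull K) / inball_diam (hull K) <= sigma.

(* [(#|F| - 1)]-dimensional volume of the simplex with vertex set F, as the
   square root of a Gram determinant; it is 1 when F is a singleton. *)
Definition simplex_vol F : R :=
  let s := [seq X i | i <- enum F] in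
  let B := \matrix_(k < #|F|.-1, l < d) (s`_k.+1 - s`_0) ord0 l in
  Num.sqrt (\det (B *m B^T)) / (#|F|.-1)`!%:R.

(* The normal is that of the facet opposite to the vertex i. *)
Definition outer_normal K i : 'rV[R]_d :=
  xget 0 [set n | [/\ enorm n = 1,
    forall j k, j \in K :\ i -> k \in K :\ i -> dotp n (X j - X k) = 0
  & forall j, j \in K :\ i -> dotp n (X i - X j) < 0]].

(* The angle inside K between the facets opposite to i and j is supplementary to
   the angle between their outward normals. *)
Definition dihedral K i j : R :=
  pi - acos (dotp (outer_normal K i) (outer_normal K j)).

Definition monotone_mesh :=
  forall i j, i != j ->
    0 <= \sum_(K in cells T | (i \in K) && (j \in K))
           (d * d.-1)%:R^-1 * simplex_vol (K :\ i :\ j) *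
           (cos (dihedral K i j) / sin (dihedral K i j)).

Definition vol K : R := fine (lebesgue_rV d (hull K)).

(* Vertex quadrature; [F K] is the integrand on the simplex K, since gradients
   of finite element functions have one value at a vertex per simplex. *)
Definition quad (F : {set 'I_(nvert T)} -> 'rV[R]_d -> R) : R :=
  \sum_(K in cells T) vol K / d.+1%:R * \sum_(i in K) F K (X i).

Definition cell_grad f K : 'rV[R]_d :=
  xget 0 [set g | exists a : R, forall x, hull K x -> f x = a + dotp g x].

Variable D : set 'rV[R]_d.

Definition V0h f :=
  [/\ {within D, continuous f},
      forall x, D x -> ~ D° x -> f x = 0
    & forall K, K \in cells T -> exists (a : R) (g : 'rV[R]_d),
        forall x, hull K x -> f x = a + dotp g x].

Definition interior_vert : {set 'I_(nvert T)} := [set i | `[< D° (X i) >]].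

Definition ndof : nat := #|interior_vert|.

Definition dof (k : 'I_ndof) : 'I_(nvert T) := enum_val k.

Definition nodal f : 'cV[R]_ndof := \col_k f (X (dof k)).

(* Nodal basis; only used for interior vertices i (no such f exists otherwise). *)
Definition hat i : 'rV[R]_d -> R :=
  xget (fun=> 0) [set f | V0h f /\ forall j, f (X j) = (j == i)%:R].

Definition weight (k : 'I_ndof) : R :=
  \sum_(K in cells T | dof k \in K) vol K / d.+1%:R.

Definition massM : 'M[R]_ndof := diag_mx (\row_k weight k).

Definition stiffM : 'M[R]_ndof :=
  \matrix_(k, l) quad (fun K _ =>
    dotp (cell_grad (hat (dof k)) K) (cell_grad (hat (dof l)) K)).

Definition lapl_h : 'M[R]_ndof := - (invmx massM *m stiffM).

Definition diag_cV (v : 'cV[R]_ndof) : 'M[R]_ndof := diag_mx v^T.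

Definition dot_h (u v : 'cV[R]_ndof) : R := (u^T *m massM *m v) ord0 ord0.

Definition hamilt_h V (beta : R) (u : 'cV[R]_ndof) : 'M[R]_ndof :=
  - lapl_h + diag_cV (nodal V) + beta *: diag_cV (map_mx (fun t => t ^+ 2) u).

Definition energy_h V (beta : R) f : R :=
  2^-1 * quad (fun K _ => dotp (cell_grad f K) (cell_grad f K)) +
  2^-1 * quad (fun _ x => V x * f x * f x) +
  beta / 4 * quad (fun _ x => f x ^+ 2 * f x ^+ 2).

Definition ground_state_h V (beta : R) f :=
  [/\ V0h f,
      quad (fun _ x => f x * f x) = 1,
      forall g, V0h g -> quad (fun _ x => g x * g x) = 1 ->
        energy_h V beta f <= energy_h V beta g
    & forall i, D° (X i) -> 0 < f (X i)].

End mesh.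

Definition irreducible_mx (R : realType) n (A : 'M[R]_n) :=
  forall J : {set 'I_n}, J != finset.set0 -> J != [set: 'I_n]%SET ->
    exists i j, [/\ i \in J, j \notin J & A i j != 0].

(* The matrices at hand are self-adjoint for [dot_h], hence have a split
   characteristic polynomial; eigenvalues are counted with multiplicity. *)
Definition second_eigenvalue (R : realType) n (A : 'M[R]_n) (lam : R) :=
  exists s : seq R, [/\ char_poly A = \prod_(a <- s) ('X - a%:P),
    sorted <=%R s, (1 < size s)%N & s`_1 = lam].

(* The family is indexed by an arbitrary type: the lower limit is taken along
   the filter generated by the sets [h i < delta]. *)
Definition liminf_h0 (R : realType) (I : Type) (h a : I -> R) : \bar R :=
  ereal_sup [set ereal_inf [set (a i)%:E | i in [set i | h i < delta]]
            | delta in [set delta : R | 0 < delta]].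

(* Main.v *)
Require Import Defs.
From HB Require Import structures.
From mathcomp Require Import all_boot all_order all_algebra.
From mathcomp Require Import all_classical all_reals all_analysis.
From mathcomp Require Import measurable_realfun ring lra.
Set Implicit Arguments. Unset Strict Implicit. Unset Printing Implicit Defensive.
Import Order.TTheory GRing.Theory Num.Theory.
Import numFieldNormedType.Exports.
Local Open Scope classical_set_scope.
Local Open Scope ring_scope.

(** The argument is purely discrete. Let s_ij be the conductances (minus the off-diagonal
    stiffness coefficients), which the monotonicity constraint makes nonnegative, m_i the lumped
    masses, u the discrete ground state. For v = u t the quadratic form of the linearized
    operator minus lambda_h is 1/2 sum_ij s_ij u_i u_j (t_i - t_j)^2 (ground state transform).
    It must be bounded below, uniformly in h, for normalized v orthogonal to u, although u
    degenerates at the boundary.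

    Testing the equation of u with phi^2 / u, phi a cutoff, bounds the energy of ln u inside the
    cube. Hence chi_K(u), which is 1 where u >= e^-K, 0 where u <= e^-2K and linear in ln u in
    between, has interior energy O(K^-2), and so has t chi_K(u) if t is truncated to [0, 1] and
    the form is small enough. A Poincare inequality on slightly smaller cubes, obtained by
    integrating along segments, then forbids this function to be 1 and 0 on two sets of nodes of
    mass bounded below. For t = 1 this shows that u is small only on a set of small mass. For t a
    truncation of v / u, it contradicts the orthogonality to u, which forces v to be positive and
    negative on sets of mass bounded below, by equi-integrability.

    The gap of the quadratic form gives the gap between the eigenvalues; that lambda_h is a simple
    root of the characteristic polynomial follows by deflating the matrix along u. *)

(** * Change of variables for the Lebesgue measure *)

(** The weight [u i * u j] of the transformed form has no uniform lower bound near the boundary, so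
    no Poincare inequality applies to the form as it stands. What replaces a lower bound is the
    bounded energy of ln u away from the boundary (ln u is infinite on it, hence the cutoff): a
    transition spread over a range K of ln u has K^-2 times that energy. Nonnegative conductances
    allow such estimates edge by edge, but inside a single cell the products of barycentric
    gradients have no sign. Passing from weighted edge sums to cell energies therefore costs h times
    the energy of the truncated function up to the boundary, which is only O(e^(4K)). This fixes the
    order in which constants are chosen: width of the boundary strip, K, size of the form, h. They
    depend on the family of meshes only through the shape constant and one bound [Lam] for the
    energy and eigenvalue of the discrete ground states, obtained from a trial function. In the
    Poincare inequality each segment is cut at its midpoint and each half is charged to its own end,
    because the average over starting points degenerates near the target. *)

Lemma affine_preimage_itvoc (R : realType) (a b c d : R) : 0 < a ->
  (fun t => a * t + b) @^-1` [set` `]c, d]] = [set` `](c - b) / a, (d - b) / a]].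
Proof.
move=> a0; apply/seteqP; split=> t /=; rewrite !in_itv/= ltr_pdivrMr// ler_pdivlMr//.
  by move=> /andP[h1 h2]; apply/andP; split; lra.
by move=> /andP[h1 h2]; apply/andP; split; lra.
Qed.

(** By uniqueness of Lebesgue measure: [a] times its image under the map gives each half-open
    interval its length. *)
Lemma lebesgue_measure_affine_pos (R : realType) (a b : R) (S : set (measurableTypeR R)) :
  0 < a -> measurable S ->
  (a%:E * lebesgue_measure ((fun t => (a * t + b)%R) @^-1` S) = lebesgue_measure S)%E.
Proof.
move=> a0 mS.
pose f : measurableTypeR R -> measurableTypeR R := fun t => a * t + b.
have mf : measurable_fun [set: measurableTypeR R] f.
  by apply: measurable_funD => //; exact: measurable_funM.
rewrite [LHS](_ : _ = mscale (NngNum (ltW a0)) (pushforward lebesgue_measure f) S)//.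
apply/esym/lebesgue_measure_unique => // _ [[c d]] _ <-.
rewrite [RHS](_ : _ = a%:E * lebesgue_measure ((fun t => (a * t + b)%R) @^-1` [set` `]c, d]]))%E//.
rewrite affine_preimage_itvoc// !lebesgue_measure_itv/= !lte_fin.
rewrite ltr_pM2r ?invr_gt0// ltrD2r; case: ifP => cd; last by rewrite mule0.
by rewrite -!EFinD -EFinM; congr EFin; field; rewrite gt_eqF.
Qed.

Lemma lebesgue_measure_affine (R : realType) (a b : R) (S : set (measurableTypeR R)) :
  a != 0 -> measurable S ->
  (`|a|%:E * lebesgue_measure ((fun t => (a * t + b)%R) @^-1` S) = lebesgue_measure S)%E.
Proof.
move=> a0 mS; case: (ltrgtP a 0) a0 => // a0 _; last first.
  by rewrite gtr0_norm// lebesgue_measure_affine_pos.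
have mf : measurable_fun [set: measurableTypeR R]
    ((fun t => - a * t + b) : measurableTypeR R -> measurableTypeR R).
  by apply: measurable_funD => //; exact: measurable_funM.
have mS' : measurable ((fun t => - a * t + b) @^-1` S : set (measurableTypeR R)).
  by rewrite -[X in measurable X]setTI; exact: mf.
rewrite ltr0_norm// -[RHS](@lebesgue_measure_affine_pos _ (- a) b)// ?oppr_gt0//.
rewrite -(lebesgue_measureN mS'); congr (_ * lebesgue_measure _)%E.
by apply/seteqP; split=> t /=; rewrite mulrNN.
Qed.

Lemma measurable_fun_rV_affine (R : realType) (n p : nat) (A : 'M[R]_(n, p)) (b : 'rV[R]_p) :
  measurable_fun [set: 'rV[R]_n] (fun x : 'rV[R]_n => x *m A + b).
Proof.
apply: measurable_fun_rV => i.
rewrite (_ : _ \o _ = fun x : 'rV[R]_n => \sum_k (rV_coord k x * A k i) + b ord0 i).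
  apply: measurable_funD => //; apply: measurable_sum => k.
  by apply: measurable_funM => //; exact: measurable_rV_coord.
by apply/funext => x; rewrite /rV_coord/= !mxE.
Qed.

Lemma measurable_affine_preimage (R : realType) (n p : nat) (A : 'M[R]_(n, p)) (b : 'rV[R]_p) S :
  measurable S -> measurable [set x : 'rV[R]_n | S (x *m A + b)].
Proof. by move=> mS; rewrite -[X in measurable X]setTI; exact: measurable_fun_rV_affine. Qed.

Lemma lebesgue_rV_xsection (R : realType) n (S : set 'rV[R]_n.+1) :
  lebesgue_rV n.+1 S =
  (\int[lebesgue_measure]_t lebesgue_rV n [set y | S (cons_rV (t, y))])%E.
Proof.
rewrite /= /cons_measure /pushforward /product_measure1; apply: eq_integral => t _ /=.
by congr (lebesgue_rV n _); apply/seteqP; split=> y; rewrite /xsection/= inE.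
Qed.

(** The measure is built from slices of fixed first coordinate; uniqueness of the product measure
    also allows slicing by lines parallel to the first axis, as maps acting on that coordinate
    require. *)
Lemma lebesgue_rV_ysection (R : realType) n (S : set 'rV[R]_n.+1) : measurable S ->
  lebesgue_rV n.+1 S =
  (\int[lebesgue_rV n]_y lebesgue_measure [set t | S (cons_rV (t, y))])%E.
Proof.
move=> mS; have mS' : measurable (@cons_rV R n @^-1` S).
  by rewrite -[X in measurable X]setTI; exact: measurable_cons_rV.
transitivity ((@lebesgue_measure R \x^ lebesgue_rV n)%E (@cons_rV R n @^-1` S)).
  rewrite /= /cons_measure /pushforward.
  apply: (@product_measure_unique _ _ _ _ _ lebesgue_measure (lebesgue_rV n) (@lebesgue_measure R \x^ lebesgue_rV n)%E) => //= A1 A2 mA1 mA2; exact: product_measure2E.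
rewrite /product_measure2; apply: eq_integral => t _ /=.
by congr (lebesgue_measure _); apply/seteqP; split=> y; rewrite /ysection/= inE.
Qed.

Lemma cons_rVE (R : realType) n (t : R) (y : 'rV[R]_n) :
  cons_rV (t, y) = row_mx t%:M y :> 'rV_(1 + n).
Proof.
apply/rowP => j; rewrite mxE; case: (unliftP ord0 j) => [k|] -> /=.
  have -> : lift ord0 k = rshift 1 k by apply/val_inj; rewrite /= /bump.
  by rewrite row_mxEr.
have -> : (ord0 : 'I_(1 + n)) = lshift n (ord0 : 'I_1) by apply/val_inj.
by rewrite row_mxEl mxE.
Qed.

Lemma measurable_cons_preimage (R : realType) n (S : set 'rV[R]_n.+1) :
  measurable S -> measurable (@cons_rV R n @^-1` S).
Proof. by move=> mS; rewrite -[X in measurable X]setTI; exact: measurable_cons_rV. Qed.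

Lemma measurable_lebesgue_rV_xsection (R : realType) n (S : set 'rV[R]_n.+1) : measurable S ->
  measurable_fun [set: R] (fun t => lebesgue_rV n [set y | S (cons_rV (t, y))]).
Proof.
move=> /measurable_cons_preimage /(measurable_fun_xsection (lebesgue_rV n)).
rewrite (_ : (_ \o _) = fun t => lebesgue_rV n [set y | S (cons_rV (t, y))])//.
by apply/funext => t /=; congr (lebesgue_rV n _); apply/seteqP; split=> y; rewrite /xsection/= inE.
Qed.

Lemma measurable_lebesgue_rV_ysection (R : realType) n (S : set 'rV[R]_n.+1) : measurable S ->
  measurable_fun [set: 'rV[R]_n] (fun y => lebesgue_measure [set t | S (cons_rV (t, y))]).
Proof.
move=> /measurable_cons_preimage /(measurable_fun_ysection (@lebesgue_measure R)).
rewrite (_ : (_ \o _) = fun y => lebesgue_measure [set t | S (cons_rV (t, y))])//.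
by apply/funext => t /=; congr (lebesgue_measure _); apply/seteqP; split=> y; rewrite /ysection/= inE.
Qed.

Lemma measurable_cons_xsection (R : realType) n (S : set 'rV[R]_n.+1) t :
  measurable S -> measurable [set y | S (cons_rV (t, y))].
Proof.
move=> /measurable_cons_preimage /(measurable_xsection t).
by rewrite /xsection/=; congr measurable; apply/seteqP; split=> y; rewrite /= inE.
Qed.

Lemma measurable_cons_ysection (R : realType) n (S : set 'rV[R]_n.+1) y :
  measurable S -> measurable ([set t | S (cons_rV (t, y))] : set (measurableTypeR R)).
Proof.
move=> /measurable_cons_preimage /(measurable_ysection y).
by rewrite /ysection/=; congr measurable; apply/seteqP; split=> t; rewrite /= inE.
Qed.

Lemma lebesgue_rV_translation (R : realType) n (b : 'rV[R]_n) (S : set 'rV[R]_n) :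
  measurable S -> lebesgue_rV n [set x | S (x + b)] = lebesgue_rV n S.
Proof.
elim: n b S => [b S mS|n IHn b S mS].
  by congr (lebesgue_rV 0 _); apply/seteqP; split => x /=; rewrite (_ : x + b = x)//;
    apply/rowP => -[].
have mtr (a : 'rV[R]_n.+1) T : measurable T -> measurable [set x | T (x + a)].
  move=> /(measurable_affine_preimage 1%:M a); congr measurable.
  by apply/seteqP; split=> x /=; rewrite mulmx1.
(* The translation is split into one along the first axis, handled on lines, and one in the other
   coordinates, handled on slices by induction. *)
pose b1 : 'rV[R]_n.+1 := cons_rV (b ord0 ord0, 0).
pose b2 : 'rV[R]_n.+1 := cons_rV (0, \row_j b ord0 (lift ord0 j)).
have bE x : x + b = x + b1 + b2.
  rewrite -addrA; congr (_ + _); apply/rowP => j; rewrite !mxE; case: (unliftP ord0 j) => [k|] -> /=.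
    by rewrite !mxE add0r.
  by rewrite addr0.
have consD (s t : R) (x y : 'rV[R]_n) : cons_rV (s, x) + cons_rV (t, y) = cons_rV (s + t, x + y).
  by apply/rowP => j; rewrite !mxE; case: unliftP => [k|] _ //=; rewrite !mxE.
transitivity (lebesgue_rV n.+1 [set x | S (x + b2)]).
  rewrite (lebesgue_rV_ysection (mtr b S mS)) (lebesgue_rV_ysection (mtr b2 S mS)).
  apply: eq_integral => y _.
  rewrite -[RHS](@lebesgue_measure_affine _ 1 (b ord0 ord0))//; last first.
    by apply: (measurable_cons_ysection (S := [set x | S (x + b2)])); exact: mtr.
  rewrite normr1 mul1e; congr (lebesgue_measure _).
  have E t : cons_rV (t, y) + b = cons_rV (1 * t + b ord0 ord0, y) + b2.
    by rewrite bE consD addr0 mul1r.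
  by apply/seteqP; split=> t /=; rewrite E.
rewrite lebesgue_rV_xsection [RHS]lebesgue_rV_xsection; apply: eq_integral => t _.
rewrite -[RHS](IHn (\row_j b ord0 (lift ord0 j))); last exact: measurable_cons_xsection.
congr (lebesgue_rV n _).
have E y : cons_rV (t, y) + b2 = cons_rV (t, y + \row_j b ord0 (lift ord0 j)).
  by rewrite consD addr0.
by apply/seteqP; split=> y /=; rewrite E.
Qed.

(** The determinant stands on the side of the preimage, so that the property passes to products of
    matrices without any inverse. *)
Definition scales_lebesgue (R : realType) n (A : 'M[R]_n) := forall S : set 'rV[R]_n,
  measurable S -> (`|\det A|%:E * lebesgue_rV n [set x | S (x *m A)] = lebesgue_rV n S)%E.

Lemma measurable_mulmx_preimage (R : realType) n p (A : 'M[R]_(n, p)) S :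
  measurable S -> measurable [set x : 'rV[R]_n | S (x *m A)].
Proof.
move=> /(measurable_affine_preimage A 0); congr measurable.
by apply/seteqP; split=> x /=; rewrite addr0.
Qed.

Lemma scales_lebesgueM (R : realType) n (A B : 'M[R]_n) :
  scales_lebesgue A -> scales_lebesgue B -> scales_lebesgue (A *m B).
Proof.
move=> hA hB S mS; rewrite -(hB S mS) -(hA [set x | S (x *m B)])//; last first.
  exact: measurable_mulmx_preimage.
rewrite det_mulmx normrM mulrC EFinM muleA; congr (_ * lebesgue_rV n _)%E.
by apply/seteqP; split=> x /=; rewrite mulmxA.
Qed.

(** On the slice of first coordinate [t] the map sends [y] to [y *m A + t *: v]: the hypothesis on
    [A] up to a translation. *)
Lemma scales_lebesgue_ublock (R : realType) n (v : 'rV[R]_n) (A : 'M[R]_n) :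
  scales_lebesgue A -> scales_lebesgue (block_mx 1%:M v 0 A : 'M[R]_(1 + n)).
Proof.
move=> hA S mS; have mS' := measurable_mulmx_preimage (block_mx 1%:M v 0 A : 'M[R]_(1 + n)) mS.
rewrite (@det_ublock _ 1 n) det1 mul1r (@lebesgue_rV_xsection _ n) [RHS]lebesgue_rV_xsection.
rewrite -ge0_integralZl//; last exact: (measurable_lebesgue_rV_xsection mS').
apply: eq_integral => t _.
rewrite -(lebesgue_rV_translation (t *: v) (measurable_cons_xsection t mS)).
rewrite -[RHS]hA; last first.
  have := measurable_affine_preimage 1%:M (t *: v) (measurable_cons_xsection t mS).
  by congr measurable; apply/seteqP; split=> y /=; rewrite mulmx1.
congr (_ * lebesgue_rV n _)%E.
have E y : cons_rV (t, y) *m (block_mx 1%:M v 0 A : 'M[R]_(1 + n)) = cons_rV (t, y *m A + t *: v).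
  rewrite !cons_rVE (@mul_row_block _ 1 1 n 1 n) mulmx1 mulmx0 addr0 addrC mul_scalar_mx.
  by rewrite addrC.
by apply/seteqP; split=> y /=; rewrite E.
Qed.

(** On each line parallel to the first axis the map is affine with slope [a], which is the
    one-dimensional formula. *)
Lemma scales_lebesgue_lblock (R : realType) n (a : R) (w : 'cV[R]_n) : a != 0 ->
  scales_lebesgue (block_mx a%:M 0 w 1%:M : 'M[R]_(1 + n)).
Proof.
move=> a0 S mS; have mS' := measurable_mulmx_preimage (block_mx a%:M 0 w 1%:M : 'M[R]_(1 + n)) mS.
rewrite (@det_lblock _ 1 n) det1 mulr1 det_scalar1.
rewrite (lebesgue_rV_ysection mS) [X in (_ * X)%E](lebesgue_rV_ysection mS').
rewrite -ge0_integralZl//; last exact: (measurable_lebesgue_rV_ysection mS').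
apply: eq_integral => y _.
rewrite -(lebesgue_measure_affine ((y *m w) ord0 ord0) a0 (measurable_cons_ysection y mS)).
congr (_ * lebesgue_measure _)%E.
have E t : cons_rV (t, y) *m (block_mx a%:M 0 w 1%:M : 'M[R]_(1 + n)) =
    cons_rV (a * t + (y *m w) ord0 ord0, y).
  rewrite !cons_rVE (@mul_row_block _ 1 1 n 1 n) mulmx1 mulmx0 add0r; congr row_mx.
  by rewrite -scalar_mxM [y *m w]mx11_scalar -raddfD/= mulrC !mxE eqxx.
by apply/seteqP; split=> t /=; rewrite E.
Qed.

(** Gaussian elimination: a matrix with nonzero corner is a lower block factor times an upper one
    containing the Schur complement, to which induction applies; a zero corner is repaired by a
    shear. *)
Lemma scales_lebesgue_unitmx (R : realType) n (A : 'M[R]_n) : A \in unitmx -> scales_lebesgue A.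
Proof.
elim: n A => [A _ S mS|n IHn A].
  rewrite det_mx00 normr1 mul1e; congr (lebesgue_rV 0 _).
  by apply/seteqP; split=> x /=; rewrite (_ : x *m A = x)//; apply/rowP => -[].
have pivot (B : 'M[R]_(1 + n)) : B ord0 ord0 != 0 -> B \in unitmx -> scales_lebesgue B.
  move=> b0 uB; set a := B ord0 ord0 in b0.
  pose v := ursubmx B; pose w := dlsubmx B; pose D := drsubmx B.
  have Bul : ulsubmx B = a%:M.
    by rewrite [ulsubmx B]mx11_scalar; congr (_%:M); rewrite !mxE; congr (B _ _); apply/val_inj.
  have BE : B = block_mx a%:M 0 w 1%:M *m block_mx 1%:M (a^-1 *: v) 0 (D - a^-1 *: (w *m v)).
    rewrite mulmx_block !mulmx1 !mul0mx !mul1mx !addr0 mul_scalar_mx scalerA mulfV// scale1r.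
    by rewrite -scalemxAr addrC subrK -Bul submxK.
  rewrite BE; apply: scales_lebesgueM; first exact: scales_lebesgue_lblock.
  apply: scales_lebesgue_ublock; apply: IHn.
  move: uB; rewrite BE unitmx_mul => /andP[_].
  by rewrite unitmxE (@det_ublock _ 1 n) det1 mul1r -unitmxE.
move=> uA; have [|A00] := boolP (A ord0 ord0 == 0); last exact: pivot.
move/eqP=> A00.
have [k Ak] : exists k : 'I_n, A (lift ord0 k) ord0 != 0.
  apply/existsP; apply: contraLR uA => /existsPn A0.
  rewrite unitmxE unitfE negbK (expand_det_col _ ord0) big1// => i _.
  case: (unliftP ord0 i) => [k|] ->; last by rewrite A00 mul0r.
  by have := A0 k; rewrite negbK => /eqP ->; rewrite mul0r.
(* Left multiplication by [E] adds to the first row a row whose first entry is nonzero; [E'] undoes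
   it. *)
pose E : 'M[R]_(1 + n) := block_mx 1%:M (delta_mx ord0 k) 0 1%:M.
pose E' : 'M[R]_(1 + n) := block_mx 1%:M (- delta_mx ord0 k) 0 1%:M.
have E'E : E' *m E = 1%:M.
  rewrite mulmx_block !mulmx1 !mul0mx !mulmx0 !mul1mx !addr0 add0r subrr.
  by rewrite -scalar_mx_block.
rewrite -[A]mul1mx -E'E -mulmxA; apply: scales_lebesgueM.
  by apply/scales_lebesgue_ublock/IHn; rewrite unitmx1.
have Er j : E ord0 (rshift 1 j) = (j == k)%:R.
  have -> : E ord0 (rshift 1 j) = E (lshift n ord0) (rshift 1 j) by congr (E _ _); exact/val_inj.
  by rewrite /E block_mxEur mxE eqxx.
have El : A (lshift n (ord0 : 'I_1)) ord0 = 0 by rewrite -A00; congr (A _ _); exact/val_inj.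
apply: pivot.
  rewrite mxE (@big_split_ord _ _ _ 1 n)/= big_ord1 (bigD1 k)//= big1 ?addr0.
    rewrite El mulr0 add0r Er eqxx mul1r.
    by rewrite (_ : rshift 1 k = lift ord0 k)//; exact/val_inj.
  by move=> i ik; rewrite Er (negPf ik) mul0r.
by rewrite unitmx_mul uA andbT; case/mulmx1_unit: E'E.
Qed.

Lemma lebesgue_rV_affine (R : realType) n (A : 'M[R]_n) (b : 'rV[R]_n) (S : set 'rV[R]_n) :
  A \in unitmx -> measurable S ->
  (`|\det A|%:E * lebesgue_rV n [set x | S (x *m A + b)%R] = lebesgue_rV n S)%E.
Proof.
move=> uA mS; rewrite -(lebesgue_rV_translation b mS) -[RHS](scales_lebesgue_unitmx uA)//.
have := measurable_affine_preimage 1%:M b mS.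
by congr measurable; apply/seteqP; split=> y /=; rewrite mulmx1.
Qed.

(** * Energies along segments *)

Lemma lebesgue_rV_homothety (R : realType) n (S : set 'rV[R]_n) (z : 'rV[R]_n) (r q : R) :
  r != 0 -> measurable S ->
  ((`|r| ^+ n)%:E * lebesgue_rV n [set x | S (r *: x + q *: z)%R] = lebesgue_rV n S)%E.
Proof.
move=> r0 mS; rewrite -(@lebesgue_rV_affine _ _ r%:M (q *: z) S) ?det_scalar ?normrX//; last first.
  by rewrite unitmxE det_scalar unitfE expf_neq0.
by congr (_ * lebesgue_rV n _)%E; apply/seteqP; split=> x /=; rewrite mul_mx_scalar.
Qed.

Lemma measurable_fun_segment (R : realType) n d (T : measurableType d) (l : R)
    (s : T -> R) (x z : T -> 'rV[R]_n) :
  measurable_fun setT s -> measurable_fun setT x -> measurable_fun setT z ->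
  measurable_fun setT (fun t => (1 - s t * l) *: x t + (s t * l) *: z t).
Proof.
move=> ms mx mz; apply: measurable_fun_rV => i.
rewrite (_ : _ \o _ = fun t => (1 - s t * l) * rV_coord i (x t) + (s t * l) * rV_coord i (z t)).
  have mc (y : T -> 'rV[R]_n) : measurable_fun setT y -> measurable_fun setT (rV_coord i \o y).
    by move=> my; apply: measurableT_comp => //; exact: measurable_rV_coord.
  have msl : measurable_fun setT (fun t => s t * l) by exact: measurable_funM.
  apply: measurable_funD; apply: measurable_funM => //; try exact: mc.
  exact: measurable_funB.
by apply/funext => t; rewrite /rV_coord/= !mxE.
Qed.

(** The point goes from [x] to [(1 - l) *: x + l *: z] in unit time. Stopping at [l <= 1 / 2] keeps
    the coefficient of [x] at least 1/2. *)
Definition seg_time (R : realType) n (B : set 'rV[R]_n) (l : R) (x z : 'rV[R]_n) : \bar R :=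
  lebesgue_measure [set s : R | 0 <= s <= 1 /\ B ((1 - s * l) *: x + (s * l) *: z)].

Lemma measurable_seg_time (R : realType) n (B : set 'rV[R]_n) (l : R) d (T : measurableType d)
    (x z : T -> 'rV[R]_n) : measurable B -> measurable_fun setT x -> measurable_fun setT z ->
  measurable_fun setT (fun t => seg_time B l (x t) (z t)).
Proof.
move=> mB mx mz.
pose E : set (T * measurableTypeR R) :=
  [set p | 0 <= p.2 <= 1 /\ B ((1 - p.2 * l) *: x p.1 + (p.2 * l) *: z p.1)].
have mE : measurable E.
  have -> : E = (snd @^-1` [set` `[0, 1]]) `&`
      ((fun p => (1 - p.2 * l) *: x p.1 + (p.2 * l) *: z p.1) @^-1` B).
    by apply/seteqP; split=> p /=; rewrite in_itv.
  apply: measurableI; rewrite -[X in measurable X]setTI.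
    exact: measurable_snd.
  apply: (measurable_fun_segment _ (s := snd) (x := x \o fst) (z := z \o fst)) => //.
  + by apply: measurableT_comp => //; exact: measurable_fst.
  + by apply: measurableT_comp => //; exact: measurable_fst.
have := measurable_fun_xsection (@lebesgue_measure R) mE.
rewrite (_ : _ \o _ = fun t => seg_time B l (x t) (z t))//.
by apply/funext => t; congr lebesgue_measure; apply/seteqP; split=> s; rewrite /xsection/= inE.
Qed.

Lemma seg_time_ge0 (R : realType) n (B : set 'rV[R]_n) (l : R) x z : (0 <= seg_time B l x z)%E.
Proof. exact: measure_ge0. Qed.

(* Tonelli: for each time s the map x |-> (1 - s l) x + s l z contracts volumes by at most 2^n. *)
Lemma integral_seg_time_le (R : realType) n (B : set 'rV[R]_n) (l : R) (z : 'rV[R]_n) :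
  measurable B -> 0 <= l <= 1 / 2 ->
  (\int[lebesgue_rV n]_x seg_time B l x z <= (2 ^+ n)%:E * lebesgue_rV n B)%E.
Proof.
move=> mB /andP[l0 l1].
pose E : set (measurableTypeR R * 'rV[R]_n) :=
  [set p | 0 <= p.1 <= 1 /\ B ((1 - p.1 * l) *: p.2 + (p.1 * l) *: z)].
have mE : measurable E.
  have -> : E = (fst @^-1` [set` `[0, 1]]) `&`
      ((fun p => (1 - p.1 * l) *: p.2 + (p.1 * l) *: z) @^-1` B).
    by apply/seteqP; split=> p /=; rewrite in_itv.
  apply: measurableI; rewrite -[X in measurable X]setTI.
    exact: measurable_fst.
  apply: (measurable_fun_segment _ (s := fst) (x := snd) (z := cst z)) => //.
have -> : (\int[lebesgue_rV n]_x seg_time B l x z =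
    \int[lebesgue_measure]_s lebesgue_rV n (xsection E s))%E.
  transitivity ((@lebesgue_measure R \x^ lebesgue_rV n)%E E).
    rewrite /product_measure2; apply: eq_integral => t _ /=.
    by congr (lebesgue_measure _); apply/seteqP; split=> y; rewrite /ysection/= inE.
  apply/esym; apply: (@product_measure_unique _ _ _ _ _ lebesgue_measure (lebesgue_rV n)
    (@lebesgue_measure R \x^ lebesgue_rV n)%E) => //= A1 A2 mA1 mA2; exact: product_measure2E.
apply: (@le_trans _ _ (\int[@lebesgue_measure R]_s (((2 ^+ n)%:E * lebesgue_rV n B) * (\1_(`[0, 1]) s)%:E))%E).
  apply: ge0_le_integral => //.
  - exact: (measurable_fun_xsection (lebesgue_rV n) mE).
  - by apply: emeasurable_funM => //; exact/measurable_EFinP.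
  move=> s _; rewrite indicE.
  have [|s01] := boolP (s \in [set` `[0, 1]]).
    rewrite mem_setE in_itv/= => /andP[s0 s1]; rewrite mule1.
    have r0 : 1 / 2 <= 1 - s * l by nra.
    have rn0 : 1 - s * l != 0 by apply: lt0r_neq0; lra.
    rewrite -(lebesgue_rV_homothety z (s * l) rn0 mB) muleA -[leLHS]mul1e.
    rewrite (_ : xsection E s = [set x | B ((1 - s * l) *: x + (s * l) *: z)]); last first.
      apply/seteqP; split=> x; rewrite /xsection/= inE; first by case.
      by move=> Bx; split => //; apply/andP.
    apply: lee_wpmul2r; first exact: measure_ge0.
    rewrite lee_fin -exprMn ger0_norm; last lra.
    by apply: exprn_ege1; lra.
  rewrite mule0 (_ : xsection E s = set0) ?measure0//.
  apply/seteqP; split=> x //; rewrite /xsection/= inE => -[s0 _].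
  by move: s01; rewrite mem_setE in_itv/= s0.
rewrite ge0_integralZl//; last 2 first.
  - exact/measurable_EFinP.
  - by apply: mule_ge0 => //; rewrite lee_fin exprn_ge0.
rewrite integral_indic// setIT [X in (_ * X)%E](_ : _ = 1%E) ?mule1//.
transitivity (@lebesgue_measure R `[0, 1]%classic) => //.
by rewrite lebesgue_measure_itv/= lte_fin ltr01 oppr0 adde0.
Qed.

Lemma measurable_fun_rVS (R : realType) n (D : set 'rV[R]_n) (f : 'rV[R]_n -> \bar R) :
  measurable_fun setT f -> measurable_fun D f.
Proof. by move=> mf; apply: (measurable_funS measurableT (@subsetT _ D)); exact: mf. Qed.

Lemma sum_integral_trivIset_le (R : realType) d (T : measurableType d)
    (mu : {measure set T -> \bar R}) (I : finType) (C : I -> set T) (f : T -> \bar R) :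
  (forall i, measurable (C i)) -> trivIset setT C -> measurable_fun setT f ->
  (forall x, (0 <= f x)%E) ->
  (\sum_(i : I) \int[mu]_(x in C i) f x <= \int[mu]_x f x)%E.
Proof.
move=> mC tC mf f0; rewrite -ge0_integral_bigsetU//.
- apply: ge0_subset_integral => //.
  by apply: bigsetU_measurable => i _; exact: mC.
- exact: index_enum_uniq.
- exact: sub_trivIset tC.
- exact: measurable_funS mf.
Qed.

Lemma restrict_indic (R : realType) (T : Type) (D : set T) (h : T -> \bar R) :
  h \_ D = (fun t => h t * (\1_D t)%:E)%E.
Proof. by apply/funext => t; rewrite patchE indicE; case: ifP => _; rewrite ?mule1 ?mule0. Qed.

Section integral_rect.
Context (R : realType) d1 d2 (T1 : measurableType d1) (T2 : measurableType d2).
Variables (m1 : {sigma_finite_measure set T1 -> \bar R}) (m2 : {sigma_finite_measure set T2 -> \bar R}).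
Variables (A : set T1) (B : set T2) (f : T1 -> T2 -> \bar R).
Hypotheses (mA : measurable A) (mB : measurable B).
Hypothesis mf : measurable_fun setT (fun p => f p.1 p.2).
Hypothesis f0 : forall x y, (0 <= f x y)%E.

Let mA1 : measurable_fun setT (fun p : T1 * T2 => (\1_A p.1)%:E : \bar R).
Proof. by apply/measurable_EFinP; exact: (measurableT_comp (measurable_indic mA) measurable_fst). Qed.

Let mB2 : measurable_fun setT (fun p : T1 * T2 => (\1_B p.2)%:E : \bar R).
Proof. by apply/measurable_EFinP; exact: (measurableT_comp (measurable_indic mB) measurable_snd). Qed.

Lemma measurable_fun_integral_rect : measurable_fun setT (fun x => \int[m2]_(y in B) f x y)%E.
Proof.
rewrite (_ : (fun x => _) = fubini_F m2 (fun p => f p.1 p.2 * (\1_B p.2)%:E)%E).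
  apply: measurable_fun_fubini_tonelli_F; first exact: emeasurable_funM.
  by move=> p; rewrite mule_ge0.
by apply/funext => x; rewrite integral_mkcond restrict_indic.
Qed.

Lemma integral_rect_swap :
  (\int[m1]_(x in A) \int[m2]_(y in B) f x y = \int[m2]_(y in B) \int[m1]_(x in A) f x y)%E.
Proof.
pose g (p : T1 * T2) := (f p.1 p.2 * ((\1_A p.1)%:E * (\1_B p.2)%:E))%E.
have mg : measurable_fun setT g by do 2 apply: emeasurable_funM => //.
have g0 p : (0 <= g p)%E by rewrite !mule_ge0.
rewrite integral_mkcond [RHS]integral_mkcond.
transitivity (\int[m1]_x \int[m2]_y g (x, y))%E; last rewrite fubini_tonelli//.
  apply: eq_integral => x _; rewrite restrict_indic indicE.
  have [xA|xA] := boolP (x \in A); last first.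
    by rewrite mule0 integral0_eq// => y _; rewrite /g indicE (negPf xA)/= mul0e mule0.
  rewrite mule1 integral_mkcond restrict_indic; apply: eq_integral => y _.
  by rewrite /g [\1_A _]indicE xA mul1e.
apply: eq_integral => y _; rewrite restrict_indic indicE.
have [yB|yB] := boolP (y \in B); last first.
  by rewrite mule0 integral0_eq// => x _; rewrite /g indicE [\1_B _]indicE (negPf yB)/= !mule0.
rewrite [RHS]mule1 [RHS]integral_mkcond restrict_indic; apply: eq_integral => x _.
by rewrite /g [\1_B _]indicE yB mule1.
Qed.
End integral_rect.

Lemma affine_le_integral_rect (R : realType) d1 d2 (T1 : measurableType d1) (T2 : measurableType d2)
    (m1 : {sigma_finite_measure set T1 -> \bar R}) (m2 : {sigma_finite_measure set T2 -> \bar R})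
    (A : set T1) (B : set T2) (f g : T1 -> T2 -> \bar R) (a b r K ga : R) :
  measurable A -> measurable B ->
  measurable_fun setT (fun p => f p.1 p.2) -> measurable_fun setT (fun p => g p.1 p.2) ->
  (forall x y, (0 <= f x y)%E) -> (forall x y, (0 <= g x y)%E) ->
  m1 A = a%:E -> m2 B = b%:E -> 0 <= r -> 0 <= K -> 0 <= ga ->
  (forall x y, A x -> B y -> (r%:E <= K%:E + ga%:E * (f x y + g x y))%E) ->
  ((r * a * b)%:E <= (K * a * b)%:E + ga%:E * (\int[m1]_(x in A) \int[m2]_(y in B) f x y +
     \int[m1]_(x in A) \int[m2]_(y in B) g x y))%E.
Proof.
move=> mA mB mf mg f0 g0 m1A m2B r0 K0 ga0 hr.
have mfS d (T : measurableType d) (D : set T) (h : T -> \bar R) :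
    measurable_fun setT h -> measurable_fun D h.
  by move=> mh; apply: (measurable_funS measurableT (@subsetT _ D)); exact: mh.
have iA (s : \bar R) : (\int[m1]_(x in A) s = s * a%:E)%E by rewrite -m1A -(integral_cst _ mA).
have iB (s : \bar R) : (\int[m2]_(x in B) s = s * b%:E)%E by rewrite -m2B -(integral_cst _ mB).
have mfx x : measurable_fun setT (f x) by exact: (measurable_fun_pair2 x mf).
have mgx x : measurable_fun setT (g x) by exact: (measurable_fun_pair2 x mg).
have miF := measurable_fun_integral_rect m2 mB mf f0.
have miG := measurable_fun_integral_rect m2 mB mg g0.
have if0 x : (0 <= \int[m2]_(y in B) f x y)%E by apply: integral_ge0 => y _; exact: f0.
have ig0 x : (0 <= \int[m2]_(y in B) g x y)%E by apply: integral_ge0 => y _; exact: g0.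
have ga0' : (0 <= ga%:E)%E by rewrite lee_fin.
have ifg0 x := adde_ge0 (if0 x) (ig0 x).
have B0 x y : (0 <= f x y + g x y)%E by rewrite adde_ge0.
have inner x : (\int[m2]_(y in B) (K%:E + ga%:E * (f x y + g x y)) =
    (K * b)%:E + ga%:E * (\int[m2]_(y in B) f x y + \int[m2]_(y in B) g x y))%E.
  rewrite ge0_integralD//; last 2 first.
  - by move=> y _; rewrite mule_ge0// lee_fin.
  - by apply: mfS; apply: measurable_funeM; exact: emeasurable_funD.
  rewrite iB -EFinM; congr (_ + _)%E.
  rewrite ge0_integralZl//; last by apply: mfS; exact: emeasurable_funD.
  by rewrite ge0_integralD//; exact: mfS.
have E (s : R) : (s * a * b)%:E = (\int[m1]_(x in A) \int[m2]_(y in B) cst s%:E y)%E.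
  under eq_integral => x _ do rewrite iB -EFinM.
  by rewrite iA -EFinM mulrAC.
apply: (@le_trans _ _ (\int[m1]_(x in A) ((K * b)%:E + ga%:E *
    (\int[m2]_(y in B) f x y + \int[m2]_(y in B) g x y)))%E).
  rewrite E; apply: ge0_le_integral => //.
  - by move=> x _; apply: integral_ge0 => y _; rewrite lee_fin.
  - apply: mfS; apply: emeasurable_funD => //; apply: measurable_funeM.
    exact: emeasurable_funD.
  move=> x Ax; rewrite -inner; apply: ge0_le_integral => //.
  - apply: mfS; apply: emeasurable_funD => //; apply: measurable_funeM.
    exact: emeasurable_funD.
  - by move=> y By; exact: hr.
have b0 : 0 <= b by rewrite -lee_fin -m2B measure_ge0.
rewrite ge0_integralD//; last 3 first.
- by move=> x _; rewrite lee_fin mulr_ge0.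
- by move=> x _; exact: mule_ge0 ga0' (ifg0 x).
- by apply: mfS; apply: measurable_funeM; exact: emeasurable_funD.
rewrite iA -EFinM mulrAC.
rewrite ge0_integralZl//; last by apply: mfS; exact: emeasurable_funD.
rewrite ge0_integralD//.
- exact: mfS miF.
- exact: mfS miG.
Qed.

(** * Poincare and equi-integrability inequalities over disjoint cells *)

Section cell_inequalities.
Variables (R : realType) (n : nat) (I : finType).
Variables (C H : I -> set 'rV[R]_n) (vol c : I -> R).
Local Notation mu := (@lebesgue_rV R n).
Hypothesis mC : forall i, measurable (C i).
Hypothesis mH : forall i, measurable (H i).
Hypothesis tC : trivIset setT C.
Hypothesis volC : forall i, mu (C i) = (vol i)%:E.
Hypothesis volH : forall i, mu (H i) = (vol i)%:E.
Hypothesis c0 : forall i, 0 <= c i.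

(** Time integral, along the truncated segment, of the density equal to [c j] on [H j]. The sets
    [C i] are disjoint and serve to integrate over starting points; the [H i] will be the closed
    cells, of the same volumes. *)
Definition path_energy (l : R) (x z : 'rV[R]_n) : \bar R :=
  (\sum_j (c j)%:E * seg_time (H j) l x z)%E.

Let pe_ge0 l x z : (0 <= path_energy l x z)%E.
Proof. by apply: sume_ge0 => j _; rewrite mule_ge0// ?lee_fin// seg_time_ge0. Qed.

Let mpe l d (T : measurableType d) (x z : T -> 'rV[R]_n) :
  measurable_fun setT x -> measurable_fun setT z ->
  measurable_fun setT (fun t => path_energy l (x t) (z t)).
Proof.
move=> mx mz; apply: emeasurable_sum => j.
by apply: measurable_funeM; exact: measurable_seg_time.
Qed.

Let vol0 i : 0 <= vol i.
Proof. by rewrite -lee_fin -volC measure_ge0. Qed.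

Let intC (r : \bar R) k : (\int[mu]_(x in C k) r = r * (vol k)%:E)%E.
Proof. by rewrite -volC -(integral_cst _ (mC k)). Qed.

Lemma integral_path_energy_le (l : R) (z : 'rV[R]_n) : 0 <= l <= 1 / 2 ->
  (\sum_k \int[mu]_(x in C k) path_energy l x z <= (2 ^+ n * \sum_j c j * vol j)%:E)%E.
Proof.
move=> hl.
apply: (le_trans (sum_integral_trivIset_le mu mC tC _ _)) => //.
  exact: (mpe l (@measurable_id _ _ setT) (measurable_cst z)).
rewrite /path_energy ge0_integral_sum//; last first.
- by move=> j x _; rewrite mule_ge0// ?lee_fin// seg_time_ge0.
- by move=> j; apply: measurable_funeM; exact: measurable_seg_time.
rewrite mulr_sumr -sumEFin; apply: lee_sum => j _.
rewrite ge0_integralZl//; last 2 first.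
- exact: (measurable_seg_time l (mH j) (@measurable_id _ _ setT) (measurable_cst z)).
- by rewrite lee_fin.
rewrite mulrCA EFinM; apply: lee_wpmul2l; first by rewrite lee_fin.
by apply: (le_trans (integral_seg_time_le z (mH j) hl)); rewrite volH EFinM.
Qed.

(** Integrate the hypothesis over [C k] times [C k'] and sum over all pairs. The two path terms have
    equal integrals by exchange of [x] and [z], and each is bounded by Tonelli with its target
    fixed. In the application [p] and [q] are the densities of two sets of nodes. *)
Lemma poincare_cells (p q : I -> R) (al ga : R) :
  0 <= al -> 0 <= ga -> (forall k, 0 <= p k) -> (forall k, 0 <= q k) ->
  (forall k k' x z, C k x -> C k' z ->
    ((p k * q k')%:E <= (al * (c k + c k'))%:E +
       ga%:E * (path_energy (1 / 2) x z + path_energy (1 / 2) z x))%E) ->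
  (\sum_k p k * vol k) * (\sum_k q k * vol k) <=
  2 * (al + ga * 2 ^+ n) * (\sum_k c k * vol k) * (\sum_k vol k).
Proof.
move=> al0 ga0 p0 q0 hpq.
have l01 : (0 : R) <= (1 / 2 : R) <= (1 / 2 : R) by apply/andP; split; lra.
pose S1 := (\sum_k \sum_k' \int[mu]_(x in C k) \int[mu]_(z in C k') path_energy (1 / 2) x z)%E.
pose S2 := (\sum_k \sum_k' \int[mu]_(x in C k) \int[mu]_(z in C k') path_energy (1 / 2) z x)%E.
have mpe1 : measurable_fun setT (fun t : 'rV[R]_n * 'rV[R]_n => path_energy (1 / 2) t.1 t.2).
  by apply: mpe.
have mpe2 : measurable_fun setT (fun t : 'rV[R]_n * 'rV[R]_n => path_energy (1 / 2) t.2 t.1).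
  by apply: mpe.
have mpx z : measurable_fun setT (fun x => path_energy (1 / 2) x z) by apply: mpe.
have mpz x : measurable_fun setT (fun z => path_energy (1 / 2) x z) by apply: mpe.
have i0 (D : set 'rV[R]_n) (f : 'rV[R]_n -> \bar R) : (forall x, 0 <= f x)%E -> (0 <= \int[mu]_(x in D) f x)%E.
  by move=> f0; apply: integral_ge0.
have mi1 k' : measurable_fun setT (fun x => \int[mu]_(z in C k') path_energy (1 / 2) x z)%E.
  exact: (measurable_fun_integral_rect mu (mC k') mpe1).
have mi2 k' : measurable_fun setT (fun x => \int[mu]_(z in C k') path_energy (1 / 2) z x)%E.
  exact: (measurable_fun_integral_rect mu (mC k') mpe2).
pose W := 2 ^+ n * \sum_j c j * vol j.
have W0 : 0 <= W by rewrite mulr_ge0 ?exprn_ge0// sumr_ge0// => j _; rewrite mulr_ge0.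
have S2le : (S2 <= (W * \sum_k vol k)%:E)%E.
  rewrite mulr_sumr -sumEFin; apply: lee_sum => k _.
  rewrite -(ge0_integral_sum mu (mC k)); last 2 first.
  - by move=> k'; exact: measurable_fun_rVS (mi2 k').
  - by move=> k' x _; apply: (i0).
  apply: (@le_trans _ _ (\int[mu]_(x in C k) cst W%:E x)%E).
    apply: ge0_le_integral => //.
    - by move=> x _; apply: sume_ge0 => k' _; apply: (i0).
    - by apply: emeasurable_sum => k'; exact: measurable_fun_rVS (mi2 k').
    - by move=> x _; exact: integral_path_energy_le.
  by rewrite intC EFinM.
have S1E : S1 = S2.
  rewrite /S1 exchange_big/=; apply: eq_bigr => k _; apply: eq_bigr => k' _.
  by rewrite (integral_rect_swap mu mu (mC k') (mC k) mpe1).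
have pk k k' : ((p k * q k' * vol k * vol k')%:E <= (al * (c k + c k') * vol k * vol k')%:E +
    ga%:E * (\int[mu]_(x in C k) \int[mu]_(z in C k') path_energy (1 / 2) x z +
     \int[mu]_(x in C k) \int[mu]_(z in C k') path_energy (1 / 2) z x))%E.
  apply: (affine_le_integral_rect (m1 := mu) (m2 := mu) (mC k) (mC k') mpe1 mpe2 _ _ (volC k) (volC k')).
  - by move=> x z; exact: pe_ge0.
  - by move=> x z; exact: pe_ge0.
  - exact: mulr_ge0.
  - exact: mulr_ge0 al0 (addr_ge0 (c0 k) (c0 k')).
  - exact: ga0.
  - by move=> x z Cx Cz; exact: hpq.
have h : ((\sum_k \sum_k' p k * q k' * vol k * vol k')%:E <=
    (\sum_k \sum_k' al * (c k + c k') * vol k * vol k')%:E + ga%:E * (S1 + S2))%E.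
  rewrite -!sumEFin /S1 /S2 -big_split/= ge0_sume_distrr; last first.
    by move=> k _; apply: adde_ge0; apply: sume_ge0 => k' _; apply: (i0) => x; apply: (i0).
  rewrite -big_split/=; apply: lee_sum => k _.
  rewrite -!sumEFin -big_split/= ge0_sume_distrr; last first.
    by move=> k' _; apply: adde_ge0; apply: (i0) => x; apply: (i0).
  by rewrite -big_split/=; apply: lee_sum => k' _; exact: pk.
clear mpx mpz mpe1 mpe2 mi1 mi2 hpq pk i0.
move: h S1E S2le W0; clearbody S1 S2; move=> h S1E S2le W0.
have {}h : \sum_k \sum_k' p k * q k' * vol k * vol k' <=
    \sum_k \sum_k' al * (c k + c k') * vol k * vol k' + ga * (2 * (W * \sum_k vol k)).
  rewrite -lee_fin (le_trans h)// S1E EFinD leeD2l// EFinM.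
  apply: lee_wpmul2l; rewrite ?lee_fin//.
  by rewrite mulrDl mul1r EFinD; apply: leeD.
rewrite mulr_suml; under eq_bigr => k _ do rewrite mulr_sumr.
apply: (@le_trans _ _ (\sum_k \sum_k' p k * q k' * vol k * vol k')).
  by apply: ler_sum => k _; apply: ler_sum => k' _; rewrite le_eqVlt; apply/orP; left; apply/eqP; ring.
apply: (le_trans h).
have -> : \sum_k \sum_k' al * (c k + c k') * vol k * vol k' =
    2 * al * (\sum_k c k * vol k) * (\sum_k vol k).
  transitivity (\sum_k (al * (c k * vol k) * (\sum_k' vol k') + al * vol k * (\sum_k' c k' * vol k'))).
    apply: eq_bigr => k _; rewrite !mulr_sumr -big_split; apply: eq_bigr => k' _.
    by rewrite /=; ring.
  rewrite big_split/= -!mulr_suml -!mulr_sumr; ring.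
by rewrite /W le_eqVlt; apply/orP; left; apply/eqP; ring.
Qed.

Lemma sum_integral_path_energy_le (D : set 'rV[R]_n) (vD l : R) :
  measurable D -> mu D = vD%:E -> 0 <= l <= 1 / 2 ->
  (\sum_k \int[mu]_(x in C k) \int[mu]_(z in D) path_energy l x z <=
    (2 ^+ n * (\sum_j c j * vol j) * vD)%:E)%E.
Proof.
move=> mD muD hl.
have mp : measurable_fun setT (fun t : 'rV[R]_n * 'rV[R]_n => path_energy l t.1 t.2) by exact: mpe.
have mp' : measurable_fun setT (fun t : 'rV[R]_n * 'rV[R]_n => path_energy l t.2 t.1) by exact: mpe.
have mi k := measurable_fun_integral_rect mu (mC k) mp' (fun x y => pe_ge0 l y x).
have i0 k z : (0 <= \int[mu]_(x in C k) path_energy l x z)%E by apply: integral_ge0 => x _; exact: pe_ge0.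
under eq_bigr => k _ do rewrite (integral_rect_swap mu mu (mC k) mD mp (pe_ge0 l)).
rewrite -(ge0_integral_sum mu mD); last 2 first.
- by move=> k; exact: measurable_fun_rVS (mi k).
- by move=> k z _; exact: i0.
rewrite EFinM -muD -(integral_cst _ mD); apply: ge0_le_integral.
- exact: mD.
- by move=> z _; apply: sume_ge0 => k _; exact: i0.
- by apply: emeasurable_sum => k; exact: measurable_fun_rVS (mi k).
- exact: measurable_cst.
- by move=> z _; exact: integral_path_energy_le.
Qed.

Lemma integral_homothety_indic (l : R) (x : 'rV[R]_n) (B : set 'rV[R]_n) : 0 < l -> measurable B ->
  ((l ^+ n)%:E * \int[mu]_z (\1_B ((1 - l) *: x + l *: z))%:E = mu B)%E.
Proof.
move=> l0 mB; rewrite -(lebesgue_rV_homothety (n := n) (S := B) x (1 - l) (lt0r_neq0 l0) mB).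
rewrite gtr0_norm//; congr (_ * _)%E.
pose B' := [set z | B (l *: z + (1 - l) *: x)].
rewrite -[RHS](_ : (\int[mu]_z (\1_B' z)%:E = _)%E).
  apply: eq_integral => z _; rewrite !indicE; congr (_ : bool)%:R%:E.
  by apply/idP/idP; rewrite !inE /B'/= addrC.
rewrite integral_indic ?setIT//.
have := measurable_affine_preimage l%:M ((1 - l) *: x) mB.
by congr measurable; apply/seteqP; split=> y /=; rewrite mul_mx_scalar.
Qed.

(** Average over [z] in [D]. For fixed [x] the displaced point [(1 - l) *: x + l *: z] has density
    at most [l ^- n], so the [F] term is controlled by the total of [F] whatever [x] is, and the
    total of [a] factors out. A small [l] will pay for the path term, a small total of [a] for the
    product. *)
Lemma equi_integrability_cells (D : set 'rV[R]_n) (vD l al ga : R) (a b F : I -> R) :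
  measurable D -> mu D = vD%:E -> 0 < l <= 1 / 2 -> 0 <= al -> 0 <= ga ->
  (forall k, 0 <= a k) -> (forall k, 0 <= b k) -> (forall k, 0 <= F k) ->
  (forall k x z, C k x -> D z -> ((b k)%:E <= (al * c k)%:E + (ga%:E * path_energy l x z +
     \sum_j (a k * F j * \1_(H j) ((1 - l) *: x + l *: z))%:E))%E) ->
  l ^+ n * vD * (\sum_k b k * vol k) <=
  l ^+ n * vD * (al + ga * 2 ^+ n) * (\sum_k c k * vol k) +
  (\sum_k a k * vol k) * (\sum_k F k * vol k).
Proof.
move=> mD muD /andP[l0 l1] al0 ga0 a0 b0 F0 hb.
have ln0 : 0 < l ^+ n by exact: exprn_gt0.
pose f x z := (ga%:E * path_energy l x z)%E.
pose h j x z : R := \1_(H j) ((1 - l) *: x + l *: z).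
pose g k x z := (\sum_j (a k * F j * h j x z)%:E)%E.
have f0 x z : (0 <= f x z)%E by rewrite mule_ge0// lee_fin.
have h0 j x z : 0 <= h j x z by rewrite /h indicE.
have g0 k x z : (0 <= g k x z)%E by apply: sume_ge0 => j _; rewrite lee_fin !mulr_ge0.
have vD0 : 0 <= vD by rewrite -lee_fin -muD measure_ge0.
have mf : measurable_fun setT (fun p : 'rV[R]_n * 'rV[R]_n => f p.1 p.2).
  by apply: measurable_funeM; exact: mpe.
have mh j : measurable_fun setT (fun p : 'rV[R]_n * 'rV[R]_n => h j p.1 p.2).
  have mseg : measurable_fun setT (fun p : 'rV[R]_n * 'rV[R]_n => (1 - 1 * l) *: p.1 + (1 * l) *: p.2).
    exact: measurable_fun_segment.
  have := measurableT_comp (measurable_indic (R := R) (mH j)) mseg.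
  rewrite (_ : _ \o _ = fun p => h j p.1 p.2)//.
  by apply/funext => p; rewrite /h/= mul1r.
have mg k : measurable_fun setT (fun p : 'rV[R]_n * 'rV[R]_n => g k p.1 p.2).
  by apply: emeasurable_sum => j; apply/measurable_EFinP; apply: measurable_funM.
have hk k : ((b k * vol k * vD)%:E <= (al * c k * vol k * vD)%:E +
    1%:E * (\int[mu]_(x in C k) \int[mu]_(z in D) f x z + \int[mu]_(x in C k) \int[mu]_(z in D) g k x z))%E.
  apply: (affine_le_integral_rect (m1 := mu) (m2 := mu) (mC k) mD mf (mg k) f0 (g0 k) (volC k) muD) => //.
    by rewrite mulr_ge0.
  by move=> x z Cx Dz; rewrite mul1e; exact: hb.
have mp : measurable_fun setT (fun t : 'rV[R]_n * 'rV[R]_n => path_energy l t.1 t.2) by exact: mpe.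
have ga0' : (0 <= ga%:E)%E by rewrite lee_fin.
have sumf : (\sum_k \int[mu]_(x in C k) \int[mu]_(z in D) f x z <=
    (ga * (2 ^+ n * (\sum_j c j * vol j) * vD))%:E)%E.
  have l01 : 0 <= l <= 1 / 2 by rewrite l1 andbT ltW.
  have := sum_integral_path_energy_le mD muD l01.
  move/(lee_wpmul2l ga0'); rewrite -EFinM; apply: le_trans.
  rewrite ge0_sume_distrr; last first.
    by move=> k _; apply: integral_ge0 => x _; apply: integral_ge0 => z _; exact: pe_ge0.
  apply: lee_sum => k _.
  rewrite -(ge0_integralZl mu (mC k) (measurable_fun_rVS (measurable_fun_integral_rect mu mD mp (pe_ge0 l)))); last 2 first.
  - by move=> x _; apply: integral_ge0 => z _; exact: pe_ge0.
  - exact: ga0'.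
  rewrite le_eqVlt; apply/orP; left; apply/eqP; apply: eq_integral => x _.
  rewrite -(ge0_integralZl mu mD (measurable_fun_rVS (measurable_fun_pair2 x mp)))//.
have sumg k : (\int[mu]_(x in C k) \int[mu]_(z in D) g k x z <=
    (a k * vol k * (\sum_j F j * vol j) / l ^+ n)%:E)%E.
  rewrite (_ : (_ / _)%:E = ((a k * (\sum_j F j * vol j) / l ^+ n)%:E * (vol k)%:E)%E); last first.
    by rewrite -EFinM; congr EFin; ring.
  rewrite -intC; apply: ge0_le_integral.
  - exact: mC.
  - by move=> x _; apply: integral_ge0 => z _; exact: g0.
  - exact: measurable_fun_rVS (measurable_fun_integral_rect mu mD (mg k) (g0 k)).
  - exact: measurable_cst.
  move=> x _.
  have mgz : measurable_fun setT (g k x) by exact: (measurable_fun_pair2 x (mg k)).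
  apply: (@le_trans _ _ (\int[mu]_z g k x z)%E).
    by apply: ge0_subset_integral => //.
  rewrite ge0_integral_sum//; last 2 first.
  - move=> j; apply/measurable_EFinP; apply: measurable_funM => //.
    exact: (measurable_fun_pair2 x (mh j)).
  - by move=> j z _; rewrite lee_fin !mulr_ge0.
  rewrite mulr_sumr mulr_suml -sumEFin; apply: lee_sum => j _.
  under eq_integral => z _ do rewrite EFinM.
  have mhx : measurable_fun setT (fun z => (h j x z)%:E).
    by apply/measurable_EFinP; exact: (measurable_fun_pair2 x (mh j)).
  have akF0 : (0 <= (a k * F j)%:E)%E by rewrite lee_fin mulr_ge0.
  have hx0 z : [set: 'rV[R]_n] z -> (0 <= (h j x z)%:E)%E by move=> _; rewrite lee_fin.
  rewrite (ge0_integralZl mu measurableT mhx hx0 akF0).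
  have := integral_homothety_indic x l0 (mH j); rewrite volH.
  move=> /(congr1 (fun y => (l ^- n)%:E * y)%E); rewrite muleA -!EFinM mulVf ?lt0r_neq0// mul1e.
  move=> ->; rewrite -EFinM le_eqVlt; apply/orP; left; apply/eqP; congr EFin; ring.
have : ((\sum_k b k * vol k * vD)%:E <= (\sum_k al * c k * vol k * vD)%:E +
   ((ga * (2 ^+ n * (\sum_j c j * vol j) * vD))%:E +
    (\sum_k a k * vol k * (\sum_j F j * vol j) / l ^+ n)%:E))%E.
  rewrite -!sumEFin.
  apply: (@le_trans _ _ (\sum_k ((al * c k * vol k * vD)%:E +
    1%:E * (\int[mu]_(x in C k) \int[mu]_(z in D) f x z + \int[mu]_(x in C k) \int[mu]_(z in D) g k x z)))%E).
    by apply: lee_sum => k _; exact: hk.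
  rewrite big_split/=; apply: leeD; first exact: lexx.
  under eq_bigr => k _ do rewrite mul1e.
  rewrite big_split/=; apply: leeD; first exact: sumf.
  by apply: lee_sum => k _; exact: sumg.
rewrite -!EFinD lee_fin -!mulr_suml => ineq.
have {}ineq := ler_wpM2l (ltW ln0) ineq.
apply: (le_trans (le_trans _ ineq)).
  by rewrite le_eqVlt; apply/orP; left; apply/eqP; ring.
rewrite le_eqVlt; apply/orP; left; apply/eqP.
under eq_bigr => k _ do rewrite -mulrA.
rewrite -mulr_sumr; field; exact: lt0r_neq0.
Qed.
End cell_inequalities.

(** * Barycentric coordinates and the sign of the stiffness matrix *)

Definition time_in (R : realType) (A : set R) (a : R) : R :=
  fine (lebesgue_measure (A `&` `[a, 1])).

Lemma time_inE (R : realType) (A : set R) (a : R) : closed A ->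
  lebesgue_measure (A `&` `[a, 1]) = (time_in A a)%:E.
Proof.
move=> cA; rewrite /time_in fineK// ge0_fin_numE ?measure_ge0//.
have mI : measurable (`[a, 1]%classic : set (measurableTypeR R)) by exact: measurable_itv.
apply: (@le_lt_trans _ _ (lebesgue_measure `[a, 1]%classic)).
  apply: le_measure; rewrite ?inE.
  - by apply: measurableI => //; exact: closed_measurable.
  - exact: mI.
  - exact: subIsetr.
by rewrite lebesgue_measure_itv/= lte_fin; case: ifP => _; rewrite ltry.
Qed.

Lemma time_in_ge0 (R : realType) (A : set R) (a : R) : 0 <= time_in A a.
Proof. by rewrite fine_ge0// measure_ge0. Qed.

Lemma time_in_le (R : realType) (A : set R) (a b : R) : closed A -> a <= b ->
  time_in A b <= time_in A a.
Proof.
move=> cA ab; rewrite -lee_fin -!time_inE//.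
have mI c : measurable (`[c, 1]%classic : set (measurableTypeR R)) by exact: measurable_itv.
apply: le_measure; rewrite ?inE.
- by apply: measurableI => //; exact: closed_measurable.
- by apply: measurableI => //; exact: closed_measurable.
- move=> s [As sb]; split => //; move: sb; rewrite /= !in_itv/= => /andP[bs s1]; by rewrite (le_trans ab bs).
Qed.

Lemma time_in_ge (R : realType) (A : set R) (a b : R) : closed A -> is_interval A ->
  a <= b -> b <= 1 -> A a -> A b -> b - a <= time_in A a.
Proof.
move=> cA iA ab b1 Aa Ab; rewrite -lee_fin -time_inE//.
have mI c d : measurable (`[c, d]%classic : set (measurableTypeR R)) by exact: measurable_itv.
apply: (@le_trans _ _ (lebesgue_measure `[a, b]%classic)).
  move: ab; rewrite le_eqVlt => /predU1P[->|ab]; first by rewrite subrr measure_ge0.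
  by rewrite lebesgue_measure_itv/= lte_fin ab EFinB.
apply: le_measure; rewrite ?inE.
- exact: mI.
- by apply: measurableI => //; exact: closed_measurable.
- move=> s; rewrite /= in_itv/= => /andP[as_ sb]; split.
    by apply: (iA a b Aa Ab); rewrite as_ sb.
  by rewrite in_itv/= as_ (le_trans sb).
Qed.

(** A finite union of closed sets is closed, so it contains the limit [a] of the covered points to
    its right. *)
Lemma closed_cover_left_end (R : realType) (I : finType) (A : I -> set R) (S : {set I}) (a : R) :
  a < 1 -> (forall k, k \in S -> closed (A k)) ->
  (forall s, a < s <= 1 -> exists2 k, k \in S & A k s) -> exists2 k, k \in S & A k a.
Proof.
move=> a1 cA cov; apply: contrapT => nA.
have cU : closed (\big[setU/set0]_(k <- enum S) A k).
  by apply: closed_bigsetU => k; rewrite mem_enum; exact: cA.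
have Ua : (~` (\big[setU/set0]_(k <- enum S) A k)) a.
  rewrite -bigcup_seq => -[k /=]; rewrite mem_enum => kS Aka; apply: nA; by exists k.
have := closed_openC cU; rewrite openE => /(_ _ Ua) [e /= e0 he].
have s1 : a < Num.min 1 (a + e / 2) <= 1 by rewrite lt_min a1 ltrDl divr_gt0//= ge_min lexx.
have [k kS Ak] := cov _ s1.
apply: (he (Num.min 1 (a + e / 2))).
  rewrite /ball/= distrC ger0_norm.
    by rewrite ltrBlDl gt_min; apply/orP; right; rewrite ltrD2l; lra.
  by rewrite subr_ge0 le_min (ltW a1) lerDl divr_ge0// ltW.
by rewrite -bigcup_seq; exists k => //=; rewrite mem_enum.
Qed.

(** Cauchy-Schwarz for two consecutive stretches of durations [p] and [q], the first of slope [c],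
    with energies [c ^+ 2 * p] and [W]. *)
Lemma sqr_chain_le (R : realType) (x y c p q W : R) : 0 <= c -> 0 <= p -> 0 <= q -> 0 <= W ->
  `|x| <= c * p -> y ^+ 2 <= q * W -> (x + y) ^+ 2 <= (p + q) * (c ^+ 2 * p + W).
Proof.
move=> c0 p0 q0 W0 hx hy.
have x2 : x ^+ 2 <= c ^+ 2 * p ^+ 2 by rewrite -exprMn -real_normK ?num_real// ler_pXn2r// nnegrE mulr_ge0.
have xy : 2 * x * y <= p * (c ^+ 2 * q + W).
  have P0 : 0 <= p * (c ^+ 2 * q + W) by rewrite mulr_ge0// addr_ge0// mulr_ge0// exprn_ge0.
  apply: (le_trans (ler_norm _)); rewrite -(@ler_pXn2r _ 2)// ?nnegrE// real_normK ?num_real//.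
  rewrite !exprMn.
  have h1 : 2 ^+ 2 * x ^+ 2 * y ^+ 2 <= 2 ^+ 2 * (c ^+ 2 * p ^+ 2) * (q * W).
    apply: ler_pM => //; rewrite ?sqr_ge0//; first by rewrite mulr_ge0 ?sqr_ge0.
    by rewrite ler_wpM2l ?sqr_ge0.
  apply: (le_trans h1); rewrite -subr_ge0.
  rewrite (_ : _ - _ = p ^+ 2 * (c ^+ 2 * q - W) ^+ 2); last by ring.
  by rewrite mulr_ge0// sqr_ge0.
rewrite (_ : (x + y) ^+ 2 = x ^+ 2 + y ^+ 2 + 2 * x * y); last by ring.
apply: (le_trans (lerD (lerD x2 hy) xy)).
by rewrite le_eqVlt; apply/orP; left; apply/eqP; ring.
Qed.

(* One-dimensional fundamental theorem of calculus for a function which is Lipschitz on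
   finitely many closed intervals: follow an interval to its right end, then discard it. *)
Lemma piecewise_lipschitz_chain (R : realType) (I : finType) (A : I -> set R) (c : I -> R)
    (phi : R -> R) (S : {set I}) (a : R) : a <= 1 ->
  (forall k, 0 <= c k) -> (forall k, k \in S -> closed (A k)) ->
  (forall k, k \in S -> is_interval (A k)) ->
  (forall k s t, k \in S -> A k s -> A k t -> `|phi s - phi t| <= c k * `|s - t|) ->
  (forall s, a < s <= 1 -> exists2 k, k \in S & A k s) ->
  (phi 1 - phi a) ^+ 2 <= (1 - a) * \sum_(k in S) c k ^+ 2 * time_in (A k) a.
Proof.
elim: {S}#|S| {-2}S (erefl #|S|) a => [|m IH] S Sm a a1 c0 cA iA lip cov.
  move: a1; rewrite le_eqVlt => /predU1P[->|a1]; first by rewrite !subrr mul0r expr0n.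
  have [k kS] := closed_cover_left_end a1 cA cov.
  by move/eqP: Sm; rewrite cards_eq0 => /eqP S0; rewrite S0 inE in kS.
move: a1; rewrite le_eqVlt => /predU1P[->|a1]; first by rewrite !subrr mul0r expr0n.
have [k kS Aka] := closed_cover_left_end a1 cA cov.
(* [b] is the last time in [[a, 1]] at which [A k] is met: after it [A k] covers nothing, and from
   [a] to [b] the function varies at rate at most [c k]. *)
have [b] : exists2 b, b \in (A k `&` `[a, 1]) & forall t, t \in (A k `&` `[a, 1]) -> t <= b.
  apply: (compact_EVT_max (f := id)).
  - by exists a; split => //=; rewrite in_itv/= lexx ltW.
  - rewrite setIC; apply: compact_closedI; last exact: cA.
    exact: segment_compact.
  - by apply: continuous_subspaceT => s; exact: cvg_id.
rewrite inE /= in_itv/= => -[Akb /andP[ab b1]] bmax.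
have kb s : b < s <= 1 -> ~ A k s.
  move=> /andP[bs s1] Aks; have := bmax s; rewrite inE/= in_itv/= s1 (le_trans ab (ltW bs)) andbT.
  by move=> /(_ (conj Aks isT)); rewrite leNgt bs.
have /IH : #|S :\ k| = m by move: Sm; rewrite (cardsD1 k) kS => -[].
move=> /(_ b b1 c0); rewrite (big_setD1 k kS)/=.
set W := \sum_(j in S :\ k) c j ^+ 2 * time_in (A j) b => IHb.
have sub j : j \in S :\ k -> j \in S by rewrite !inE => /andP[].
have hW : (phi 1 - phi b) ^+ 2 <= (1 - b) * W.
  apply: IHb => //.
  - by move=> j /sub; exact: cA.
  - by move=> j /sub; exact: iA.
  - by move=> j s t /sub; exact: lip.
  - move=> s /[dup] bs /andP[bs' s1].
    have [j jS Aj] := cov s (introT andP (conj (le_lt_trans ab bs') s1)).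
    exists j => //; rewrite !inE jS andbT; apply/eqP => jk.
    by apply: (kb s bs); rewrite -jk.
have W0 : 0 <= W by apply: sumr_ge0 => j _; rewrite mulr_ge0 ?sqr_ge0 ?time_in_ge0.
have h1 : `|phi b - phi a| <= c k * (b - a).
  by rewrite -[b - a]ger0_norm ?subr_ge0//; exact: lip.
have := sqr_chain_le (c0 k) _ _ W0 h1 hW.
rewrite !subr_ge0 => /(_ ab b1).
rewrite (_ : phi b - phi a + (phi 1 - phi b) = phi 1 - phi a); last by ring.
rewrite (_ : b - a + (1 - b) = 1 - a); last by ring.
move=> h; apply: (le_trans h); apply: ler_wpM2l; first by rewrite subr_ge0 ltW.
apply: lerD.
  by apply: ler_wpM2l; [rewrite sqr_ge0|apply: time_in_ge => //; [exact: cA|exact: iA]].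
apply: ler_sum => j /sub jS; apply: ler_wpM2l; first by rewrite sqr_ge0.
by apply: time_in_le => //; exact: cA.
Qed.

Section dotp_theory.
Context {R : realType} {d : nat}.
Implicit Types x y z : 'rV[R]_d.

Lemma dotpC x y : dotp x y = dotp y x.
Proof. by apply: eq_bigr => i _; rewrite mulrC. Qed.

Lemma dotpDr x y z : dotp x (y + z) = dotp x y + dotp x z.
Proof. by rewrite /dotp -big_split; apply: eq_bigr => i _; rewrite mxE mulrDr. Qed.

Lemma dotpDl x y z : dotp (y + z) x = dotp y x + dotp z x.
Proof. by rewrite dotpC dotpDr !(dotpC x). Qed.

Lemma dotpZr a x y : dotp x (a *: y) = a * dotp x y.
Proof. by rewrite /dotp mulr_sumr; apply: eq_bigr => i _; rewrite mxE mulrCA. Qed.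

Lemma dotpZl a x y : dotp (a *: x) y = a * dotp x y.
Proof. by rewrite dotpC dotpZr dotpC. Qed.

Lemma dotpNr x y : dotp x (- y) = - dotp x y.
Proof. by rewrite -scaleN1r dotpZr mulN1r. Qed.

Lemma dotpNl x y : dotp (- x) y = - dotp x y.
Proof. by rewrite dotpC dotpNr dotpC. Qed.

Lemma dotpBr x y z : dotp x (y - z) = dotp x y - dotp x z.
Proof. by rewrite dotpDr dotpNr. Qed.

Lemma dotp0r x : dotp x 0 = 0.
Proof. by rewrite -(scale0r 0) dotpZr mul0r. Qed.

Lemma dotp0l x : dotp 0 x = 0.
Proof. by rewrite dotpC dotp0r. Qed.

Lemma dotp_sumr (I : Type) (r : seq I) (P : pred I) (F : I -> 'rV[R]_d) x :
  dotp x (\sum_(i <- r | P i) F i) = \sum_(i <- r | P i) dotp x (F i).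
Proof. by elim/big_rec2: _ => [|i y z _ <-]; rewrite ?dotp0r ?dotpDr. Qed.

Lemma dotp_suml (I : Type) (r : seq I) (P : pred I) (F : I -> 'rV[R]_d) x :
  dotp (\sum_(i <- r | P i) F i) x = \sum_(i <- r | P i) dotp (F i) x.
Proof. by rewrite dotpC dotp_sumr; apply: eq_bigr => i _; rewrite dotpC. Qed.

Lemma dotp_ge0 x : 0 <= dotp x x.
Proof. by apply: sumr_ge0 => i _; rewrite -expr2 sqr_ge0. Qed.

Lemma dotp_eq0 x : (dotp x x == 0) = (x == 0).
Proof.
apply/eqP/eqP => [|->]; last by rewrite dotp0r.
move=> /psumr_eq0P x0; apply/rowP => i; rewrite mxE.
have /eqP : x ord0 i * x ord0 i = 0 by apply: x0 => // j _; rewrite -expr2 sqr_ge0.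
by rewrite -expr2 sqrf_eq0 => /eqP.
Qed.

Lemma dotp_inj x y : (forall z, dotp x z = dotp y z) -> x = y.
Proof.
move=> h; apply/eqP; rewrite -subr_eq0 -dotp_eq0.
by rewrite dotpDl dotpNl h subrr.
Qed.

Lemma enorm_ge0 x : 0 <= enorm x.
Proof. exact: sqrtr_ge0. Qed.

Lemma enorm_sqr x : enorm x ^+ 2 = dotp x x.
Proof. by rewrite sqr_sqrtr// dotp_ge0. Qed.

Lemma enorm_eq0 x : (enorm x == 0) = (x == 0).
Proof. by rewrite -dotp_eq0 -enorm_sqr sqrf_eq0. Qed.

Lemma enorm_gt0 x : (0 < enorm x) = (x != 0).
Proof. by rewrite lt_def enorm_ge0 andbT enorm_eq0. Qed.

Lemma enormZ a x : enorm (a *: x) = `|a| * enorm x.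
Proof. by rewrite /enorm dotpZl dotpZr mulrA -expr2 sqrtrM ?sqr_ge0// sqrtr_sqr. Qed.

Lemma enormN x : enorm (- x) = enorm x.
Proof. by rewrite -scaleN1r enormZ normrN1 mul1r. Qed.

Lemma dotp_sqr_le x y : dotp x y ^+ 2 <= dotp x x * dotp y y.
Proof.
have [->|y0] := eqVneq y 0; first by rewrite !dotp0r mulr0 expr0n.
have yy : 0 < dotp y y by rewrite lt_def dotp_eq0 y0 dotp_ge0.
have := dotp_ge0 (dotp y y *: x - dotp x y *: y).
rewrite !(dotpBr, dotpDl, dotpNl, dotpZl, dotpZr) (dotpC y x).
rewrite (_ : _ - _ = dotp y y * (dotp x x * dotp y y - dotp x y ^+ 2)); last by ring.
by rewrite pmulr_rge0// subr_ge0.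
Qed.

Lemma dotp_le_enorm x y : `|dotp x y| <= enorm x * enorm y.
Proof.
rewrite -(@ler_pXn2r _ 2)// ?nnegrE ?mulr_ge0 ?enorm_ge0//.
by rewrite real_normK ?num_real// exprMn !enorm_sqr dotp_sqr_le.
Qed.

Lemma dotp_delta x i : dotp x (delta_mx ord0 i) = x ord0 i.
Proof.
rewrite /dotp (bigD1 i)//= big1 ?addr0 ?mxE ?eqxx ?mulr1// => j ji.
by rewrite mxE (negPf ji) andbF mulr0.
Qed.

(** Replacing a coordinate [k] such that [g ord0 k != 0] by [dotp g x] is an invertible linear
    change, which turns the hyperplane into a box with one side reduced to a point. *)
Lemma lebesgue_rV_hyperplane (g : 'rV[R]_d) (c : R) : g != 0 ->
  lebesgue_rV d [set x | dotp g x = c] = 0%E.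
Proof.
move=> g0; have [k gk] : exists k, g ord0 k != 0.
  apply/existsP; apply: contraR g0 => /existsPn h; apply/eqP/rowP => j.
  by have := h j; rewrite negbK mxE => /eqP.
pose A : 'M[R]_d := \matrix_(i, j) if j == k then g ord0 i else (i == j)%:R.
have xAk (x : 'rV[R]_d) : (x *m A) ord0 k = dotp g x.
  by rewrite mxE dotpC; apply: eq_bigr => i _; rewrite mxE eqxx.
have xAj (x : 'rV[R]_d) j : j != k -> (x *m A) ord0 j = x ord0 j.
  move=> jk; rewrite mxE (bigD1 j)//= big1 ?addr0.
    by rewrite mxE (negPf jk) eqxx mulr1.
  by move=> i ij; rewrite mxE (negPf jk) (negPf ij) mulr0.
have uA : A \in unitmx.
  rewrite -row_free_unit; apply: inj_row_free => x xA.
  have xj j : j != k -> x ord0 j = 0 by move=> jk; rewrite -xAj// xA mxE.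
  apply/rowP => j; rewrite mxE; have [->|/xj//] := eqVneq j k.
  have : dotp g x = 0 by rewrite -xAk xA mxE.
  rewrite /dotp (bigD1 k)//= big1 ?addr0; last by move=> i ik; rewrite (xj i ik) mulr0.
  by move/eqP; rewrite mulf_eq0 (negPf gk) => /eqP.
pose U (i : 'I_d) : set R := if i == k then [set c] else setT.
have mU i : measurable (U i) by rewrite /U; case: ifP => _; [exact: measurable_set1|exact: measurableT].
pose S : set 'rV[R]_d := [set y | forall i, U i (y ord0 i)].
have mS : measurable S := measurable_box mU.
have S0 : lebesgue_rV d S = 0%E.
  by rewrite lebesgue_rV_box// (bigD1 k)//= {1}/U eqxx lebesgue_measure_set1 mul0e.
have := lebesgue_rV_affine 0 uA mS; rewrite S0 => /eqP.
rewrite mule_eq0 eqe normr_eq0 => /orP[|/eqP <-].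
  by rewrite -[_ == _]negbK -unitfE -unitmxE uA.
congr (lebesgue_rV d _); apply/seteqP; split=> x /=.
  by move=> gx i; rewrite addr0 /U; case: ifP => [/eqP ->|//]; rewrite /= xAk.
by move=> /(_ k); rewrite /U eqxx addr0 /= xAk.
Qed.

End dotp_theory.

Section simplex.
Context {R : realType} {d : nat} (T : mesh R d).
Local Notation node := 'I_(nvert T).
Local Notation X := (@vert R d T).
Implicit Types (i j : node) (K F : {set node}).

Definition enumerates (e : 'I_d.+1 -> node) K := injective e /\ forall i, (i \in K) = [exists k, e k == i].

Lemma exists_enumerates K : #|K| = d.+1 -> exists e, enumerates e K.
Proof.
move=> cK; exists (fun k => enum_val (cast_ord (esym cK) k)); split.
  by move=> k l /enum_val_inj /cast_ord_inj.
move=> i; apply/idP/existsP => [iK|[k /eqP <-]]; last exact: enum_valP.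
by exists (cast_ord cK (enum_rank_in iK i)); rewrite cast_ordK enum_rankK_in.
Qed.

Lemma enumerates_in e K k : enumerates e K -> e k \in K.
Proof. by move=> [_ ->]; apply/existsP; exists k. Qed.

Lemma enumeratesP e K i : enumerates e K -> i \in K -> exists k, i = e k.
Proof. by move=> [_ ->] /existsP [k /eqP <-]; exists k. Qed.

Lemma sum_enumerates (V : nmodType) e K (F : node -> V) : enumerates e K ->
  \sum_(i in K) F i = \sum_k F (e k).
Proof.
move=> eK; transitivity (\sum_(i in [set e k | k in [set: 'I_d.+1]%SET]%SET) F i).
  apply: eq_bigl => i; rewrite eK.2; apply/existsP/imsetP => [[k /eqP <-]|[k _ ->]]; by exists k.
rewrite big_imset/=; first by apply: eq_bigl => k; rewrite inE.
by move=> k l _ _; exact: eK.1.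
Qed.

(** Vertices in homogeneous coordinates: affine independence makes this matrix invertible, and the
    columns of the inverse are the coefficients of the barycentric coordinates. *)
Definition vmx (e : 'I_d.+1 -> node) : 'M[R]_(d.+1, 1 + d) := \matrix_k row_mx 1 (X (e k)).

Lemma vmx_unit e K : enumerates e K -> aff_indep K -> vmx e \in unitmx.
Proof.
move=> eK aff; rewrite -row_free_unit; apply: inj_row_free => v vM.
pose a i := \sum_k (e k == i)%:R * v ord0 k.
have aE k : a (e k) = v ord0 k.
  rewrite /a (bigD1 k)//= eqxx mul1r big1 ?addr0// => l lk.
  by rewrite (inj_eq eK.1) (negPf lk) mul0r.
have vMk : \sum_k v ord0 k *: row_mx 1 (X (e k)) = 0 :> 'rV_(1 + d).
  transitivity (v *m vmx e); last exact: vM.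
  rewrite mulmx_sum_row; apply: eq_bigr => k _; congr (_ *: _).
  by apply/rowP => j; rewrite !mxE.
have s0 : \sum_(i in K) a i = 0.
  rewrite (sum_enumerates _ eK); under eq_bigr => k _ do rewrite aE.
  have /rowP /(_ (lshift d ord0)) := vMk; rewrite summxE mxE => h; rewrite -[RHS]h.
  by apply: eq_bigr => k _; rewrite !mxE (unsplitK (inl _)) mxE mulr1.
have s1 : \sum_(i in K) a i *: X i = 0.
  rewrite (sum_enumerates _ eK); under eq_bigr => k _ do rewrite aE.
  apply/rowP => j; have /rowP /(_ (rshift 1 j)) := vMk.
  rewrite !summxE !mxE => h; rewrite -[RHS]h.
  by apply: eq_bigr => k _; rewrite !mxE (unsplitK (inr _)).
apply/rowP => k; rewrite mxE -aE; apply: (aff _ s0 s1); exact: enumerates_in.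
Qed.

(** A pair [(a, g)] stands for the affine function [a + dotp g x]; the value [(0, 0)] off [K] allows
    sums over all nodes. *)
Definition bary_of K (b : node -> R * 'rV[R]_d) :=
  [/\ forall i, i \notin K -> b i = (0, 0),
      forall i j, i \in K -> j \in K -> (b i).1 + dotp (b i).2 (X j) = (i == j)%:R,
      forall x, \sum_(i in K) ((b i).1 + dotp (b i).2 x) = 1
    & forall x, \sum_(i in K) ((b i).1 + dotp (b i).2 x) *: X i = x].

Lemma exists_bary K : #|K| = d.+1 -> aff_indep K -> exists b, bary_of K b.
Proof.
move=> cK aff; have [e eK] := exists_enumerates cK.
have uM := vmx_unit eK aff.
pose N : 'M[R]_(1 + d, d.+1) := invmx (vmx e).
have MN : vmx e *m N = 1%:M by exact: mulmxV.
have NM : N *m vmx e = 1%:M by exact: mulVmx.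
pose b0 k : R * 'rV[R]_d := (N (lshift d ord0) k, \row_j N (rshift 1 j) k).
pose b i := if [pick k | e k == i] is Some k then b0 k else (0, 0).
have bE k : b (e k) = b0 k.
  by rewrite /b; case: pickP => [l /eqP /eK.1 ->//|/(_ k)]; rewrite eqxx.
have b0E k x : (b0 k).1 + dotp (b0 k).2 x = (row_mx 1 x *m N) ord0 k.
  rewrite mxE big_split_ord/= big_ord1 row_mxEl mxE mul1r; congr (_ + _).
  by rewrite /dotp; apply: eq_bigr => j _; rewrite row_mxEr mxE mulrC.
exists b; split.
- move=> i iK; rewrite /b; case: pickP => // k /eqP ki.
  by move: iK; rewrite -ki enumerates_in.
- move=> i j /(enumeratesP eK)[k ->] /(enumeratesP eK)[l ->]; rewrite bE b0E.
  have := congr1 (fun A : 'M[R]_(d.+1) => A l k) MN; rewrite !mxE (inj_eq eK.1) eq_sym => <-.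
  by apply: eq_bigr => m _; congr (_ * _); rewrite [RHS]mxE.
- move=> x; rewrite (sum_enumerates _ eK).
  under eq_bigr => k _ do rewrite bE b0E.
  have := congr1 (fun A : 'M[R]_(1 + d) => (row_mx 1 x *m A) ord0 (lshift d ord0)) NM.
  rewrite mulmx1 row_mxEl [X in _ = X]mxE eqxx => h; apply: etrans h; rewrite mulmxA [RHS]mxE.
  by apply: eq_bigr => k _; rewrite [vmx e k _]mxE row_mxEl [X in _ * X]mxE eqxx mulr1.
- move=> x; rewrite (sum_enumerates _ eK).
  under eq_bigr => k _ do rewrite bE b0E.
  apply/rowP => j; rewrite summxE.
  have := congr1 (fun A : 'M[R]_(1 + d) => (row_mx 1 x *m A) ord0 (rshift 1 j)) NM.
  rewrite mulmx1 row_mxEr => <-; rewrite mulmxA [RHS]mxE.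
  by apply: eq_bigr => k _; rewrite [vmx e k _]mxE row_mxEr [LHS]mxE.
Qed.

Definition bcoef K : node -> R * 'rV[R]_d := xget (fun=> (0, 0)) [set b | bary_of K b].
Definition bgrad K i : 'rV[R]_d := (bcoef K i).2.
Definition bary K i x : R := (bcoef K i).1 + dotp (bgrad K i) x.

Section cell.
Variable K : {set node}.
Hypotheses (cK : #|K| = d.+1) (aK : aff_indep K).

Let bP : bary_of K (bcoef K).
Proof. by have [b hb] := exists_bary cK aK; rewrite /bcoef; case: xgetP => [c _ //|/(_ b)]. Qed.

Lemma bgrad_notin i : i \notin K -> bgrad K i = 0.
Proof. by case: bP => h _ _ _ /h; rewrite /bgrad => ->. Qed.

Lemma bary_notin i x : i \notin K -> bary K i x = 0.
Proof. by case: bP => h _ _ _ /h; rewrite /bary /bgrad => ->; rewrite dotp0l addr0. Qed.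

Lemma bary_vert i j : i \in K -> j \in K -> bary K i (X j) = (i == j)%:R.
Proof. by case: bP => _ h _ _; exact: h. Qed.

Lemma sum_bary x : \sum_(i in K) bary K i x = 1.
Proof. by case: bP => _ _ h _; exact: h. Qed.

Lemma sum_bary_vert x : \sum_(i in K) bary K i x *: X i = x.
Proof. by case: bP => _ _ _ h; exact: h. Qed.

Lemma baryB i x y : bary K i x - bary K i y = dotp (bgrad K i) (x - y).
Proof. by rewrite /bary dotpBr; ring. Qed.

Lemma bary_comb i x y s : bary K i ((1 - s) *: x + s *: y) = (1 - s) * bary K i x + s * bary K i y.
Proof. by rewrite /bary dotpDr !dotpZr; ring. Qed.

Lemma sum_bgrad : \sum_(i in K) bgrad K i = 0.
Proof.
apply: dotp_inj => z; rewrite dotp0l dotp_suml.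
rewrite -[LHS](_ : \sum_(i in K) (bary K i z - bary K i 0) = _).
  by rewrite sumrB !sum_bary subrr.
by apply: eq_bigr => i _; rewrite baryB subr0.
Qed.

(** The linear function [dotp n] is its own interpolant from the vertices of [K]; take gradients. *)
Lemma bgrad_dual (n : 'rV[R]_d) : n = \sum_(i in K) dotp n (X i) *: bgrad K i.
Proof.
apply: dotp_inj => z; rewrite dotp_suml.
transitivity (\sum_(i in K) dotp n (X i) * (bary K i z - bary K i 0)).
  rewrite -[z in LHS](subr0 z) -[z in LHS](sum_bary_vert z) -[X in _ - X](sum_bary_vert 0).
  rewrite dotpBr !dotp_sumr -sumrB; apply: eq_bigr => i _.
  by rewrite !dotpZr; ring.
by apply: eq_bigr => i _; rewrite baryB subr0 dotpZl.
Qed.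

Lemma bary_hull_coef (t : node -> R) i : i \in K -> \sum_(j in K) t j = 1 ->
  bary K i (\sum_(j in K) t j *: X j) = t i.
Proof.
move=> iK t1; transitivity (\sum_(j in K) t j * bary K i (X j)).
  rewrite /bary; under [RHS]eq_bigr => j _ do rewrite mulrDr.
  rewrite big_split/= -mulr_suml t1 mul1r dotp_sumr; congr (_ + _).
  by apply: eq_bigr => j _; rewrite dotpZr.
rewrite (bigD1 i)//= bary_vert// eqxx mulr1 big1 ?addr0// => j /andP[jK ji].
by rewrite bary_vert// eq_sym (negPf ji) mulr0.
Qed.

Lemma hullP x : hull K x <-> forall i, i \in K -> 0 <= bary K i x.
Proof.
split=> [[t [t0 t1 ->]] i iK|h].
  by rewrite bary_hull_coef.
exists (bary K ^~ x); split.
- by move=> i; have [/h//|iK] := boolP (i \in K); rewrite bary_notin.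
- exact: sum_bary.
- by rewrite sum_bary_vert.
Qed.

Lemma bary_hull_le1 i x : hull K x -> bary K i x <= 1.
Proof.
move=> /hullP h; have [iK|/bary_notin->//] := boolP (i \in K).
by rewrite -(sum_bary x) (bigD1 i)//= lerDl sumr_ge0// => j /andP[/h].
Qed.

Lemma bary_face F (t : node -> R) i : F \subset K -> \sum_(j in F) t j = 1 ->
  bary K i (\sum_(j in F) t j *: X j) = if i \in F then t i else 0.
Proof.
move=> FK t1; have [iK|iK] := boolP (i \in K); last first.
  by rewrite bary_notin// ifN//; apply: contra iK; exact: (fintype.subsetP FK).
pose t' j := if j \in F then t j else 0.
have E (V : lmodType R) (f : node -> V) : \sum_(j in F) t j *: f j = \sum_(j in K) t' j *: f j.
  rewrite [RHS](bigID (mem F))/= [X in _ + X]big1 ?addr0.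
    apply: eq_big => [j|j jF]; last by rewrite /t' jF.
    by apply/idP/andP => [jF|[]//]; split => //; exact: (fintype.subsetP FK).
  by move=> j /andP[_ /negPf jF]; rewrite /t' jF scale0r.
have t'1 : \sum_(j in K) t' j = 1.
  transitivity (\sum_(j in K) t' j *: (1 : R^o)).
    by apply: eq_bigr => j _; rewrite /GRing.scale/= mulr1.
  by rewrite -E -[RHS]t1; apply: eq_bigr => j _; rewrite /GRing.scale/= mulr1.
by rewrite E bary_hull_coef.
Qed.

Lemma vert_hull i : i \in K -> hull K (X i).
Proof. by move=> iK; apply/hullP => j jK; rewrite bary_vert. Qed.

Lemma hull_convex x y s : hull K x -> hull K y -> 0 <= s <= 1 -> hull K ((1 - s) *: x + s *: y).
Proof.
move=> /hullP hx /hullP hy /andP[s0 s1]; apply/hullP => i iK; rewrite bary_comb.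
by rewrite addr_ge0// mulr_ge0 ?subr_ge0// ?hx ?hy.
Qed.

Lemma measurable_fun_dotp (g : 'rV[R]_d) : measurable_fun [set: 'rV[R]_d] (dotp g).
Proof.
apply: measurable_sum => i; apply: measurable_funM => //.
exact: measurable_rV_coord.
Qed.

Lemma measurable_hull : measurable (hull K).
Proof.
rewrite (_ : hull K = \bigcap_(i in [set` K]) [set x | 0 <= bary K i x]).
  apply: fin_bigcap_measurable => // i _.
  have mb : measurable_fun setT (bary K i) by apply: measurable_funD => //; exact: measurable_fun_dotp.
  have := mb measurableT `[0, +oo[%classic (measurable_itv _).
  by rewrite setTI; congr measurable; apply/seteqP; split=> x /=; rewrite in_itv/= andbT.
by apply/seteqP; split=> x; rewrite hullP => h i; [exact: h|exact: h].
Qed.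

End cell.
End simplex.

(** * Volume of a simplex *)

Definition std_simplex (R : realType) d : set 'rV[R]_d :=
  [set t | (forall i, 0 <= t ord0 i) /\ \sum_i t ord0 i <= 1].

Lemma measurable_std_simplex (R : realType) d : measurable (@std_simplex R d).
Proof.
rewrite (_ : std_simplex (R := R) (d := d) = [set t | forall i, `[0, +oo[%classic (t ord0 i)] `&`
   [set t | \sum_i t ord0 i <= 1]).
  apply: measurableI.
    exact: (@measurable_box R d (fun _ => `[0, +oo[%classic) (fun i => measurable_itv _)).
  have ms : measurable_fun [set: 'rV[R]_d] (fun t => \sum_i t ord0 i).
    by apply: measurable_sum => i; exact: (measurable_rV_coord i).
  have := ms measurableT `]-oo, 1]%classic (measurable_itv _).
  by rewrite setTI; congr measurable; apply/seteqP; split=> x /=; rewrite in_itv.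
apply/seteqP; split=> t /= [t0 t1]; split => // i; first by rewrite in_itv/= andbT.
by have := t0 i; rewrite in_itv/= andbT.
Qed.

(** This is 1 / d!, the common factor between volumes and determinants of edges; finiteness and
    positivity are the properties established. *)
Definition simplex_const (R : realType) d : R := fine (lebesgue_rV d (@std_simplex R d)).

Lemma simplex_constE (R : realType) d : lebesgue_rV d (@std_simplex R d) = (simplex_const R d)%:E.
Proof.
rewrite /simplex_const fineK// ge0_fin_numE ?measure_ge0//.
have mB : measurable [set t : 'rV[R]_d | forall i, `[0, 1]%classic (t ord0 i)].
  exact: (@measurable_box R d (fun _ => `[0, 1]%classic) (fun i => measurable_itv _)).
apply: (@le_lt_trans _ _ (lebesgue_rV d [set t | forall i, `[0, 1]%classic (t ord0 i)])).
  apply: le_measure; rewrite ?inE//; first exact: measurable_std_simplex.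
  move=> t [t0 t1] i /=; rewrite in_itv/= t0/=; apply: le_trans t1.
  by rewrite (bigD1 i)//= lerDl sumr_ge0.
rewrite (@lebesgue_rV_box R d (fun _ => `[0, 1]%classic) (fun i => measurable_itv _)).
rewrite big1 ?ltry// => i _.
by rewrite lebesgue_measure_itv/= lte_fin ltr01 oppr0 adde0.
Qed.

Lemma simplex_const_gt0 (R : realType) d : 0 < simplex_const R d.
Proof.
rewrite -lte_fin -simplex_constE.
(* The cube of side 1 / (d + 1) lies in the simplex; adding 1 covers [d = 0]. *)
pose r : R := d.+1%:R^-1.
have r0 : 0 < r by rewrite invr_gt0.
have mB : measurable [set t : 'rV[R]_d | forall i, `[0, r]%classic (t ord0 i)].
  exact: (@measurable_box R d (fun _ => `[0, r]%classic) (fun i => measurable_itv _)).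
apply: (@lt_le_trans _ _ (lebesgue_rV d [set t | forall i, `[0, r]%classic (t ord0 i)])).
  rewrite (@lebesgue_rV_box R d (fun _ => `[0, r]%classic) (fun i => measurable_itv _)).
  rewrite (eq_bigr (fun _ => r%:E)); last first.
    by move=> i _; rewrite lebesgue_measure_itv/= lte_fin r0 oppr0 adde0.
  by elim/big_ind: _ => [|x y x0 y0|i _]; rewrite ?lte_fin ?ltr01 ?mule_gt0.
apply: le_measure; rewrite ?inE//; first exact: measurable_std_simplex.
move=> t /= h; split=> [i|]; first by have := h i; rewrite in_itv/= => /andP[].
apply: (@le_trans _ _ (\sum_(i < d) r)).
  by apply: ler_sum => i _; have := h i; rewrite in_itv/= => /andP[].
rewrite sumr_const card_ord -mulr_natl ler_pdivrMr// mul1r ler_nat//.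
Qed.

Section simplex_volume.
Context {R : realType} {d : nat} (T : mesh R d).
Local Notation node := 'I_(nvert T).
Local Notation X := (@vert R d T).
Implicit Types (i j : node) (K F : {set node}).

Definition edges (e : 'I_d.+1 -> node) : 'M[R]_d :=
  \matrix_k (X (e (lift ord0 k)) - X (e ord0)).

Variable K : {set node}.
Hypotheses (cK : #|K| = d.+1) (aK : aff_indep K).
Variable e : 'I_d.+1 -> node.
Hypothesis eK : enumerates e K.

Lemma edges_bgrad : edges e *m (\matrix_k bgrad K (e (lift ord0 k)))^T = 1%:M.
Proof.
apply/matrixP => k l; rewrite !mxE.
transitivity (dotp (bgrad K (e (lift ord0 l))) (X (e (lift ord0 k)) - X (e ord0))).
  by apply: eq_bigr => j _; rewrite !mxE mulrC.
have eI m : e m \in K by exact: enumerates_in.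
rewrite -baryB !bary_vert// !(inj_eq eK.1) (inj_eq lift_inj) eq_sym.
by rewrite [lift _ _ == ord0]eq_sym (negPf (neq_lift _ _)) subr0.
Qed.

(** The barycentric coordinates other than the first map the hull onto the standard simplex, and the
    linear part of this map is inverse to the matrix of edges. *)
Lemma vol_edges : vol K = simplex_const R d * `|\det (edges e)| /\
  lebesgue_rV d (hull K) = (vol K)%:E.
Proof.
have eI m : e m \in K by exact: enumerates_in.
pose G := (\matrix_k bgrad K (e (lift ord0 k)))^T.
have [uB uG] := mulmx1_unit edges_bgrad.
have hE : hull K = [set x | std_simplex (x *m G + - (X (e ord0)) *m G)].
  have bE k x : (x *m G + - X (e ord0) *m G) ord0 k = bary K (e (lift ord0 k)) x.
    rewrite -mulmxDl; transitivity (dotp (bgrad K (e (lift ord0 k))) (x - X (e ord0))).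
      by rewrite mxE; apply: eq_bigr => j _; rewrite !mxE mulrC.
    by rewrite -baryB bary_vert// (inj_eq eK.1) eq_sym (negPf (neq_lift _ _)) subr0.
  have b0 x : bary K (e ord0) x = 1 - \sum_k (x *m G + - X (e ord0) *m G) ord0 k.
    rewrite -(sum_bary cK aK x) (sum_enumerates _ eK) big_ord_recl/=.
    by under [in RHS]eq_bigr => k _ do rewrite -bE; rewrite addrK.
  apply/seteqP; split=> x /=; rewrite hullP//.
    move=> h; split=> [k|]; first by rewrite bE h.
    by rewrite -subr_ge0 -b0 h.
  move=> [h0 h1] i /(enumeratesP eK)[k ->].
  case: (unliftP ord0 k) => [l|] ->; first by rewrite -bE.
  by rewrite b0 subr_ge0.
have := lebesgue_rV_affine (- X (e ord0) *m G) uG (@measurable_std_simplex R d).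
rewrite -hE simplex_constE => muH.
have detBG : \det (edges e) * \det G = 1 by rewrite -det_mulmx edges_bgrad det1.
have E : lebesgue_rV d (hull K) = (simplex_const R d * `|\det (edges e)|)%:E.
  rewrite mulrC EFinM -muH muleA -EFinM -normrM detBG normr1 mul1e//.
have -> : vol K = simplex_const R d * `|\det (edges e)| by rewrite /vol E.
by [].
Qed.

End simplex_volume.

(** * Gram determinants and the cotangent formula *)

Lemma det_mx2 (R : comRingType) (M : 'M[R]_2) :
  \det M = M ord0 ord0 * M ord_max ord_max - M ord0 ord_max * M ord_max ord0.
Proof.
have E0 : lift ord0 (ord0 : 'I_1) = ord_max :> 'I_2 by exact/val_inj.
have E1 : lift ord_max (ord0 : 'I_1) = ord0 :> 'I_2 by exact/val_inj.
rewrite (expand_det_row _ ord0) !big_ord_recl big_ord0 addr0 /cofactor !det_mx11 !mxE /= !E0 E1.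
by rewrite /bump /= expr0 expr1 mul1r mulN1r mulrN.
Qed.

(* Jacobi's complementary minor identity for the Gram matrices of dual bases. *)
Lemma gram_complementary_minor (R : realType) m n (E : (2 + m)%N = n) (B G : 'M[R]_(2 + m, n)) :
  B *m G^T = 1%:M ->
  \det (usubmx G *m (usubmx G)^T) * \det (castmx (E, erefl n) B) ^+ 2 =
  \det (dsubmx B *m (dsubmx B)^T).
Proof.
subst n => BG; rewrite castmx_id.
pose P := B *m B^T; pose Q := G *m G^T.
have GB : G^T *m B = 1%:M by exact: mulmx1C.
have PQ : P *m Q = 1%:M.
  by rewrite /P /Q mulmxA -(mulmxA B) -[B^T *m G]trmxK trmx_mul trmxK GB trmx1 mulmx1.
have detP : \det P = \det B ^+ 2 by rewrite det_mulmx det_tr.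
have P22 : drsubmx P = dsubmx B *m (dsubmx B)^T.
  by rewrite /P -{1 2}[B]vsubmxK tr_col_mx mul_col_row block_mxKdr.
have Q11 : ulsubmx Q = usubmx G *m (usubmx G)^T.
  by rewrite /Q -{1 2}[G]vsubmxK tr_col_mx mul_col_row block_mxKul.
(* The first block column of [P *m Q = 1%:M], completed to an identity between block triangular
   factors; its determinants give the claim. *)
have E1 : P *m block_mx (ulsubmx Q) 0 (dlsubmx Q) 1%:M = block_mx 1%:M (ursubmx P) 0 (drsubmx P).
  have : block_mx (ulsubmx P) (ursubmx P) (dlsubmx P) (drsubmx P) *m
      block_mx (ulsubmx Q) (ursubmx Q) (dlsubmx Q) (drsubmx Q) = block_mx 1%:M 0 0 1%:M.
    by rewrite !submxK -scalar_mx_block.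
  rewrite mulmx_block => /eq_block_mx [e1 _ e3 _].
  by rewrite -[P in P *m _]submxK mulmx_block e1 e3 !mulmx0 !mulmx1 !add0r.
have := congr1 determinant E1; rewrite det_mulmx det_lblock det_ublock !det1 mulr1 mul1r P22 Q11 => <-.
by rewrite mulrC detP.
Qed.

Section stiffness_sign.
Context {R : realType} {d : nat} (T : mesh R d).
Local Notation node := 'I_(nvert T).
Local Notation X := (@vert R d T).
Implicit Types (i j : node) (K F : {set node}).

Section cell.
Variable K : {set node}.
Hypotheses (cK : #|K| = d.+1) (aK : aff_indep K).

Lemma bgrad_neq0 i p : i \in K -> p \in K -> p != i -> bgrad K i != 0.
Proof.
move=> iK pK pi; apply/eqP => g0.
have := baryB K i (X i) (X p); rewrite !bary_vert// eqxx eq_sym (negPf pi) g0 dotp0l subr0.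
by move/eqP; rewrite oner_eq0.
Qed.

(** The defining conditions determine the normal: in the expansion of [n] along the gradients,
    subtracting [dotp n (X p)] from all coefficients changes nothing, as the gradients sum to 0, and
    leaves only the term of [i], with negative coefficient. *)
Lemma outer_normalE i p : i \in K -> p \in K -> p != i ->
  outer_normal K i = - (enorm (bgrad K i))^-1 *: bgrad K i.
Proof.
move=> iK pK pi; set g := bgrad K i.
have g0 : 0 < enorm g by rewrite enorm_gt0 (bgrad_neq0 iK pK pi).
have gX j k : j \in K -> k \in K -> dotp g (X j - X k) = (i == j)%:R - (i == k)%:R.
  by move=> jK kK; rewrite -baryB !bary_vert.
rewrite /outer_normal; case: xgetP => [n _ [n1 n2 n3]|/(_ (- (enorm g)^-1 *: g))[]]; last first.
  split.
  - by rewrite enormZ normrN gtr0_norm ?invr_gt0// mulVf// gt_eqF.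
  - move=> j k; rewrite !inE => /andP[ji jK] /andP[ki kK].
    by rewrite dotpZl gX// ![i == _]eq_sym (negPf ji) (negPf ki) subrr mulr0.
  - move=> j; rewrite !inE => /andP[ji jK].
    by rewrite dotpZl gX// eqxx [i == _]eq_sym (negPf ji) subr0 mulr1 oppr_lt0 invr_gt0.
have pKi : p \in K :\ i by rewrite !inE pi.
pose c := dotp n (X i - X p).
have c0 : c < 0 by exact: n3.
have nE : n = c *: g.
  rewrite [LHS](bgrad_dual cK aK) -[LHS]subr0 -[X in _ - X](scaler0 _ (dotp n (X p))).
  rewrite -{2}(sum_bgrad cK aK) scaler_sumr -sumrB (bigD1 i)//= big1 ?addr0.
    by rewrite -scalerBl -dotpBr.
  move=> j /andP[jK ji]; rewrite -scalerBl -dotpBr n2 ?scale0r// !inE.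
  by rewrite ji.
rewrite nE; congr (_ *: _).
move: n1; rewrite nE enormZ ltr0_norm// => /(congr1 (fun x => x / enorm g)).
by rewrite mulfK ?gt_eqF// mul1r => <-; rewrite opprK.
Qed.

End cell.

Lemma nth_enumerates K p0 (L : seq node) : uniq L -> size L = d.+1 -> K =i L ->
  enumerates (fun k : 'I_d.+1 => nth p0 L k) K.
Proof.
move=> uL sL KL; split=> [k l /eqP|i].
  by rewrite nth_uniq ?sL// => /eqP /val_inj.
rewrite KL; apply/idP/existsP => [iL|[k /eqP <-]]; last by rewrite mem_nth// sL.
have iL' : (index i L < d.+1)%N by rewrite -sL index_mem.
by exists (Ordinal iL'); rewrite /= nth_index.
Qed.

(** The gradients form the basis dual to the edges, so the Gram determinant of two gradients is, up
    to the squared volume of [K], the complementary Gram determinant of the edges of the opposite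
    face. *)
Lemma simplex_vol_gram K i j : #|K| = d.+1 -> aff_indep K -> i \in K -> j \in K -> i != j -> (2 <= d)%N ->
  (d.-2)`!%:R * simplex_vol (K :\ i :\ j) =
  Num.sqrt (dotp (bgrad K i) (bgrad K i) * dotp (bgrad K j) (bgrad K j) -
            dotp (bgrad K i) (bgrad K j) ^+ 2) * (vol K / simplex_const R d).
Proof.
move=> cK aK iK jK ij d2; set F := K :\ i :\ j.
have cF : #|F|.+2 = d.+1.
  by rewrite -cK (cardsD1 i K) iK (cardsD1 j (K :\ i)) !inE eq_sym ij jK.
have F0 : (0 < #|F|)%N by move: cF d2; case: #|F| => // -[<-].
case eF : (enum F) => [|p q]; first by move: F0; rewrite cardE eF.
(* The base point [p] is taken on the opposite face: the edges to [i] and [j] are the first two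
   rows, the remaining ones span that face. *)
pose L := [:: p, i, j & q].
have sq : size q = #|F|.-1 by rewrite cardE eF.
have E : (2 + #|F|.-1)%N = d by rewrite add2n; case: cF; case: #|F| F0.
have memF k : (k \in F) = (k \in p :: q) by rewrite -eF mem_enum.
have uL : uniq L.
  have := enum_uniq (mem F); rewrite eF /= => /andP[pq uq].
  have pF : p \in F by rewrite memF inE eqxx.
  have iF : i \notin F by rewrite !inE eqxx andbF.
  have jF : j \notin F by rewrite !inE eqxx.
  have niq : i \notin q by apply: contra iF; rewrite memF inE orbC => ->.
  have njq : j \notin q by apply: contra jF; rewrite memF inE orbC => ->.
  rewrite /L /= !inE !negb_or uq pq ij niq njq !andbT.
  by apply/andP; split; [apply: contraNneq iF => <-|apply: contraNneq jF => <-].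
have sL : size L = d.+1 by rewrite /L /= sq -cF prednK.
have KL : K =i L.
  move=> k; rewrite /L !inE.
  have := memF k; rewrite !inE.
  have [->|ki] /= := eqVneq k i; first by rewrite iK orbT.
  have [->|kj] /= := eqVneq k j; first by rewrite jK orbT.
  by move=> ->.
have eK := nth_enumerates p uL sL KL.
pose B : 'M[R]_(2 + #|F|.-1, d) := \matrix_k (X (nth p L k.+1) - X p).
pose G : 'M[R]_(2 + #|F|.-1, d) := \matrix_k bgrad K (nth p L k.+1).
have mL k : (k < d.+1)%N -> nth p L k \in K by move=> kd; rewrite KL mem_nth// sL.
have kL (k : 'I_(2 + #|F|.-1)) : (k.+1 < d.+1)%N by rewrite ltnS -[X in (_ < X)%N]E.
have BG : B *m G^T = 1%:M.
  apply/matrixP => k l; rewrite !mxE.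
  transitivity (dotp (bgrad K (nth p L l.+1)) (X (nth p L k.+1) - X (nth p L 0))).
    by apply: eq_bigr => m _; rewrite !mxE mulrC.
  rewrite -baryB !bary_vert ?mL ?kL// !nth_uniq ?sL ?kL//.
  by rewrite eqSS subr0 eq_sym.
have := gram_complementary_minor E BG.
have -> : castmx (E, erefl d) B = edges (fun k : 'I_d.+1 => nth p L k).
  by apply/matrixP => k l; rewrite castmxE cast_ord_id [LHS]mxE [RHS]mxE.
have -> : \det (usubmx G *m (usubmx G)^T) =
    dotp (bgrad K i) (bgrad K i) * dotp (bgrad K j) (bgrad K j) - dotp (bgrad K i) (bgrad K j) ^+ 2.
  have entry k l : (usubmx G *m (usubmx G)^T) k l =
      dotp (bgrad K (nth p L (val k).+1)) (bgrad K (nth p L (val l).+1)).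
    by rewrite mxE; apply: eq_bigr => m _; rewrite !mxE.
  by rewrite det_mx2 !entry /= [in X in _ - _ * X]dotpC -expr2.
have -> : dsubmx B = \matrix_(k < #|F|.-1, l < d)
    ([seq X i | i <- enum F]`_k.+1 - [seq X i | i <- enum F]`_0) ord0 l.
  apply/matrixP => k l; rewrite [LHS]mxE [LHS]mxE [RHS]mxE eF /=.
  rewrite (nth_map p) ?sq//.
set D := \det (edges _) => h.
have [volK _] := vol_edges cK aK eK.
rewrite volK /simplex_vol -h sqrtrM ?subr_ge0 ?dotp_sqr_le// sqrtr_sqr.
have -> : #|F|.-1 = d.-2 by have := congr1 (fun m => m.-2) E.
have f0 : (d.-2)`!%:R != 0 :> R by rewrite pnatr_eq0 -lt0n fact_gt0.
have C0 : simplex_const R d != 0 by rewrite gt_eqF// simplex_const_gt0.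
by rewrite [LHS]mulrC mulfVK// [simplex_const R d * _]mulrC mulfK.
Qed.

(** Equality in Cauchy-Schwarz would make the gradients proportional; the edge from a third vertex
    [p] to [i], available since [2 <= d], tells them apart. *)
Lemma gram_bgrad_gt0 K i j : #|K| = d.+1 -> aff_indep K -> i \in K -> j \in K -> i != j -> (2 <= d)%N ->
  0 < dotp (bgrad K i) (bgrad K i) * dotp (bgrad K j) (bgrad K j) - dotp (bgrad K i) (bgrad K j) ^+ 2.
Proof.
move=> cK aK iK jK ij d2; rewrite lt_def subr_ge0 dotp_sqr_le andbT.
set gi := bgrad K i; set gj := bgrad K j; apply/eqP => h.
have /card_gt0P[p] : (0 < #|K :\ i :\ j|)%N.
  have := cK; rewrite (cardsD1 i K) iK (cardsD1 j (K :\ i)) !inE eq_sym ij jK.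
  by rewrite /= !add1n => -[cF]; rewrite -ltnS cF.
rewrite !inE => /and3P[pj pi pK].
have ji : j != i by rewrite eq_sym.
have w0 : dotp gj gj *: gi - dotp gi gj *: gj = 0.
  apply/eqP; rewrite -dotp_eq0 !(dotpBr, dotpDl, dotpNl, dotpZl, dotpZr) (dotpC gj gi).
  rewrite (_ : _ - _ = dotp gj gj * (dotp gi gi * dotp gj gj - dotp gi gj ^+ 2)); last by ring.
  by rewrite h mulr0.
have : dotp (dotp gj gj *: gi - dotp gi gj *: gj) (X i - X p) = 0 by rewrite w0 dotp0l.
rewrite dotpDl dotpNl !dotpZl -!baryB !bary_vert// eqxx !(negPf ji) ![_ == p]eq_sym (negPf pi) (negPf pj).
rewrite !subr0 mulr0 subr0 mulr1 => /eqP; rewrite dotp_eq0.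
by rewrite (negPf (bgrad_neq0 cK aK jK iK ij)).
Qed.

(** The dihedral angle is supplementary to the angle between the gradients, so its cotangent is
    minus their product over the square root of their Gram determinant; that root cancels against
    the volume of the opposite face. *)
Lemma monotone_cell_term K i j : #|K| = d.+1 -> aff_indep K -> i \in K -> j \in K -> i != j -> (2 <= d)%N ->
  (d * d.-1)%:R^-1 * simplex_vol (K :\ i :\ j) * (cos (dihedral K i j) / sin (dihedral K i j)) =
  - ((d * d.-1)%:R * (d.-2)`!%:R * simplex_const R d)^-1 * (vol K * dotp (bgrad K i) (bgrad K j)).
Proof.
move=> cK aK iK jK ij d2.
have := simplex_vol_gram cK aK iK jK ij d2.
have := gram_bgrad_gt0 cK aK iK jK ij d2.
set gi := bgrad K i; set gj := bgrad K j; set vl := simplex_vol _.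
have ji : j != i by rewrite eq_sym.
have ni : 0 < enorm gi by rewrite enorm_gt0 (bgrad_neq0 cK aK iK jK ji).
have nj : 0 < enorm gj by rewrite enorm_gt0 (bgrad_neq0 cK aK jK iK ij).
rewrite /dihedral (outer_normalE cK aK iK jK ji) (outer_normalE cK aK jK iK ij) -/gi -/gj.
rewrite dotpZl dotpZr.
set t := (- (enorm gi)^-1 * _).
have tE : t = dotp gi gj / (enorm gi * enorm gj).
  by rewrite /t invfM; ring.
have t1 : -1 <= t <= 1.
  rewrite -ler_norml tE normrM normfV (gtr0_norm (mulr_gt0 ni nj)) ler_pdivrMr ?mulr_gt0// mul1r.
  exact: dotp_le_enorm.
have sE : sin (acos t) = Num.sqrt (dotp gi gi * dotp gj gj - dotp gi gj ^+ 2) / (enorm gi * enorm gj).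
  rewrite sin_acos// tE.
  have -> : 1 - (dotp gi gj / (enorm gi * enorm gj)) ^+ 2 =
      (dotp gi gi * dotp gj gj - dotp gi gj ^+ 2) * ((enorm gi * enorm gj)^-1) ^+ 2.
    rewrite -!enorm_sqr; field; apply/andP; split; exact: lt0r_neq0.
  by rewrite sqrtrM ?subr_ge0 ?dotp_sqr_le// sqrtr_sqr gtr0_norm// invr_gt0 mulr_gt0.
rewrite cosB sinB cospi sinpi acosK ?inE// sE.
set S := Num.sqrt _ => G0 hv.
have S0 : S != 0 by rewrite gt_eqF// sqrtr_gt0.
have f0 : (d.-2)`!%:R != 0 :> R by rewrite pnatr_eq0 -lt0n fact_gt0.
have C0 : simplex_const R d != 0 by rewrite gt_eqF// simplex_const_gt0.
have vlE : vl = S * (vol K / simplex_const R d) / (d.-2)`!%:R by rewrite -hv mulrAC mulfV// mul1r.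
rewrite vlE tE; move: f0 C0; set f := (d.-2)`!%:R; set C := simplex_const R d; set dd := (d * d.-1)%:R.
move=> f0 C0; have n0 : enorm gi * enorm gj != 0 by rewrite gt_eqF// mulr_gt0.
have [->|dd0] := eqVneq dd 0; first by rewrite !mul0r invr0 !mul0r oppr0 mul0r.
move: n0; set nn := enorm gi * enorm gj => n0.
rewrite !mul0r mulN1r mulN1r addr0 sub0r opprK; clearbody f C dd nn S.
by field; rewrite S0 n0 f0 C0 dd0.
Qed.

(** Defined for all pairs of vertices, boundary included. On the diagonal it is nonpositive, and all
    conductances at a vertex sum to 0. *)
Definition conductance i j : R := - \sum_(K in cells T) vol K * dotp (bgrad K i) (bgrad K j).

Lemma conductanceC i j : conductance i j = conductance j i.
Proof. by congr (- _); apply: eq_bigr => K _; rewrite dotpC. Qed.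

Lemma vol_ge0 K : 0 <= vol K.
Proof. by rewrite fine_ge0// measure_ge0. Qed.

(** The monotonicity sum is a positive multiple of the conductance. For [d = 1] the two gradients of
    a segment are opposite. *)
Lemma conductance_ge0 i j : (0 < d)%N -> (forall K, K \in cells T -> #|K| = d.+1 /\ aff_indep K) ->
  ((2 <= d)%N -> monotone_mesh T) -> i != j -> 0 <= conductance i j.
Proof.
move=> d0 hT mono ij.
have E : conductance i j = - \sum_(K in cells T | (i \in K) && (j \in K)) vol K * dotp (bgrad K i) (bgrad K j).
  congr (- _); rewrite [LHS](bigID (fun K => (i \in K) && (j \in K)))/= [X in _ + X]big1 ?addr0//.
  move=> K /andP[/hT[cK aK]]; rewrite negb_and => /orP[] h.
    by rewrite (bgrad_notin cK aK h) dotp0l mulr0.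
  by rewrite (bgrad_notin cK aK h) dotp0r mulr0.
rewrite {}E; have [d2|d2] := leqP 2 d.
  have := mono d2 i j ij.
  rewrite (eq_bigr (fun K => - ((d * d.-1)%:R * (d.-2)`!%:R * simplex_const R d)^-1 *
    (vol K * dotp (bgrad K i) (bgrad K j)))); last first.
    by move=> K /and3P[/hT[cK aK] iK jK]; exact: monotone_cell_term.
  rewrite -mulr_sumr mulNr -mulrN pmulr_rge0// invr_gt0 !mulr_gt0 ?simplex_const_gt0// ltr0n ?fact_gt0//.
  by case: (d) d2 => [|[|?]].
rewrite -sumrN sumr_ge0// => K /and3P[/hT[cK aK] iK jK].
have d1 : d = 1%N by apply/eqP; rewrite eqn_leq d0 andbT -ltnS.
have KE : K = [set i; j]%SET.
  apply/eqP; rewrite eq_sym eqEcard cards2 ij cK; apply/andP; split; last by rewrite ltnS {1}d1.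
  by apply/fintype.subsetP => k; rewrite !inE => /orP[] /eqP ->.
have := sum_bgrad cK aK; rewrite {1}KE big_setU1 ?inE//= big_set1 => /eqP; rewrite addr_eq0 => /eqP ->.
by rewrite dotpNl mulrN opprK mulr_ge0 ?vol_ge0 ?dotp_ge0.
Qed.

End stiffness_sign.

(** * Meshes of the cube and P1 interpolation *)

Section cube.
Context {R : realType} {d : nat}.
Implicit Types (x y : 'rV[R]_d) (r : R).

Lemma measurable_cube r : measurable (cube r : set 'rV[R]_d).
Proof.
have := @measurable_box R d (fun _ => `[- r, r]%classic) (fun i => measurable_itv _).
by congr measurable; apply/seteqP; split=> x /= h i; have := h i; rewrite in_itv.
Qed.

Lemma lebesgue_rV_cube r : 0 <= r -> lebesgue_rV d (cube r) = ((2 * r) ^+ d)%:E.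
Proof.
move=> r0; rewrite (_ : cube r = [set x : 'rV[R]_d | forall i, `[- r, r]%classic (x ord0 i)]); last first.
  by apply/seteqP; split=> x /= h i; have := h i; rewrite in_itv.
rewrite (@lebesgue_rV_box R d (fun _ => `[- r, r]%classic) (fun i => measurable_itv _)).
rewrite (eq_bigr (fun _ => (2 * r)%:E)); last first.
  move=> i _; rewrite lebesgue_measure_itv/= lte_fin.
  move: r0; rewrite le_eqVlt => /predU1P[<-|r0]; first by rewrite oppr0 ltxx mulr0.
  by rewrite gtrN// -EFinD; congr EFin; ring.
by rewrite prodEFin prodr_const card_ord.
Qed.

Lemma cube_convex r x y s : cube r x -> cube r y -> 0 <= s <= 1 -> cube r ((1 - s) *: x + s *: y).
Proof.
move=> hx hy /andP[s0 s1] i; rewrite !mxE.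
have /andP[a1 a2] := hx i; have /andP[b1 b2] := hy i.
have s1' : 0 <= 1 - s by rewrite subr_ge0.
apply/andP; split.
  have := ler_wpM2l s1' a1; have := ler_wpM2l s0 b1; lra.
have := ler_wpM2l s1' a2; have := ler_wpM2l s0 b2; lra.
Qed.

Lemma dotp_cube_le r x y : cube r x -> cube r y -> dotp (x - y) (x - y) <= d%:R * (2 * r) ^+ 2.
Proof.
move=> hx hy; rewrite mulr_natl -[d in X in _ <= X]card_ord -sumr_const; apply: ler_sum => i _.
rewrite !mxE -expr2 -real_normK ?num_real// ler_pXn2r// ?nnegrE//; last 2 first.
- have /andP[a1 a2] := hx i; have /andP[b1 b2] := hy i.
  by rewrite ler_norml; apply/andP; split; lra.
- by have /andP[a1 a2] := hx i; lra.
Qed.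

Lemma cube_normP r x : 0 <= r -> cube r x <-> `|x| <= r.
Proof.
move=> r0; split=> [h|h i].
  rewrite [leLHS]mx_normrE; apply/bigmax_leP; split => // -[i j] _ /=.
  by rewrite ord1 ler_norml; exact: h.
rewrite -ler_norml; apply: le_trans h; rewrite [leRHS]mx_normrE.
exact: (le_bigmax _ (fun k => `|x k.1 k.2|) (ord0, i)).
Qed.

Lemma cube_interiorP r x : (0 < d)%N -> 0 < r -> (cube r)° x <-> `|x| < r.
Proof.
move=> d0 r0; split; last first.
  move=> xr; apply/nbhs_ballP; exists (r - `|x|); first by rewrite /= subr_gt0.
  move=> y; rewrite -ball_normE /= => xy; apply/cube_normP; first exact: ltW.
  rewrite -[y](subrK x) addrC; apply: (le_trans (ler_normD _ _)).
  by rewrite -lerBrDl; apply/ltW; rewrite distrC.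
move=> /nbhs_ballP[e /= e0 he].
have xr : `|x| <= r.
  by apply/cube_normP; [exact: ltW|apply: he; exact: ballxx].
rewrite lt_neqAle xr andbT; apply/eqP => nx.
(* A point of norm [r], dilated by [t], stays in the ball of radius [e] but leaves the cube. *)
pose t := 1 + e / (2 * r).
have : cube r (t *: x).
  apply: he; rewrite -ball_normE /= /t scalerDl scale1r opprD addNKr normrN normrZ nx.
  by rewrite ger0_norm ?divr_ge0 ?mulr_ge0 ?ltW// invfM mulrA mulfVK ?gt_eqF//; lra.
move=> /(cube_normP _ (ltW r0)).1; rewrite normrZ nx ger0_norm; last first.
  by rewrite addr_ge0// divr_ge0 ?mulr_ge0// ltW.
rewrite -ler_pdivlMr// mulfV ?gt_eqF// leNgt => /negP; apply.
by rewrite ltrDl divr_gt0// mulr_gt0.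
Qed.
End cube.

(** * Volumes of the cells of a mesh of the cube *)

Lemma measure_le_sum (R : realType) d (T : measurableType d) (mu : {measure set T -> \bar R})
    (I : finType) (P : pred I) (A : set T) (F : I -> set T) :
  measurable A -> (forall i, P i -> measurable (F i)) ->
  (forall x, A x -> exists2 i, P i & F i x) -> (mu A <= \sum_(i | P i) mu (F i))%E.
Proof.
move=> mA mF cov.
pose U := \big[setU/set0]_(i | P i) F i.
have mU : measurable U by apply: bigsetU_measurable.
apply: (@le_trans _ _ (mu U)).
  apply: le_measure; rewrite ?inE// => x /cov[i Pi Fi].
  by rewrite /U -bigcup_seq_cond; exists i => //=; rewrite mem_index_enum.
rewrite /U; elim: (index_enum I) => [|i r IH]; first by rewrite !big_nil measure0.
rewrite !big_cons; case: ifP => // Pi.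
apply: (@le_trans _ _ (mu (F i) + mu (\big[setU/set0]_(j <- r | P j) F j))%E).
  by apply: measureU2; [exact: mF|exact: bigsetU_measurable].
exact: leeD2l.
Qed.

Section mesh_volume.
Context {R : realType} {d : nat} (T : mesh R d) (L : R).
Local Notation node := 'I_(nvert T).
Local Notation X := (@vert R d T).
Local Notation mu := (@lebesgue_rV R d).
Implicit Types (i j : node) (K F : {set node}).
Hypothesis d0 : (0 < d)%N.
Hypothesis L0 : 0 < L.
Hypothesis conf : conforming_mesh T (cube L).

Lemma cell_simplex K : K \in cells T -> #|K| = d.+1 /\ aff_indep K.
Proof. by case: conf => _ _ h _ _; exact: h. Qed.

Lemma hull_sub_cube K : K \in cells T -> hull K `<=` cube L.
Proof. by case: conf => _ _ _ -> _ KT x Kx; exists K. Qed.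

Lemma cube_cover x : cube L x -> exists2 K, K \in cells T & hull K x.
Proof. by case: conf => _ _ _ -> _ [K KT Kx]; exists K. Qed.

Lemma cell_nonempty K : K \in cells T -> exists i, i \in K.
Proof. by move=> /cell_simplex[cK _]; apply/card_gt0P; rewrite cK. Qed.

Lemma mu_hull K : K \in cells T -> mu (hull K) = (vol K)%:E.
Proof. by move=> /cell_simplex[cK aK]; have [e eK] := exists_enumerates cK; case: (vol_edges cK aK eK). Qed.

Lemma vol_gt0 K : K \in cells T -> 0 < vol K.
Proof.
move=> /cell_simplex[cK aK]; have [e eK] := exists_enumerates cK.
have [-> _] := vol_edges cK aK eK.
rewrite mulr_gt0 ?simplex_const_gt0// normr_gt0.
by have [+ _] := mulmx1_unit (edges_bgrad cK aK eK); rewrite unitmxE unitfE.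
Qed.

Lemma mhull K : K \in cells T -> measurable (hull K).
Proof. by move=> /cell_simplex[cK aK]; exact: measurable_hull. Qed.

Lemma hull_convex_cell K x y s : K \in cells T -> hull K x -> hull K y -> 0 <= s <= 1 ->
  hull K ((1 - s) *: x + s *: y).
Proof. by move=> /cell_simplex[cK aK]; exact: hull_convex. Qed.

(** By conformity the intersection is spanned by common vertices, so the barycentric coordinate of a
    vertex of [K] outside [K'] vanishes on it: it lies in a hyperplane. *)
Lemma hull_overlap_null K K' : K \in cells T -> K' \in cells T -> K != K' ->
  mu (hull K `&` hull K') = 0%E.
Proof.
move=> KT K'T KK'; have [cK aK] := cell_simplex KT; have [cK' aK'] := cell_simplex K'T.
have [i iK iK'] : exists2 i, i \in K & i \notin K'.
  apply/fintype.subsetPn; apply: contra KK' => KsK'.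
  by rewrite eqEcard KsK' cK cK' leqnn.
have /card_gt0P[p] : (0 < #|K :\ i|)%N by move: cK; rewrite (cardsD1 i K) iK add1n => -[->].
rewrite !inE => /andP[pi pK].
have gi := bgrad_neq0 cK aK iK pK pi.
apply/eqP; rewrite eq_le measure_ge0 andbT -(lebesgue_rV_hyperplane (- (bcoef K i).1) gi).
apply: le_measure; rewrite ?inE.
- by apply: measurableI; exact: mhull.
- have := measurable_fun_dotp (bgrad K i) measurableT (measurable_set1 (- (bcoef K i).1)).
  by rewrite setTI.
move=> x /= xx; have : hull (K :&: K') x by case: conf => _ _ _ _ <-.
move=> [t [_ t1 xE]].
have : bary K i x = 0.
  by rewrite xE (bary_face cK aK)// ?finset.subsetIl// inE iK (negPf iK').
by rewrite /bary => /eqP; rewrite addrC addr_eq0 => /eqP.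
Qed.

(** Closed cells share faces; removing the other cells gives disjoint sets of the same volume.
    Vertex sets which are not cells get [set0], so that the family is indexed by a finite type. *)
Definition core K : set 'rV[R]_d :=
  if K \in cells T then hull K `\` \bigcup_(K' in [set K' | K' \in cells T /\ K' != K]) hull K' else set0.

Definition cell_hull K : set 'rV[R]_d := if K \in cells T then hull K else set0.

Definition cell_vol K : R := if K \in cells T then vol K else 0.

Lemma measurable_cell_hull K : measurable (cell_hull K).
Proof. by rewrite /cell_hull; case: ifP => // /mhull. Qed.

Let others K := [set K' | K' \in cells T /\ K' != K].

Let mothers K : measurable (\bigcup_(K' in others K) hull K').
Proof.
by apply: fin_bigcup_measurable => [|K' [K'T _]]; [exact: finite_finset|exact: mhull].
Qed.

Lemma measurable_core K : measurable (core K).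
Proof. by rewrite /core; case: ifP => // KT; apply: measurableD; [exact: mhull|exact: mothers]. Qed.

Lemma core_hull K x : core K x -> K \in cells T /\ hull K x.
Proof. by rewrite /core; case: ifP => // KT [Kx _]. Qed.

Lemma trivIset_core : trivIset setT core.
Proof.
move=> K K' _ _ [x [Kx K'x]]; apply/eqP; apply: contrapT => /negP KK'.
have [KT hKx] := core_hull Kx.
by move: K'x; rewrite /core; case: ifP => // K'T [_]; apply; exists K.
Qed.

Lemma mu_cell_hull K : mu (cell_hull K) = (cell_vol K)%:E.
Proof. by rewrite /cell_hull /cell_vol; case: ifP => [/mu_hull//|_]; rewrite measure0. Qed.

(** The cell is covered by its core and its null intersections with the other cells. *)
Lemma mu_core K : mu (core K) = (cell_vol K)%:E.
Proof.
have mv : (mu (core K) <= (cell_vol K)%:E)%E.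
  rewrite -mu_cell_hull; apply: le_measure; rewrite ?inE.
  - exact: measurable_core.
  - exact: measurable_cell_hull.
  - by move=> x /core_hull[KT Kx]; rewrite /cell_hull KT.
apply/eqP; rewrite eq_le mv /= /cell_vol; case: ifPn => [KT|_]; last exact: measure_ge0.
have meas K' : K' \in cells T -> measurable (if K' == K then core K else hull K `&` hull K').
  move=> K'T; case: ifP => _; first exact: measurable_core.
  by apply: measurableI; exact: mhull.
rewrite -mu_hull//.
have -> : mu (core K) = (\sum_(K' in cells T) mu (if K' == K then core K else hull K `&` hull K'))%E.
  rewrite (bigD1 K)//= eqxx big1 ?adde0// => K' /andP[K'T K'K].
  by rewrite (negPf K'K) hull_overlap_null// eq_sym.
apply: measure_le_sum => //; first exact: mhull.
move=> x Kx; case: (pselect (exists2 K', (K' \in cells T) && (K' != K) & hull K' x)).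
  by move=> [K' /andP[K'T K'K] K'x]; exists K' => //; rewrite (negPf K'K).
move=> nx; exists K => //; rewrite eqxx /core KT; split => // -[K' [K'T K'K] K'x].
by apply: nx; exists K' => //; rewrite K'T.
Qed.

Lemma sum_vol_le (P : pred {set node}) (S : set 'rV[R]_d) (s : R) : measurable S -> mu S = s%:E ->
  (forall K, K \in cells T -> P K -> hull K `<=` S) -> \sum_(K in cells T | P K) vol K <= s.
Proof.
move=> mS muS hS; rewrite -lee_fin -muS.
rewrite -sumEFin (eq_bigr (fun K => mu (core K))); last by move=> K /andP[KT _]; rewrite mu_core /cell_vol KT.
have f0 (x : 'rV[R]_d) : (0 <= (\1_S x)%:E :> \bar R)%E by rewrite lee_fin.
have mf : measurable_fun setT (fun x : 'rV[R]_d => (\1_S x)%:E : \bar R) by apply/measurable_EFinP.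
have := sum_integral_trivIset_le mu measurable_core trivIset_core mf f0.
rewrite integral_indic// setIT; apply: le_trans.
rewrite big_mkcond/=; apply: lee_sum => K _; case: ifP => [/andP[KT PK]|_]; last exact: integral_ge0.
rewrite integral_indic//; last exact: measurable_core.
rewrite setIC (setIidl _)// => x /core_hull[_ Kx]; exact: hS Kx.
Qed.

Lemma le_sum_vol (P : pred {set node}) (S : set 'rV[R]_d) (s : R) : measurable S -> mu S = s%:E ->
  (forall x, S x -> exists K, [/\ K \in cells T, P K & hull K x]) ->
  s <= \sum_(K in cells T | P K) vol K.
Proof.
move=> mS muS hS; rewrite -lee_fin -muS -sumEFin.
rewrite (eq_bigr (fun K => mu (hull K))); last by move=> K /andP[KT _]; rewrite mu_hull.
apply: measure_le_sum => //; first by move=> K /andP[KT _]; exact: mhull.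
by move=> x /hS[K [KT PK Kx]]; exists K => //; rewrite KT.
Qed.

Lemma sum_vol : \sum_(K in cells T) vol K = (2 * L) ^+ d.
Proof.
have mu_cube := lebesgue_rV_cube (ltW L0) (d := d).
apply/eqP; rewrite eq_le; apply/andP; split.
  have := @sum_vol_le predT _ _ (measurable_cube L) mu_cube.
  under eq_bigl => K do rewrite andbT.
  by apply => K KT _; exact: hull_sub_cube.
have := @le_sum_vol predT _ _ (measurable_cube L) mu_cube.
under eq_bigl => K do rewrite andbT.
by apply => x /cube_cover[K KT Kx]; exists K.
Qed.

End mesh_volume.

(** * Consequences of shape regularity *)

Section mesh_shape.
Context {R : realType} {d : nat} (T : mesh R d) (L : R).
Local Notation node := 'I_(nvert T).
Local Notation X := (@vert R d T).
Implicit Types (i j : node) (K F : {set node}) (f : node -> R).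
Hypothesis d0 : (0 < d)%N.
Hypothesis L0 : 0 < L.
Hypothesis conf : conforming_mesh T (cube L).

Let cs K : K \in cells T -> #|K| = d.+1 /\ aff_indep K := @cell_simplex _ _ T L conf K.

Lemma enorm_le_diam K x y : K \in cells T -> hull K x -> hull K y -> enorm (x - y) <= diam (hull K).
Proof.
move=> KT Kx Ky; apply: ub_le_sup; last by exists (x, y).
exists (Num.sqrt (d%:R * (2 * L) ^+ 2)) => _ [[a b] [/= Ka Kb] <-].
by rewrite ler_wsqrtr// dotp_cube_le//; exact: (hull_sub_cube conf KT).
Qed.

Lemma diam_ge0 K : K \in cells T -> 0 <= diam (hull K).
Proof.
move=> KT; have [i iK] := cell_nonempty conf KT; have [cK aK] := cs KT.
by apply: (le_trans (enorm_ge0 (X i - X i))); apply: enorm_le_diam => //; exact: vert_hull.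
Qed.

Lemma diam_le_mesh_size K : K \in cells T -> diam (hull K) <= mesh_size T.
Proof. by move=> KT; rewrite /mesh_size (bigD1 K)//= le_max lexx. Qed.

Lemma mesh_size_ge0 : 0 <= mesh_size T.
Proof. by rewrite /mesh_size; elim/big_ind: _ => // [x y x0 y0|K /diam_ge0//]; rewrite le_max x0. Qed.

Definition pgrad f K : 'rV[R]_d := \sum_(i in K) f i *: bgrad K i.

Lemma pgradB f K x y : dotp (pgrad f K) (x - y) = \sum_(i in K) f i * bary K i x - \sum_(i in K) f i * bary K i y.
Proof.
rewrite /pgrad dotp_suml -sumrB; apply: eq_bigr => i _.
by rewrite dotpZl -baryB mulrBr.
Qed.

(** Two opposite points of a ball of radius [r], in the direction of [g], differ by
    [2 * r * enorm g] under [dotp g]. *)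
Lemma inball_ubound K (g : 'rV[R]_d) (m : R) : g != 0 ->
  (forall x y, hull K x -> hull K y -> dotp g (x - y) <= m) ->
  ubound [set 2 * r | r in [set r | 0 <= r /\ exists x, [set y | enorm (y - x) <= r] `<=` hull K]]
    (m / enorm g).
Proof.
rewrite -enorm_gt0 => gp h _ [r [r0 [x hx]] <-].
pose v := (r / enorm g) *: g.
have vr : enorm v = r by rewrite enormZ ger0_norm ?divr_ge0// ?enorm_ge0// divfK// gt_eqF.
have h1 : hull K (x + v) by apply: hx; rewrite /= addrC addKr vr.
have h2 : hull K (x - v) by apply: hx; rewrite /= addrC addKr enormN vr.
have := h _ _ h1 h2; rewrite (_ : x + v - (x - v) = 2 *: v); last first.
  by rewrite scaler_nat mulr2n opprB addrC addrA subrK.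
rewrite dotpZr dotpZr -enorm_sqr ler_pdivlMr// => h3.
apply: le_trans h3; rewrite le_eqVlt; apply/orP; left; apply/eqP.
by field; rewrite gt_eqF.
Qed.

Lemma enorm_inball_le K (g : 'rV[R]_d) (m : R) : K \in cells T ->
  (forall x y, hull K x -> hull K y -> dotp g (x - y) <= m) -> enorm g * inball_diam (hull K) <= m.
Proof.
move=> KT h; have [i iK] := cell_nonempty conf KT; have [cK aK] := cs KT.
have Ki : hull K (X i) by exact: vert_hull.
have [->|g0] := eqVneq g 0.
  have -> : enorm (0 : 'rV[R]_d) = 0 by apply/eqP; rewrite enorm_eq0.
  by rewrite mul0r; have := h _ _ Ki Ki; rewrite subrr dotp0r.
rewrite mulrC -ler_pdivlMr ?enorm_gt0//; apply: ge_sup; last exact: inball_ubound.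
exists (2 * 0), 0 => //; split => //; exists (X i) => y /= yX.
suff -> : y = X i by [].
by apply/eqP; rewrite -subr_eq0 -enorm_eq0 eq_le yX enorm_ge0.
Qed.

Lemma bary_osc_le1 K i x y : K \in cells T -> hull K x -> hull K y -> dotp (bgrad K i) (x - y) <= 1.
Proof.
move=> KT Kx Ky; have [cK aK] := cs KT; rewrite -baryB.
have [iK|iK] := boolP (i \in K); last by rewrite !bary_notin// subrr.
have := bary_hull_le1 cK aK i Kx; have /(hullP cK aK) /(_ i iK) := Ky; lra.
Qed.

(** Without this, [x / 0 = 0] would make the shape constraint say nothing about the cell. *)
Lemma inball_diam_gt0 K : K \in cells T -> 0 < inball_diam (hull K).
Proof.
move=> KT; have [i iK] := cell_nonempty conf KT; have [cK aK] := cs KT.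
pose x := \sum_(j in K) (d.+1%:R^-1) *: X j.
have t1 : \sum_(j in K) (d.+1%:R^-1 : R) = 1.
  by rewrite sumr_const cK -[_ *+ _]mulr_natr mulVf// pnatr_eq0.
pose M := 1 + \sum_(j in K) enorm (bgrad K j).
have M0 : 0 < M by rewrite ltr_pwDl// sumr_ge0// => j _; exact: enorm_ge0.
(* At the barycenter [x] all barycentric coordinates are 1 / (d + 1), and [M] bounds their
   gradients: they remain nonnegative up to distance [r]. *)
pose r := (d.+1%:R * M)^-1.
have r0 : 0 < r by rewrite invr_gt0 mulr_gt0.
apply: (@lt_le_trans _ _ (2 * r)); first by rewrite mulr_gt0.
apply: ub_le_sup; last first.
  exists r => //; split; first exact: ltW.
  exists x => y /= yx; apply/hullP => // j jK.
  have bx : bary K j x = d.+1%:R^-1 by rewrite (bary_hull_coef cK aK jK t1).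
  rewrite -[bary K j y](subrK (bary K j x)) baryB bx -lerBlDr sub0r.
  have := dotp_le_enorm (bgrad K j) (y - x); rewrite ler_norml => /andP[+ _].
  apply: le_trans; rewrite lerN2.
  have gM : enorm (bgrad K j) <= M.
    by rewrite /M (bigD1 j)//= addrCA lerDl addr_ge0// sumr_ge0// => k _; exact: enorm_ge0.
  apply: (@le_trans _ _ (M * r)); first by apply: ler_pM => //; exact: enorm_ge0.
  by rewrite /r invfM mulrCA mulfV ?mulr1// gt_eqF.
have [p pK pi] : exists2 p, p \in K & p != i.
  have /card_gt0P[p] : (0 < #|K :\ i|)%N by move: cK; rewrite (cardsD1 i K) iK add1n => -[->].
  by rewrite !inE => /andP[pi pK]; exists p.
have gi := bgrad_neq0 cK aK iK pK pi.
exists (1 / enorm (bgrad K i)); apply: inball_ubound gi _ => x' y; exact: bary_osc_le1.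
Qed.

Variable sigma : R.
Hypothesis shape : shape_regular T sigma.

Lemma diam_le_inball K : K \in cells T -> diam (hull K) <= sigma * inball_diam (hull K).
Proof. by move=> KT; rewrite -ler_pdivrMr ?inball_diam_gt0//; exact: shape. Qed.

Lemma shape_ge0 K : K \in cells T -> 0 <= sigma.
Proof.
by move=> KT; apply: le_trans (shape KT); rewrite divr_ge0 ?diam_ge0// ltW// inball_diam_gt0.
Qed.

(** A barycentric coordinate oscillates by at most 1 on the cell, so its gradient is at most the
    inverse of the inball diameter. *)
Lemma bgrad_diam_le K i : K \in cells T -> enorm (bgrad K i) * diam (hull K) <= sigma.
Proof.
move=> KT; apply: (@le_trans _ _ (enorm (bgrad K i) * (sigma * inball_diam (hull K)))).
  by apply: ler_wpM2l; [exact: enorm_ge0|exact: diam_le_inball].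
rewrite mulrCA -[leRHS]mulr1; apply: ler_wpM2l; first exact: shape_ge0 KT.
by apply: enorm_inball_le => // x y; exact: bary_osc_le1.
Qed.

(** The interpolant stays within [Lam * diam (hull K)] of a vertex value, hence oscillates by at
    most twice that; divide by the inball diameter. *)
Lemma pgrad_lipschitz_le K f (Lam : R) : K \in cells T -> 0 <= Lam ->
  (forall i j, i \in K -> j \in K -> `|f i - f j| <= Lam * enorm (X i - X j)) ->
  enorm (pgrad f K) <= 2 * Lam * sigma.
Proof.
move=> KT Lam0 hf; have [cK aK] := cs KT; have [i0 iK0] := cell_nonempty conf KT.
have ib := inball_diam_gt0 KT.
rewrite -(ler_pM2r ib); apply: (@le_trans _ _ (2 * Lam * diam (hull K))); last first.
  rewrite -[2 * Lam * sigma * _]mulrA; apply: ler_wpM2l; first by rewrite mulr_ge0.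
  exact: diam_le_inball.
have h x : hull K x -> `|\sum_(i in K) f i * bary K i x - f i0| <= Lam * diam (hull K).
  move=> Kx; have hx := (hullP cK aK x).1 Kx.
  rewrite -[f i0 in X in `|_ - X|]mulr1 -(sum_bary cK aK x) mulr_sumr -sumrB.
  apply: (le_trans (ler_norm_sum _ _ _)).
  rewrite -[leRHS]mulr1 -(sum_bary cK aK x) mulr_sumr; apply: ler_sum => i iK.
  rewrite -mulrBl normrM (ger0_norm (hx i iK)); apply: ler_wpM2r; first exact: hx.
  apply: (le_trans (hf i i0 iK iK0)); apply: ler_wpM2l => //.
  by apply: enorm_le_diam => //; exact: vert_hull.
apply: enorm_inball_le => // x y Kx Ky; rewrite pgradB.
have := h x Kx; have := h y Ky; rewrite !ler_norml => /andP[a1 a2] /andP[b1 b2]; lra.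
Qed.
End mesh_shape.

(** * P1 interpolants and their variation along segments *)

Section p1_interpolant.
Context {R : realType} {d : nat} (T : mesh R d) (L : R).
Local Notation node := 'I_(nvert T).
Local Notation X := (@vert R d T).
Implicit Types (i j : node) (K F : {set node}) (f : node -> R).
Hypothesis d0 : (0 < d)%N.
Hypothesis L0 : 0 < L.
Hypothesis conf : conforming_mesh T (cube L).

Let cs K : K \in cells T -> #|K| = d.+1 /\ aff_indep K := @cell_simplex _ _ T L conf K.

(** By conformity [x] is a convex combination of common vertices, whose coefficients are the
    barycentric coordinates in either cell. This makes [p1] independent of the cell chosen. *)
Lemma bary_agree K K' x i : K \in cells T -> K' \in cells T -> hull K x -> hull K' x ->
  bary K i x = bary K' i x.
Proof.
move=> KT K'T Kx K'x; have [cK aK] := cs KT; have [cK' aK'] := cs K'T.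
have : hull (K :&: K') x by case: conf => _ _ _ _ <-.
move=> [t [_ t1 ->]]; rewrite (bary_face cK aK) ?finset.subsetIl//.
by rewrite (bary_face cK' aK') ?finset.subsetIr.
Qed.

Definition p1 f x : R :=
  if [pick K | (K \in cells T) && `[< hull K x >]] is Some K then \sum_i f i * bary K i x else 0.

Lemma sum_bary_cell f K x : K \in cells T -> \sum_i f i * bary K i x = \sum_(i in K) f i * bary K i x.
Proof.
move=> KT; have [cK aK] := cs KT; rewrite [RHS]big_mkcond; apply: eq_bigr => i _.
by case: ifPn => // iK; rewrite bary_notin// mulr0.
Qed.

Lemma p1E f K x : K \in cells T -> hull K x -> p1 f x = \sum_(i in K) f i * bary K i x.
Proof.
move=> KT Kx; rewrite -sum_bary_cell// /p1; case: pickP => [K' /andP[K'T /asboolP K'x]|/(_ K)].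
  by apply: eq_bigr => i _; rewrite (@bary_agree K' K).
by rewrite KT/= asboolT.
Qed.

Lemma p1_vert f i : p1 f (X i) = f i.
Proof.
have [K KT iK] : exists2 K, K \in cells T & i \in K by case: conf => _ h _ _ _; exact: h.
have [cK aK] := cs KT; rewrite (p1E f KT (vert_hull cK aK iK)) (bigD1 i)//= bary_vert// eqxx mulr1.
by rewrite big1 ?addr0// => j /andP[jK ji]; rewrite bary_vert// (negPf ji) mulr0.
Qed.

Lemma p1B f K x y : K \in cells T -> hull K x -> hull K y -> p1 f x - p1 f y = dotp (pgrad f K) (x - y).
Proof. by move=> KT Kx Ky; rewrite (p1E f KT Kx) (p1E f KT Ky) pgradB. Qed.

Lemma p1_lip f K x y : K \in cells T -> hull K x -> hull K y ->
  `|p1 f x - p1 f y| <= enorm (pgrad f K) * enorm (x - y).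
Proof. by move=> KT Kx Ky; rewrite (p1B f KT)//; exact: dotp_le_enorm. Qed.

Lemma p1_osc f K x y : K \in cells T -> hull K x -> hull K y ->
  `|p1 f x - p1 f y| <= enorm (pgrad f K) * mesh_size T.
Proof.
move=> KT Kx Ky; apply: (le_trans (p1_lip f KT Kx Ky)); apply: ler_wpM2l; first exact: enorm_ge0.
by apply: (le_trans (enorm_le_diam conf KT Kx Ky)); exact: diam_le_mesh_size.
Qed.

(** All cells meeting the smaller cube are counted: a segment inside that cube crosses no other. *)
Definition cell_energy (r : R) f K : R :=
  if (K \in cells T) && `[< hull K `&` cube r !=set0 >] then dotp (pgrad f K) (pgrad f K) else 0.

Lemma cell_energy_ge0 r f K : 0 <= cell_energy r f K.
Proof. by rewrite /cell_energy; case: ifP => // _; exact: dotp_ge0. Qed.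

(** In each crossed cell the interpolant is Lipschitz in time with constant [c K], and the times
    spent in a cell form a closed interval by convexity, so the chain inequality on [[0, 1]]
    applies; the segment stays in [cube r]. *)
Lemma segment_energy f (r l M : R) x z : r <= L -> 0 <= l <= 1 -> cube r x -> cube r z ->
  dotp (x - z) (x - z) <= M ->
  (((p1 f ((1 - l) *: x + l *: z) - p1 f x) ^+ 2)%:E <=
    (l ^+ 2 * M)%:E * path_energy (@cell_hull R d T) (cell_energy r f) l x z)%E.
Proof.
move=> rL /andP[l0 l1] Qx Qz hM.
pose gam s := (1 - s * l) *: x + (s * l) *: z.
pose A K := [set s : R | hull K (gam s)].
pose S := [set K in cells T | `[< hull K `&` cube r !=set0 >]]%SET.
have ST K : K \in S -> K \in cells T by rewrite inE => /andP[].
have gamE s t : gam s - gam t = (l * (t - s)) *: (x - z).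
  by apply/rowP => i; rewrite !mxE; ring.
have M0 : 0 <= M by apply: le_trans hM; exact: dotp_ge0.
have bgam K i s : bary K i (gam s) = (1 - s * l) * bary K i x + (s * l) * bary K i z by rewrite bary_comb.
have cA K : K \in S -> closed (A K).
  move=> /ST KT; have [cK aK] := cs KT.
  have -> : A K = \bigcap_(i in [set` K]) (fun s => bary K i x + s * (l * (bary K i z - bary K i x))) @^-1` [set y | 0 <= y].
    apply/seteqP; split=> s; rewrite /A/= (hullP cK aK).
      by move=> h i iK /=; have := h i iK; rewrite bgam; congr (0 <= _); ring.
    by move=> h i iK; have := h i iK; rewrite /= bgam; congr (0 <= _); ring.
  apply: closed_bigI => i _; apply: preimage_closed; last exact: closed_ge.
  move=> s _; apply: cvgD; first exact: cvg_cst.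
  by apply: cvgM; [exact: cvg_id|exact: cvg_cst].
have iA K : K \in S -> is_interval (A K).
  move=> /ST KT s t As At u /andP[su ut].
  have [st|st] := eqVneq s t.
    by have -> : u = s by apply/eqP; rewrite eq_le su st ut.
  have ts : 0 < t - s by rewrite subr_gt0 lt_neqAle st (le_trans su).
  pose v := (u - s) / (t - s).
  have -> : A K u = hull K ((1 - v) *: gam s + v *: gam t).
    rewrite /A/=; congr hull; apply/rowP => i; rewrite !mxE /v; field; exact: lt0r_neq0.
  apply: (hull_convex_cell conf KT As At).
  by rewrite /v ler_pdivrMr// mul1r lerB// divr_ge0 ?subr_ge0// ltW// -subr_gt0.
pose c K := enorm (pgrad f K) * (l * Num.sqrt M).
have c0 K : 0 <= c K by rewrite mulr_ge0 ?enorm_ge0// mulr_ge0 ?sqrtr_ge0.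
pose phi s := p1 f (gam s).
have lip K s t : K \in S -> A K s -> A K t -> `|phi s - phi t| <= c K * `|s - t|.
  move=> /ST KT As At; apply: (le_trans (p1_lip f KT As At)).
  rewrite /c -mulrA; apply: ler_wpM2l; first exact: enorm_ge0.
  rewrite gamE enormZ normrM (ger0_norm l0) distrC -!mulrA; apply: ler_wpM2l => //.
  by rewrite mulrC; apply: ler_wpM2r => //; exact: ler_wsqrtr.
have cov s : 0 < s <= 1 -> exists2 K, K \in S & A K s.
  move=> /andP[s0 s1].
  have Qg : cube r (gam s).
    by apply: cube_convex => //; rewrite mulr_ge0 ?(ltW s0)//= mulr_ile1// ltW.
  have Dg : cube L (gam s).
    by move=> i; have /andP[h1 h2] := Qg i; apply/andP; split; lra.
  have [K KT Kg] := cube_cover conf Dg.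
  by exists K => //; rewrite inE KT/=; apply/asboolP; exists (gam s).
have := piecewise_lipschitz_chain ler01 c0 cA iA lip cov.
rewrite subr0 mul1r -lee_fin.
rewrite /phi (_ : gam 1 = (1 - l) *: x + l *: z); last by rewrite /gam mul1r.
rewrite (_ : gam 0 = x); last by rewrite /gam mul0r subr0 scale1r scale0r addr0.
move/le_trans; apply.
rewrite -sumEFin big_mkcond /path_energy ge0_sume_distrr; last first.
  by move=> K _; rewrite mule_ge0 ?seg_time_ge0// lee_fin cell_energy_ge0.
apply: lee_sum => K _; case: ifPn => [KS|_]; last first.
  by rewrite !mule_ge0 ?seg_time_ge0// lee_fin ?cell_energy_ge0// mulr_ge0// sqr_ge0.
have := KS; rewrite inE => /andP[KT hK].
rewrite /cell_energy KT hK /cell_hull KT EFinM -time_inE; last exact: cA.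
rewrite muleA -EFinM; apply: lee_pmul.
- by rewrite lee_fin sqr_ge0.
- exact: measure_ge0.
- rewrite lee_fin /c !exprMn enorm_sqr sqr_sqrtr// le_eqVlt; apply/orP; left; apply/eqP; ring.
- rewrite le_eqVlt; apply/orP; left; apply/eqP; congr (lebesgue_measure _).
  by apply/seteqP; split=> s /=; rewrite in_itv/= => -[].
Qed.

End p1_interpolant.

(** * Lumped masses and discrete Poincare inequalities *)

Section nodal_inequalities.
Context {R : realType} {d : nat} (T : mesh R d) (L : R).
Local Notation node := 'I_(nvert T).
Local Notation X := (@vert R d T).
Implicit Types (i j : node) (K F : {set node}) (f : node -> R) (A P N : pred node).
Hypothesis d0 : (0 < d)%N.
Hypothesis L0 : 0 < L.
Hypothesis conf : conforming_mesh T (cube L).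

Let cs K : K \in cells T -> #|K| = d.+1 /\ aff_indep K := @cell_simplex _ _ T L conf K.

(** Agrees with [weight] at interior vertices, but is also defined on the boundary. *)
Definition mass i : R := \sum_(K in cells T | i \in K) vol K / d.+1%:R.

Definition dirichlet f : R := \sum_(K in cells T) vol K * dotp (pgrad f K) (pgrad f K).

Lemma mass_ge0 i : 0 <= mass i.
Proof. by apply: sumr_ge0 => K _; rewrite divr_ge0// vol_ge0. Qed.

Lemma sum_mass A f : \sum_(i | A i) mass i * f i =
  \sum_(K in cells T) vol K / d.+1%:R * \sum_(i in K | A i) f i.
Proof.
under eq_bigr => i _ do rewrite mulr_suml.
rewrite (exchange_big_dep (fun K => K \in cells T))/=; last by move=> i K _ /andP[].
apply: eq_bigr => K KT; rewrite mulr_sumr; apply: eq_big => // i.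
by rewrite KT andbC.
Qed.

Lemma dirichlet_ge0 f : 0 <= dirichlet f.
Proof. by apply: sumr_ge0 => K _; rewrite mulr_ge0 ?vol_ge0 ?dotp_ge0. Qed.

(** Expand the squares: the rows of the Gram matrix of the gradients sum to 0, so only the cross
    terms remain. *)
Lemma dotp_pgrad_edges f K : K \in cells T ->
  dotp (pgrad f K) (pgrad f K) =
  - 2^-1 * \sum_(i in K) \sum_(j in K) dotp (bgrad K i) (bgrad K j) * (f i - f j) ^+ 2.
Proof.
move=> KT; have [cK aK] := cs KT.
have sg i : \sum_(j in K) dotp (bgrad K i) (bgrad K j) = 0.
  by rewrite -dotp_sumr sum_bgrad// dotp0r.
pose G i j := dotp (bgrad K i) (bgrad K j).
have E1 : \sum_(i in K) \sum_(j in K) G i j * f i ^+ 2 = 0.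
  by rewrite big1// => i _; rewrite -mulr_suml sg mul0r.
have E2 : \sum_(i in K) \sum_(j in K) G i j * f j ^+ 2 = 0.
  rewrite exchange_big big1//= => j _; rewrite -mulr_suml.
  by under eq_bigr => i _ do rewrite /G dotpC; rewrite sg mul0r.
have E3 : dotp (pgrad f K) (pgrad f K) = \sum_(i in K) \sum_(j in K) G i j * (f i * f j).
  rewrite /pgrad dotp_suml; apply: eq_bigr => i _; rewrite dotp_sumr; apply: eq_bigr => j _.
  by rewrite dotpZl dotpZr /G; ring.
transitivity (- 2^-1 * (\sum_(i in K) \sum_(j in K) G i j * f i ^+ 2 +
  \sum_(i in K) \sum_(j in K) G i j * f j ^+ 2 - 2 * \sum_(i in K) \sum_(j in K) G i j * (f i * f j))).
  by rewrite E1 E2 E3; field.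
congr (_ * _); rewrite mulr_sumr -!(big_split, sumrB)/=; apply: eq_bigr => i _.
rewrite mulr_sumr -!(big_split, sumrB)/=; apply: eq_bigr => j _; rewrite /G; ring.
Qed.

Lemma weighted_edges_cells (w : node -> node -> R) :
  \sum_i \sum_j conductance i j * w i j =
  - \sum_(K in cells T) vol K * \sum_(i in K) \sum_(j in K) dotp (bgrad K i) (bgrad K j) * w i j.
Proof.
transitivity (- \sum_i \sum_j \sum_(K in cells T) vol K * (dotp (bgrad K i) (bgrad K j) * w i j)).
  rewrite -sumrN; apply: eq_bigr => i _; rewrite -sumrN; apply: eq_bigr => j _.
  rewrite /conductance mulNr mulr_suml; congr (- _); apply: eq_bigr => K _; ring.
congr (- _); under eq_bigr => i _ do rewrite exchange_big.
rewrite exchange_big/=; apply: eq_bigr => K KT; have [cK aK] := cs KT.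
rewrite mulr_sumr [RHS]big_mkcond; apply: eq_bigr => i _.
case: ifPn => iK; last by rewrite big1// => j _; rewrite (bgrad_notin cK aK iK) dotp0l mul0r mulr0.
rewrite mulr_sumr [RHS]big_mkcond; apply: eq_bigr => j _.
by case: ifPn => // jK; rewrite (bgrad_notin cK aK jK) dotp0r mul0r mulr0.
Qed.

Lemma dirichlet_edges f :
  dirichlet f = 2^-1 * \sum_i \sum_j conductance i j * (f i - f j) ^+ 2.
Proof.
rewrite weighted_edges_cells mulrN -mulNr mulr_sumr; apply: eq_bigr => K KT.
by rewrite dotp_pgrad_edges//; ring.
Qed.

Lemma p1_sqr_le f K x : K \in cells T -> hull K x -> p1 f x ^+ 2 <= \sum_(j in K) f j ^+ 2.
Proof.
move=> KT Kx; have [cK aK] := cs KT; have hx := (hullP cK aK x).1 Kx.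
apply: (@le_trans _ _ (\sum_(j in K) bary K j x * f j ^+ 2)); last first.
  apply: ler_sum => j jK; rewrite -[leRHS]mul1r; apply: ler_wpM2r; first exact: sqr_ge0.
  exact: bary_hull_le1.
rewrite -subr_ge0; set p := p1 f x.
(* With barycentric weights, of which [p] is the mean, the mean of the squares minus [p ^+ 2] is a
   variance. *)
rewrite (_ : _ - _ = \sum_(j in K) bary K j x * (f j - p) ^+ 2).
  by apply: sumr_ge0 => j jK; rewrite mulr_ge0 ?sqr_ge0// hx.
transitivity (\sum_(j in K) bary K j x * f j ^+ 2 - 2 * p * \sum_(j in K) f j * bary K j x +
   p ^+ 2 * \sum_(j in K) bary K j x).
  by rewrite sum_bary// -(p1E conf f KT Kx) -/p; ring.
rewrite !mulr_sumr -sumrB -big_split/=; apply: eq_bigr => j _; ring.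
Qed.

(** Share of the lumped mass of [K] carried by [A]; it turns nodal masses into integrals over
    cells. *)
Definition frac A K : R := #|[set i in K | A i]%SET|%:R / d.+1%:R.

Lemma frac_ge0 A K : 0 <= frac A K.
Proof. by rewrite divr_ge0. Qed.

Lemma frac_le1 A K : K \in cells T -> frac A K <= 1.
Proof.
move=> /cs[cK _]; rewrite ler_pdivrMr ?ltr0n// mul1r ler_nat -cK subset_leq_card//.
by apply/fintype.subsetP => i; rewrite inE => /andP[].
Qed.

Lemma sum_frac A K (x : R) : \sum_(i in K | A i) x = (frac A K * d.+1%:R) * x.
Proof.
rewrite /frac divfK ?pnatr_eq0// sumr_const mulr_natl; congr (_ *+ _).
by apply: eq_card => i; rewrite inE.
Qed.

Lemma sum_mass1 A : \sum_(i | A i) mass i = \sum_(K in cells T) frac A K * vol K.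
Proof.
transitivity (\sum_(i | A i) mass i * 1); first by apply: eq_bigr => i _; rewrite mulr1.
rewrite sum_mass; apply: eq_bigr => K _.
by rewrite sum_frac mulr1 [frac _ _ * _]mulrC mulrA divfK ?pnatr_eq0// mulrC.
Qed.

Lemma sum_mass_all : \sum_i mass i = (2 * L) ^+ d.
Proof.
rewrite -(sum_vol d0 L0 conf) (sum_mass1 predT); apply: eq_bigr => K /cs[cK _].
rewrite /frac (_ : [set i in K | predT i]%SET = K) ?cK ?mulfV ?mul1r// ?pnatr_eq0//.
by apply/setP => i; rewrite inE andbT.
Qed.
End nodal_inequalities.

Section nodal_poincare.
Context {R : realType} {d : nat} (T : mesh R d) (L : R).
Local Notation node := 'I_(nvert T).
Local Notation X := (@vert R d T).
Local Notation h := (mesh_size T).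
Implicit Types (i j : node) (K F : {set node}) (f : node -> R) (A P N : pred node).
Hypothesis d0 : (0 < d)%N.
Hypothesis L0 : 0 < L.
Hypothesis conf : conforming_mesh T (cube L).

Let cs K : K \in cells T -> #|K| = d.+1 /\ aff_indep K := @cell_simplex _ _ T L conf K.

Lemma vert_osc f K i x : K \in cells T -> i \in K -> hull K x ->
  (f i - p1 f x) ^+ 2 <= h ^+ 2 * dotp (pgrad f K) (pgrad f K).
Proof.
move=> KT iK Kx; have [cK aK] := cs KT; rewrite -(p1_vert conf f i).
have := p1_osc conf f KT (vert_hull cK aK iK) Kx.
rewrite -[`|_|]ger0_norm// -(@ler_pXn2r _ 2)// ?nnegrE ?mulr_ge0 ?enorm_ge0 ?(mesh_size_ge0 conf)//.
by rewrite normr_id real_normK ?num_real// exprMn enorm_sqr mulrC.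
Qed.

Lemma sum_cell_vol (c : {set node} -> R) :
  \sum_K c K * cell_vol K = \sum_(K in cells T) c K * vol K.
Proof. by rewrite [RHS]big_mkcond; apply: eq_bigr => K _; rewrite /cell_vol; case: ifP; rewrite ?mulr0. Qed.

Lemma cell_energy_full f K : K \in cells T -> cell_energy L f K = dotp (pgrad f K) (pgrad f K).
Proof.
move=> KT; rewrite /cell_energy KT/= asboolT//.
have [i iK] := cell_nonempty conf KT; have [cK aK] := cs KT.
exists (X i); split; first exact: vert_hull.
exact: (hull_sub_cube conf KT (vert_hull cK aK iK)).
Qed.

Lemma sqrD3_le (a b c : R) : (a + b + c) ^+ 2 <= 3 * (a ^+ 2 + b ^+ 2 + c ^+ 2).
Proof. have := sqr_ge0 (a - b); have := sqr_ge0 (b - c); have := sqr_ge0 (a - c); nra. Qed.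

Lemma sqrD4_le (a b c e : R) : (a + b + c + e) ^+ 2 <= 4 * (a ^+ 2 + b ^+ 2 + c ^+ 2 + e ^+ 2).
Proof.
rewrite -subr_ge0.
rewrite (_ : _ - _ = (a - b) ^+ 2 + (a - c) ^+ 2 + (a - e) ^+ 2 + (b - c) ^+ 2 + (b - e) ^+ 2 + (c - e) ^+ 2).
  by rewrite !addr_ge0// sqr_ge0.
ring.
Qed.

Let M : R := d%:R * (2 * L) ^+ 2.

(** Write [f i] as its deviation from the value at [x] in the cell, plus the variation from [x] to a
    displaced point [y], plus the value at [y]. The squares are paid by the energy with factors
    [h ^+ 2] and [l ^+ 2], and by the average over the target [z]; [M] bounds the squared diameter
    of the cube. *)
Lemma nodal_equi_integrability A f l : 0 < l <= 1 / 2 ->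
  l ^+ d * (2 * L) ^+ d * \sum_(i | A i) mass i * f i ^+ 2 <=
  3 * (l ^+ d * (2 * L) ^+ d) * (h ^+ 2 + l ^+ 2 * M * 2 ^+ d) * dirichlet f +
  3 * d.+1%:R * (\sum_(i | A i) mass i) * \sum_i mass i * f i ^+ 2.
Proof.
move=> l01; have /andP[l0 l1] := l01.
have l01' : 0 <= l <= 1 by rewrite ltW//=; lra.
have M0 : 0 <= M by rewrite mulr_ge0// sqr_ge0.
have h0 := mesh_size_ge0 conf.
pose a K := frac A K * (K \in cells T)%:R.
pose b K := (\sum_(i in K | A i) f i ^+ 2) / d.+1%:R * (K \in cells T)%:R.
pose F K := 3 * \sum_(j in K) f j ^+ 2 * (K \in cells T)%:R.
have a0 K : 0 <= a K by rewrite mulr_ge0 ?frac_ge0.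
have b0 K : 0 <= b K by rewrite mulr_ge0// divr_ge0// sumr_ge0// => i _; exact: sqr_ge0.
have F0 K : 0 <= F K by rewrite mulr_ge0// sumr_ge0// => i _; rewrite mulr_ge0// sqr_ge0.
have muc := lebesgue_rV_cube (ltW L0) (d := d).
have al0 : 0 <= 3 * h ^+ 2 by rewrite mulr_ge0// sqr_ge0.
have ga0 : 0 <= 3 * (l ^+ 2 * M) by apply: mulr_ge0 => //; apply: mulr_ge0 => //; exact: sqr_ge0.
have := equi_integrability_cells (measurable_core conf) (measurable_cell_hull conf)
  (@trivIset_core _ _ T) (mu_core d0 conf) (mu_cell_hull conf) (cell_energy_ge0 L f)
  (measurable_cube L) muc l01 al0 ga0 a0 b0 F0.
rewrite !sum_cell_vol => main.
have {}main : l ^+ d * (2 * L) ^+ d * (\sum_(K in cells T) b K * vol K) <=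
    l ^+ d * (2 * L) ^+ d * (3 * h ^+ 2 + 3 * (l ^+ 2 * M) * 2 ^+ d) *
      (\sum_(K in cells T) cell_energy L f K * vol K) +
    (\sum_(K in cells T) a K * vol K) * (\sum_(K in cells T) F K * vol K).
  apply: main => K x z cKx Dz; have [KT Kx] := core_hull cKx.
  have Dx := hull_sub_cube conf KT Kx.
  pose y := (1 - l) *: x + l *: z.
  have Dy : cube L y by exact: cube_convex.
  have [K' K'T K'y] := cube_cover conf Dy.
  have seg := segment_energy conf f (lexx L) l01' Dx Dz (dotp_cube_le Dx Dz).
  have aE : a K = frac A K by rewrite /a KT mulr1.
  have bE : b K <= a K * (3 * (h ^+ 2 * cell_energy L f K + (p1 f y - p1 f x) ^+ 2 + p1 f y ^+ 2)).
    rewrite /b KT mulr1 aE ler_pdivrMr ?ltr0n// mulrAC -sum_frac; apply: ler_sum => i /andP[iK _].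
    rewrite [X in X ^+ 2](_ : _ = (f i - p1 f x) + (- (p1 f y - p1 f x)) + p1 f y); last by ring.
    apply: (le_trans (sqrD3_le _ _ _)); rewrite sqrrN ler_pM2l// !lerD2r.
    by rewrite cell_energy_full//; exact: vert_osc.
  have a1 : a K <= 1 by rewrite aE; exact: (frac_le1 conf).
  have g1 : ((3 * h ^+ 2 * (a K * cell_energy L f K))%:E <= (3 * h ^+ 2 * cell_energy L f K)%:E)%E.
    rewrite lee_fin; apply: ler_wpM2l => //; rewrite -[leRHS]mul1r.
    by apply: ler_wpM2r => //; exact: cell_energy_ge0.
  have g2 : ((a K * (3 * (p1 f y - p1 f x) ^+ 2))%:E <=
      (3 * (l ^+ 2 * M))%:E * path_energy (@cell_hull R d T) (cell_energy L f) l x z)%E.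
    apply: (@le_trans _ _ (3%:E * ((p1 f y - p1 f x) ^+ 2)%:E)%E).
      rewrite -EFinM lee_fin -[leRHS]mul1r; apply: ler_wpM2r => //.
      by rewrite mulr_ge0// sqr_ge0.
    by rewrite (EFinM 3) -muleA; apply: lee_wpmul2l => //; rewrite lee_fin.
  have g3 : ((a K * (3 * p1 f y ^+ 2))%:E <=
      \sum_j (a K * F j * \1_(@cell_hull R d T j) y)%:E)%E.
    rewrite sumEFin lee_fin (bigD1 K')//= [X in _ <= X + _](_ : _ = a K * F K').
      rewrite -[leLHS]addr0; apply: lerD.
        apply: ler_wpM2l => //; rewrite /F K'T ler_pM2l//.
        under eq_bigr => j _ do rewrite mulr1.
        exact: (p1_sqr_le conf).
      by apply: sumr_ge0 => j _; apply: mulr_ge0; [apply: mulr_ge0|rewrite indicE].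
    rewrite indicE (_ : y \in _ = true) ?mulr1//.
    by apply: mem_set; rewrite /cell_hull K'T.
  apply: (@le_trans _ _ ((3 * h ^+ 2 * (a K * cell_energy L f K))%:E +
    ((a K * (3 * (p1 f y - p1 f x) ^+ 2))%:E + (a K * (3 * p1 f y ^+ 2))%:E))%E).
    rewrite -!EFinD lee_fin; apply: (le_trans bE); rewrite le_eqVlt; apply/orP; left; apply/eqP; ring.
  by apply: leeD => //; apply: leeD.
move: main.
have -> : \sum_(K in cells T) b K * vol K = \sum_(i | A i) mass i * f i ^+ 2.
  rewrite sum_mass; apply: eq_bigr => K KT; rewrite /b KT mulr1; ring.
have -> : \sum_(K in cells T) cell_energy L f K * vol K = dirichlet f.
  by apply: eq_bigr => K KT; rewrite cell_energy_full// mulrC.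
have -> : \sum_(K in cells T) a K * vol K = \sum_(i | A i) mass i.
  by rewrite (sum_mass1 A); apply: eq_bigr => K KT; rewrite /a KT mulr1.
have -> : \sum_(K in cells T) F K * vol K = 3 * d.+1%:R * \sum_i mass i * f i ^+ 2.
  rewrite (sum_mass predT) mulr_sumr; apply: eq_bigr => K KT; rewrite /F KT.
  have -> : \sum_(j in K) f j ^+ 2 * true%:R = \sum_(j in K) f j ^+ 2 by apply: eq_bigr => j _; rewrite mulr1.
  have -> : \sum_(j in K | predT j) f j ^+ 2 = \sum_(j in K) f j ^+ 2 by apply: eq_bigl => j; rewrite andbT.
  have : (d.+1%:R : R) != 0 by rewrite pnatr_eq0.
  by move=> e0; rewrite -!mulrA [d.+1%:R * _]mulrCA (mulrA d.+1%:R) mulfV// mul1r (mulrC (vol K)).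
move=> main; apply: (le_trans main); rewrite le_eqVlt; apply/orP; left; apply/eqP; ring.
Qed.

Definition local_energy (r : R) f : R := \sum_(K in cells T) cell_energy r f K * vol K.

(** Here cells must lie inside the cube, since both ends of every segment have to. *)
Definition inner_mass (r : R) A : R :=
  \sum_(K in cells T) (frac A K * `[< hull K `<=` cube r >]%:R) * vol K.

(** The jump between a node of [P] and a node of [N] is at most two deviations inside cells plus the
    variations along two half segments meeting at the midpoint. *)
Lemma inner_poincare (r : R) f P N : r <= L ->
  (forall i j, P i -> N j -> 1 <= (f i - f j) ^+ 2) ->
  inner_mass r P * inner_mass r N <=
    2 * (4 * h ^+ 2 + M * 2 ^+ d) * local_energy r f * (2 * L) ^+ d.
Proof.
move=> rL fPN.
have M0 : 0 <= M by rewrite mulr_ge0// sqr_ge0.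
have h0 := mesh_size_ge0 conf.
pose p A K := frac A K * (`[< hull K `<=` cube r >] && (K \in cells T))%:R.
have p0 A K : 0 <= p A K by rewrite mulr_ge0 ?frac_ge0.
have al0 : 0 <= 4 * h ^+ 2 by rewrite mulr_ge0// sqr_ge0.
have pE A : \sum_(K in cells T) p A K * vol K = inner_mass r A.
  by apply: eq_bigr => K KT; rewrite /p KT andbT.
have := poincare_cells (measurable_core conf) (measurable_cell_hull conf)
  (@trivIset_core _ _ T) (mu_core d0 conf) (mu_cell_hull conf) (cell_energy_ge0 r f)
  al0 M0 (p0 P) (p0 N).
rewrite !sum_cell_vol !pE => main.
have -> : (2 * L) ^+ d = \sum_k @cell_vol R d T k.
  by rewrite -(sum_vol d0 L0 conf) big_mkcond; apply: eq_bigr => K _.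
apply: main => K K' x z cKx cK'z.
have [KT Kx] := core_hull cKx; have [K'T K'z] := core_hull cK'z.
have pe0 x' z' : (0 <= path_energy (@cell_hull R d T) (cell_energy r f) (1 / 2) x' z')%E.
  by apply: sume_ge0 => j _; rewrite mule_ge0 ?seg_time_ge0// lee_fin cell_energy_ge0.
have rhs0 : (0 <= (4 * h ^+ 2 * (cell_energy r f K + cell_energy r f K'))%:E +
   M%:E * (path_energy (@cell_hull R d T) (cell_energy r f) (1 / 2) x z +
           path_energy (@cell_hull R d T) (cell_energy r f) (1 / 2) z x))%E.
  apply: adde_ge0; first by rewrite lee_fin mulr_ge0// addr_ge0// cell_energy_ge0.
  by apply: mule_ge0; [rewrite lee_fin|exact: adde_ge0].
have small A K0 : (p A K0 != 0) -> [/\ hull K0 `<=` cube r, p A K0 <= 1 &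
    exists i, (i \in K0) && A i].
  rewrite /p; case: asboolP => [K0r|]; last by rewrite mulr0 eqxx.
  have [K0T|] := boolP (K0 \in cells T); last by rewrite mulr0 eqxx.
  rewrite mulr1 => p0'; split => //; first exact: (frac_le1 conf).
  apply/existsP; apply: contraR p0' => /existsPn nA.
  rewrite /frac (_ : [set i in K0 | A i]%SET = finset.set0) ?cards0 ?mul0r//.
  by apply/setP => i; rewrite !inE; apply/negbTE/nA.
have [->|pP] := eqVneq (p P K) 0; first by rewrite mul0r.
have [->|pN] := eqVneq (p N K') 0; first by rewrite mulr0.
have [Kr pP1 [i /andP[iK Pi]]] := small _ _ pP.
have [K'r pN1 [j /andP[jK' Nj]]] := small _ _ pN.
have Qx := Kr x Kx; have Qz := K'r z K'z.
pose y := (1 - 1 / 2) *: x + (1 / 2) *: z.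
have yE : y = (1 - 1 / 2) *: z + (1 / 2) *: x.
  by rewrite /y addrC; congr (_ *: _ + _ *: _); lra.
have l01 : (0 : R) <= (1 / 2 : R) <= (1 : R) by apply/andP; split; lra.
have cubeS (t : 'rV[R]_d) : cube r t -> cube L t.
  by move=> ht k; have /andP[? ?] := ht k; apply/andP; split; lra.
have seg1 := segment_energy conf f rL l01 Qx Qz (dotp_cube_le (cubeS _ Qx) (cubeS _ Qz)).
have seg2 := segment_energy conf f rL l01 Qz Qx (dotp_cube_le (cubeS _ Qz) (cubeS _ Qx)).
rewrite -/y in seg1; rewrite -yE in seg2.
have ceE K0 t : K0 \in cells T -> hull K0 t -> cube r t -> cell_energy r f K0 = dotp (pgrad f K0) (pgrad f K0).
  by move=> K0T K0t Qt; rewrite /cell_energy K0T asboolT//; exists t.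
have real4 : p P K * p N K' <= 4 * h ^+ 2 * (cell_energy r f K + cell_energy r f K') +
    (4 * (p1 f y - p1 f x) ^+ 2 + 4 * (p1 f y - p1 f z) ^+ 2).
  apply: (@le_trans _ _ 1); first by rewrite mulr_ile1.
  apply: (le_trans (fPN i j Pi Nj)).
  rewrite [X in X ^+ 2](_ : _ = (f i - p1 f x) + (- (p1 f y - p1 f x)) +
    (p1 f y - p1 f z) + (- (f j - p1 f z))); last by ring.
  apply: (le_trans (sqrD4_le _ _ _ _)); rewrite !sqrrN.
  have v1 := vert_osc f KT iK Kx; have v2 := vert_osc f K'T jK' K'z.
  rewrite (ceE K x)// (ceE K' z)//.
  move: v1 v2; set u1 := (f i - _) ^+ 2; set u2 := (f j - _) ^+ 2; nra.
rewrite -lee_fin in real4; apply: (le_trans real4).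
rewrite EFinD leeD2l// muleDr// ?ge0_adde_def ?inE ?pe0//.
(* The factor 4 of the four-term square cancels the squared length ratio of a half segment. *)
have q4 : (4 * ((1 / 2) ^+ 2 * M) = M :> R) by field.
rewrite EFinD; apply: leeD.
  by rewrite -q4 !(EFinM 4) -muleA; apply: lee_wpmul2l.
by rewrite -q4 !(EFinM 4) -muleA; apply: lee_wpmul2l.
Qed.
End nodal_poincare.

(** * Cutoff functions and interior energies *)

Section cutoff.
Context {R : realType} {d : nat} (T : mesh R d) (L sigma : R).
Local Notation node := 'I_(nvert T).
Local Notation X := (@vert R d T).
Local Notation h := (mesh_size T).
Implicit Types (i j : node) (K F : {set node}) (f : node -> R) (A P N : pred node).
Hypothesis d0 : (0 < d)%N.
Hypothesis L0 : 0 < L.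
Hypothesis conf : conforming_mesh T (cube L).
Hypothesis shape : shape_regular T sigma.

Let cs K : K \in cells T -> #|K| = d.+1 /\ aff_indep K := @cell_simplex _ _ T L conf K.

Lemma norm_le_enorm (x : 'rV[R]_d) : `|x| <= enorm x.
Proof.
apply/cube_normP; first exact: enorm_ge0.
move=> i; rewrite -ler_norml -dotp_delta; apply: (le_trans (dotp_le_enorm _ _)).
rewrite [X in _ * X](_ : _ = 1) ?mulr1//.
by rewrite /enorm dotp_delta mxE !eqxx sqrtr1.
Qed.

Lemma cell_diameter K x y : K \in cells T -> hull K x -> hull K y -> enorm (x - y) <= h.
Proof. by move=> KT Kx Ky; apply: (le_trans (enorm_le_diam conf KT Kx Ky)); exact: diam_le_mesh_size. Qed.

Lemma cell_norm_le K x y : K \in cells T -> hull K x -> hull K y -> `|y| <= `|x| + h.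
Proof.
move=> KT Kx Ky; rewrite -[y](subrK x) addrC; apply: (le_trans (ler_normD _ _)).
by rewrite lerD2l; apply: (le_trans (norm_le_enorm _)); exact: cell_diameter KT Ky Kx.
Qed.

(** Cells meeting the cube of half-side [r - h] lie in that of half-side [r], so the discarded cells
    have at most the volume of the strip. *)
Lemma inner_mass_ge (r : R) A : h <= r -> r <= L ->
  \sum_(i | A i) mass i <= inner_mass r A + ((2 * L) ^+ d - (2 * (r - h)) ^+ d).
Proof.
move=> hr rL; have h0 := mesh_size_ge0 conf.
have muc := lebesgue_rV_cube (d := d) (r := r - h); rewrite subr_ge0 in muc.
have inner : (2 * (r - h)) ^+ d <= \sum_(K in cells T | `[< hull K `<=` cube r >]) vol K.
  apply: (le_sum_vol conf (measurable_cube (r - h)) (muc hr)) => x Qx.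
  have Dx : cube L x by move=> i; have /andP[? ?] := Qx i; apply/andP; split; lra.
  have [K KT Kx] := cube_cover conf Dx; exists K; split=> //; apply/asboolP => y Ky.
  apply/cube_normP; first exact: le_trans hr.
  apply: (le_trans (cell_norm_le KT Kx Ky)); rewrite -lerBrDr.
  by apply/cube_normP => //; rewrite subr_ge0.
rewrite sum_mass1 -(sum_vol d0 L0 conf) [X in _ <= _ + (X - _)](bigID (fun K => `[< hull K `<=` cube r >]))/=.
apply: (@le_trans _ _ (inner_mass r A + \sum_(K in cells T | ~~ `[< hull K `<=` cube r >]) vol K)); last lra.
rewrite /inner_mass [X in _ <= X + _](bigID (fun K => `[< hull K `<=` cube r >]))/=.
rewrite [X in _ <= _ + X + _]big1 ?addr0; last by move=> K /andP[_ /negPf ->]; rewrite mulr0 mul0r.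
rewrite [leLHS](bigID (fun K => `[< hull K `<=` cube r >]))/=; apply: lerD.
  by apply: ler_sum => K /andP[_ ->]; rewrite mulr1.
apply: ler_sum => K /andP[KT _]; rewrite -[leRHS]mul1r; apply: ler_wpM2r; first exact: vol_ge0.
exact: (frac_le1 conf).
Qed.

(** Inside one cell the products of gradients have no sign, so [phi] cannot be compared edge by
    edge; it is frozen at the vertex [k] instead. This changes the squared weight by at most
    [2 * (Lam * dm)], while [(y i - y j) ^+ 2 <= D * dm ^+ 2] and the two gradients compensate each
    other through [sigma ^+ 2]; one factor [dm <= h] is left. *)
Lemma cell_weighted_energy (phi y : node -> R) (Lam : R) K k : K \in cells T -> k \in K -> 0 <= Lam ->
  (forall i, 0 <= phi i <= 1) ->
  (forall i j, `|phi i - phi j| <= Lam * enorm (X i - X j)) ->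
  phi k ^+ 2 * dotp (pgrad y K) (pgrad y K) <=
  - 2^-1 * \sum_(i in K) \sum_(j in K) dotp (bgrad K i) (bgrad K j) *
     (Num.min (phi i) (phi j) ^+ 2 * (y i - y j) ^+ 2) +
  (d.+1%:R ^+ 2 * Lam * sigma ^+ 2) * h * dotp (pgrad y K) (pgrad y K).
Proof.
move=> KT kK Lam0 phi01 lip; have [cK aK] := cs KT.
set D := dotp (pgrad y K) (pgrad y K).
have D0 : 0 <= D := dotp_ge0 _.
pose dm := diam (hull K).
have dm0 : 0 <= dm := diam_ge0 conf KT.
have dmh : dm <= h := diam_le_mesh_size KT.
have xk i j : i \in K -> j \in K -> enorm (X i - X j) <= dm.
  by move=> iK jK; apply: (enorm_le_diam conf KT); exact: vert_hull.
pose mm i j := Num.min (phi i) (phi j).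
have mlip i j : i \in K -> j \in K -> `|mm i j ^+ 2 - phi k ^+ 2| <= 2 * (Lam * dm).
  move=> iK jK.
  have a1 l : l \in K -> `|phi l - phi k| <= Lam * dm.
    by move=> lK; apply: (le_trans (lip l k)); apply: ler_wpM2l => //; exact: xk.
  have [l lK ->] : exists2 l, l \in K & mm i j = phi l.
    by rewrite /mm; case: (leP (phi i) (phi j)) => _; [exists i|exists j].
  rewrite subr_sqr normrM mulrC; apply: ler_pM => //; last exact: a1.
  have /andP[? ?] := phi01 l; have /andP[? ?] := phi01 k.
  by rewrite ger0_norm; lra.
have E : phi k ^+ 2 * D = - 2^-1 * \sum_(i in K) \sum_(j in K) dotp (bgrad K i) (bgrad K j) *
     (phi k ^+ 2 * (y i - y j) ^+ 2).
  rewrite /D (dotp_pgrad_edges conf)// mulrCA; congr (_ * _); rewrite mulr_sumr; apply: eq_bigr => i _.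
  by rewrite mulr_sumr; apply: eq_bigr => j _; ring.
rewrite E -lerBlDl -mulrBr -sumrB.
under eq_bigr => i _ do rewrite -sumrB.
have term i j : i \in K -> j \in K ->
   `|dotp (bgrad K i) (bgrad K j) * (phi k ^+ 2 * (y i - y j) ^+ 2) -
   dotp (bgrad K i) (bgrad K j) * (mm i j ^+ 2 * (y i - y j) ^+ 2)| <= 2 * (Lam * sigma ^+ 2 * h * D).
  move=> iK jK; rewrite -mulrBr -mulrBl normrM [X in _ * X <= _]normrM distrC.
  have b1 : `|dotp (bgrad K i) (bgrad K j)| <= enorm (bgrad K i) * enorm (bgrad K j) := dotp_le_enorm _ _.
  have b2 : `|(y i - y j) ^+ 2| <= D * dm ^+ 2.
    rewrite ger0_norm ?sqr_ge0// -[y i](p1_vert conf) -[y j](p1_vert conf).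
    rewrite -real_normK ?num_real//.
    have := p1_lip conf y KT (vert_hull cK aK iK) (vert_hull cK aK jK).
    rewrite /D -enorm_sqr -exprMn => le1.
    rewrite ler_pXn2r// ?nnegrE ?mulr_ge0 ?enorm_ge0//.
    by apply: (le_trans le1); apply: ler_wpM2l; [exact: enorm_ge0|exact: xk].
  have b3 := mlip i j iK jK.
  have g1 := bgrad_diam_le d0 conf shape i KT; have g2 := bgrad_diam_le d0 conf shape j KT.
  apply: (@le_trans _ _ ((enorm (bgrad K i) * enorm (bgrad K j)) * (2 * (Lam * dm) * (D * dm ^+ 2)))).
    apply: ler_pM => //; exact: ler_pM.
  rewrite (_ : _ * _ = 2 * (Lam * ((enorm (bgrad K i) * dm) * (enorm (bgrad K j) * dm)) * dm * D)); last by ring.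
  rewrite ler_pM2l//; apply: ler_wpM2r => //; apply: ler_pM => //.
    by rewrite !mulr_ge0 ?enorm_ge0.
  apply: ler_wpM2l => //; rewrite expr2; apply: ler_pM => //; by rewrite mulr_ge0 ?enorm_ge0.
apply: (le_trans (ler_norm _)); rewrite normrM normrN [`|2^-1|]ger0_norm//.
rewrite ler_pdivrMl//.
apply: (le_trans (ler_norm_sum _ _ _)).
apply: (@le_trans _ _ (\sum_(i in K) \sum_(j in K) 2 * (Lam * sigma ^+ 2 * h * D))).
  apply: ler_sum => i iK; apply: (le_trans (ler_norm_sum _ _ _)); apply: ler_sum => j jK; exact: term.
rewrite !sumr_const cK -!mulrnA -[leLHS]mulr_natl le_eqVlt; apply/orP; left; apply/eqP.
by rewrite natrM; ring.
Qed.

Lemma local_energy_le (phi y : node -> R) (Lam r : R) : 0 <= Lam ->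
  (forall i, 0 <= phi i <= 1) ->
  (forall i j, `|phi i - phi j| <= Lam * enorm (X i - X j)) ->
  (forall K i, K \in cells T -> hull K `&` cube r !=set0 -> i \in K -> phi i = 1) ->
  local_energy r y <=
  2^-1 * \sum_i \sum_j conductance i j * (Num.min (phi i) (phi j) ^+ 2 * (y i - y j) ^+ 2) +
  (d.+1%:R ^+ 2 * Lam * sigma ^+ 2) * h * dirichlet y.
Proof.
move=> Lam0 phi01 lip phi1.
rewrite (weighted_edges_cells conf) mulrN -mulNr /dirichlet !mulr_sumr -big_split/=.
apply: ler_sum => K KT; have [k kK] := cell_nonempty conf KT.
have := cell_weighted_energy y KT kK Lam0 phi01 lip.
set Q := \sum_(i in K) _; set D := dotp _ _; set C := d.+1%:R ^+ 2 * Lam * sigma ^+ 2 => cw.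
have -> : - 2^-1 * (vol K * Q) + C * h * (vol K * D) = (- 2^-1 * Q + C * h * D) * vol K by ring.
apply: ler_wpM2r; first exact: vol_ge0.
apply: le_trans cw; rewrite /cell_energy KT/=; case: asboolP => [Kr|_].
  by rewrite (phi1 K k)// expr1n mul1r.
by rewrite mulr_ge0 ?sqr_ge0 ?dotp_ge0.
Qed.

(** Distance to the boundary in the sup norm, scaled to reach 1 at distance [eta / 2]; the other
    half of the strip leaves room for the cells that meet [cube (L - eta)]. *)
Definition cutoff (eta : R) i : R := Num.min 1 (2 / eta * (L - `|X i|)).

Lemma vert_norm_le i : `|X i| <= L.
Proof.
have [K KT iK] : exists2 K, K \in cells T & i \in K by case: conf => _ + _ _ _; exact.
have [cK aK] := cs KT.
by apply/cube_normP; [exact: ltW|exact: (hull_sub_cube conf KT (vert_hull cK aK iK))].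
Qed.

Lemma cutoff01 eta i : 0 < eta -> 0 <= cutoff eta i <= 1.
Proof.
move=> e0; rewrite /cutoff le_min ler01 ge_min lexx andbT/=.
by rewrite mulr_ge0 ?subr_ge0 ?vert_norm_le// divr_ge0// ltW.
Qed.

Lemma cutoff_lip eta i j : 0 < eta -> `|cutoff eta i - cutoff eta j| <= 2 / eta * enorm (X i - X j).
Proof.
move=> e0.
have ml (a b : R) : `|Num.min 1 a - Num.min 1 b| <= `|a - b|.
  by rewrite /Num.min; case: ltP => h1; case: ltP => h2; rewrite ler_norml; apply/andP; split;
    case: (ger0P (a - b)); lra.
apply: (le_trans (ml _ _)); rewrite -mulrBr normrM gtr0_norm ?divr_gt0//.
apply: ler_wpM2l; first by rewrite divr_ge0// ltW.
rewrite opprB addrC addrA subrK distrC; apply: (le_trans (ler_dist_dist _ _)).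
exact: norm_le_enorm.
Qed.

Lemma cutoff_inner eta K i : 0 < eta -> h <= eta / 2 -> eta <= L -> K \in cells T ->
  hull K `&` cube (L - eta) !=set0 -> i \in K -> cutoff eta i = 1.
Proof.
move=> e0 he eL KT [x [Kx /cube_normP]]; rewrite subr_ge0 => /(_ eL) xr iK.
have [cK aK] := cs KT.
have := cell_norm_le KT Kx (vert_hull cK aK iK) => Xi.
apply/min_idPl; rewrite mulrC mulrA ler_pdivlMr//; lra.
Qed.

Lemma dirichlet_lipschitz_le f (Lam : R) : 0 <= Lam ->
  (forall i j, `|f i - f j| <= Lam * enorm (X i - X j)) ->
  dirichlet f <= (2 * Lam * sigma) ^+ 2 * (2 * L) ^+ d.
Proof.
move=> Lam0 lip; rewrite -(sum_vol d0 L0 conf) mulr_sumr; apply: ler_sum => K KT.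
rewrite mulrC; apply: ler_wpM2r; first exact: vol_ge0.
have := pgrad_lipschitz_le d0 conf shape KT Lam0 (fun i j _ _ => lip i j).
rewrite -enorm_sqr ler_pXn2r// ?nnegrE ?enorm_ge0// !mulr_ge0// (shape_ge0 d0 conf shape KT)//.
Qed.
End cutoff.

(** * The uniform discrete gap *)

Section weighted_graph.
Context {R : realType} {I : finType} (s : I -> I -> R) (c u : I -> R).
Hypothesis sC : forall i j, s i j = s j i.
Hypothesis s0 : forall i j, 0 <= s i j.
Hypothesis u0 : forall i, 0 <= u i.
Hypothesis eqn : forall i, u i != 0 -> \sum_j s i j * (u i - u j) + c i * u i = 0.

(** Summation by parts. The test function must vanish where [u] does, as no equation is available
    there. *)
Lemma ground_weak_form (g : I -> R) : (forall i, u i = 0 -> g i = 0) ->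
  \sum_i \sum_j s i j * ((u i - u j) * (g i - g j)) = - 2 * \sum_i c i * u i * g i.
Proof.
move=> g0.
have E1 : \sum_i \sum_j s i j * (u i - u j) * g i = - \sum_i c i * u i * g i.
  rewrite -sumrN; apply: eq_bigr => i _; rewrite -mulr_suml.
  have [/g0 ->|/eqn e] := eqVneq (u i) 0; first by rewrite !mulr0 oppr0.
  by rewrite (_ : \sum_j _ = - (c i * u i)) ?mulNr//; apply/eqP; rewrite -addr_eq0 e.
have E2 : \sum_i \sum_j s i j * (u i - u j) * g j = \sum_i c i * u i * g i.
  rewrite exchange_big/= -[RHS]opprK -E1 -sumrN; apply: eq_bigr => i _.
  by rewrite -sumrN; apply: eq_bigr => j _; rewrite sC; ring.
transitivity (\sum_i \sum_j s i j * (u i - u j) * g i - \sum_i \sum_j s i j * (u i - u j) * g j).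
  by rewrite -sumrB; apply: eq_bigr => i _; rewrite -sumrB; apply: eq_bigr => j _; ring.
by rewrite E1 E2; ring.
Qed.

(** Test with u t^2 and use, on each edge, (u_i t_i - u_j t_j)^2 - (u_i - u_j)(u_i t_i^2 - u_j
    t_j^2) = u_i u_j (t_i - t_j)^2. *)
Lemma ground_state_transform (t : I -> R) :
  2^-1 * \sum_i \sum_j s i j * (u i * t i - u j * t j) ^+ 2 + \sum_i c i * (u i * t i) ^+ 2 =
  2^-1 * \sum_i \sum_j s i j * (u i * u j * (t i - t j) ^+ 2).
Proof.
have g0 i : u i = 0 -> u i * t i ^+ 2 = 0 by move=> ->; rewrite mul0r.
have := ground_weak_form g0.
rewrite (_ : \sum_i c i * u i * _ = \sum_i c i * (u i * t i) ^+ 2); last by apply: eq_bigr => i _; ring.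
move=> e; rewrite (_ : \sum_i c i * _ = - 2^-1 * \sum_i \sum_j s i j * ((u i - u j) * (u i * t i ^+ 2 - u j * t j ^+ 2))); last first.
  by rewrite e; field.
rewrite mulNr -mulrBr -sumrB; congr (_ * _); apply: eq_bigr => i _.
by rewrite -sumrB; apply: eq_bigr => j _; ring.
Qed.

(** Discrete counterpart of the squared gradient of ln u; it is 0, by [x / 0 = 0], on edges where
    [u] vanishes at an end. *)
Let D i j := (u i - u j) ^+ 2 / (u i * u j).

(** Edge version of bounding grad u . grad(phi^2 / u) by the energy of phi minus the weighted energy
    of ln u. After clearing denominators and setting [b = a + e], the difference is a sum of
    nonnegative terms, written separately for each sign of [x - y]. *)
Lemma log_test_le (a b x y : R) : 0 < x -> 0 < y -> 0 <= a -> a <= b ->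
  (x - y) * (a ^+ 2 / x - b ^+ 2 / y) <=
  3 * (a - b) ^+ 2 - 2^-1 * (a ^+ 2 * ((x - y) ^+ 2 / (x * y))).
Proof.
move=> x0 y0 a0 ab.
have [xn yn] : x != 0 /\ y != 0 by rewrite !gt_eqF.
rewrite -(ler_pM2r (mulr_gt0 x0 y0)).
have -> : (x - y) * (a ^+ 2 / x - b ^+ 2 / y) * (x * y) = (x - y) * (a ^+ 2 * y - b ^+ 2 * x).
  by field; rewrite xn yn.
have -> : (3 * (a - b) ^+ 2 - 2^-1 * (a ^+ 2 * ((x - y) ^+ 2 / (x * y)))) * (x * y) =
   3 * (a - b) ^+ 2 * (x * y) - 2^-1 * (a ^+ 2 * (x - y) ^+ 2).
  by field; rewrite xn yn.
pose e := b - a; have e0 : 0 <= e by rewrite subr_ge0.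
have -> : b = a + e by rewrite /e; ring.
rewrite -subr_ge0; have [yx|/ltW xy] := leP y x.
  rewrite (_ : _ - _ = 3 * e ^+ 2 * (x * y) + 2^-1 * (a * (x - y)) ^+ 2 + (2 * (a * e) + e ^+ 2) * x * (x - y)).
    have t1 : 0 <= e ^+ 2 * (x * y) by apply: mulr_ge0; [exact: sqr_ge0|exact/ltW/mulr_gt0].
    have t2 := sqr_ge0 (a * (x - y)).
    have t3 : 0 <= (2 * (a * e) + e ^+ 2) * x * (x - y).
      apply: mulr_ge0; last by rewrite subr_ge0.
      by apply: mulr_ge0; [rewrite addr_ge0 ?sqr_ge0// mulr_ge0// mulr_ge0|exact: ltW].
    by rewrite -(mulrA 3); lra.
  by field.
rewrite (_ : _ - _ = 2^-1 * (a * (y - x) - 2 * (e * x)) ^+ 2 + e ^+ 2 * x ^+ 2 + 2 * (e ^+ 2 * x * (y - x))).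
  have t1 : 0 <= e ^+ 2 * x ^+ 2 by apply: mulr_ge0; exact: sqr_ge0.
  have t2 := sqr_ge0 (a * (y - x) - 2 * (e * x)).
  have t3 : 0 <= e ^+ 2 * x * (y - x).
    by apply: mulr_ge0; [apply: mulr_ge0; [exact: sqr_ge0|exact: ltW]|rewrite subr_ge0].
  by lra.
by field.
Qed.

(* Test the equation with [phi ^+ 2 / u]; where u = 0 also phi = 0, and x / 0 = 0. *)
Lemma log_caccioppoli (phi : I -> R) : (forall i, 0 <= phi i) -> (forall i, u i = 0 -> phi i = 0) ->
  \sum_i \sum_j s i j * (Num.min (phi i) (phi j) ^+ 2 * D i j) <=
  6 * \sum_i \sum_j s i j * (phi i - phi j) ^+ 2 + 4 * \sum_i c i * phi i ^+ 2.
Proof.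
move=> phi0 uphi.
have g0 i : u i = 0 -> phi i ^+ 2 / u i = 0 by move=> /uphi ->; rewrite expr0n mul0r.
have := ground_weak_form g0.
rewrite (_ : \sum_i c i * u i * _ = \sum_i c i * phi i ^+ 2); last first.
  apply: eq_bigr => i _; have [/uphi ->|un] := eqVneq (u i) 0; first by rewrite expr0n mul0r !mulr0.
  by field.
have pt i j : (u i - u j) * (phi i ^+ 2 / u i - phi j ^+ 2 / u j) <=
    3 * (phi i - phi j) ^+ 2 - 2^-1 * (Num.min (phi i) (phi j) ^+ 2 * D i j).
  (* On an edge reaching the zero set of [u] the left side is at most [phi l ^+ 2], which the cutoff
     difference pays for, and the weight on the right vanishes. *)
  have half k l : u k = 0 -> (u k - u l) * (phi k ^+ 2 / u k - phi l ^+ 2 / u l) <=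
      3 * (phi k - phi l) ^+ 2 - 2^-1 * (Num.min (phi k) (phi l) ^+ 2 * D k l).
    move=> uk; rewrite /D uk (uphi _ uk) expr0n !mul0r invr0 mulr0 mulr0 mulr0 subr0 !sub0r mulNr mulrN opprK sqrrN.
    apply: (@le_trans _ _ (phi l ^+ 2)); last by have := sqr_ge0 (phi l); lra.
    have [->|un] := eqVneq (u l) 0; first by rewrite mul0r sqr_ge0.
    by rewrite mulrCA mulfV// mulr1.
  have sym k l : (u k - u l) * (phi k ^+ 2 / u k - phi l ^+ 2 / u l) =
     (u l - u k) * (phi l ^+ 2 / u l - phi k ^+ 2 / u k) by ring.
  have symr k l : 3 * (phi k - phi l) ^+ 2 - 2^-1 * (Num.min (phi k) (phi l) ^+ 2 * D k l) =
     3 * (phi l - phi k) ^+ 2 - 2^-1 * (Num.min (phi l) (phi k) ^+ 2 * D l k).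
    by rewrite minC /D (mulrC (u k)) -(sqrrN (phi k - _)) -(sqrrN (u k - _)) !opprB.
  have [ui|ui] := eqVneq (u i) 0; first exact: half.
  have [uj|uj] := eqVneq (u j) 0; first by rewrite sym symr; exact: half.
  have pos k : u k != 0 -> 0 < u k by move=> uk; rewrite lt_neqAle eq_sym uk u0.
  case: (leP (phi i) (phi j)) => [ij|/ltW ji]; first exact: log_test_le (pos _ ui) (pos _ uj) _ ij.
  rewrite sym (_ : 3 * _ - _ = 3 * (phi j - phi i) ^+ 2 - 2^-1 * (phi j ^+ 2 * ((u j - u i) ^+ 2 / (u j * u i)))).
    exact: log_test_le (pos _ uj) (pos _ ui) _ ji.
  by rewrite /D (mulrC (u i)) -(sqrrN (phi i - _)) -(sqrrN (u i - _)) !opprB.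
have : \sum_i \sum_j s i j * ((u i - u j) * (phi i ^+ 2 / u i - phi j ^+ 2 / u j)) <=
   3 * (\sum_i \sum_j s i j * (phi i - phi j) ^+ 2) -
   2^-1 * \sum_i \sum_j s i j * (Num.min (phi i) (phi j) ^+ 2 * D i j).
  rewrite !mulr_sumr -sumrB; apply: ler_sum => i _; rewrite !mulr_sumr -sumrB; apply: ler_sum => j _.
  by rewrite (mulrCA 3) (mulrCA 2^-1) -mulrBr; apply: ler_wpM2l.
set A := \sum_i _; set B := \sum_i _; set C := \sum_i _; set E := \sum_i _; lra.
Qed.

(** * Logarithmic truncation *)

Section log_cutoff.
Variables (del K : R).
Hypothesis del0 : 0 < del.
Hypothesis K0 : 0 < K.

(** The function chi_K when [del] is e^(-2K): the ramp in ln t has width [K], so it ends at e^K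
    times [del]. *)
Definition logcut (t : R) : R := Num.min 1 ((ln (Num.max t del) - ln del) / K).

Let maxdel t : 0 < Num.max t del. Proof. by rewrite lt_max del0 orbT. Qed.

Lemma logcut01 t : 0 <= logcut t <= 1.
Proof.
rewrite /logcut le_min ler01 ge_min lexx andbT/=.
by rewrite divr_ge0 ?subr_ge0 ?ler_ln ?posrE ?maxdel ?le_max ?lexx ?orbT// ltW.
Qed.

Lemma logcut_eq1 t : expR K * del <= t -> logcut t = 1.
Proof.
move=> ht; apply/min_idPl; rewrite ler_pdivlMr// mul1r lerBrDr -{1}(expRK K) -lnM ?posrE ?expR_gt0//.
by rewrite ler_ln ?posrE ?mulr_gt0 ?expR_gt0// le_max ht.
Qed.

Lemma logcut_eq0 t : t <= del -> logcut t = 0.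
Proof. by move=> ht; rewrite /logcut max_r// subrr mul0r; apply/min_idPr. Qed.

Lemma logcut_neq0 t : logcut t != 0 -> del <= t.
Proof. by apply: contraR; rewrite -ltNge => /ltW/logcut_eq0/eqP. Qed.

Lemma min1_lip (a b : R) : `|Num.min 1 a - Num.min 1 b| <= `|a - b|.
Proof.
by rewrite /Num.min; case: ltP => h1; case: ltP => h2; rewrite ler_norml; apply/andP; split;
  case: (ger0P (a - b)); lra.
Qed.

Lemma lnB_le (a b : R) : 0 < b -> b <= a -> ln a - ln b <= (a - b) / b.
Proof.
move=> b0 ba; have a0 := lt_le_trans b0 ba.
rewrite -ln_div ?posrE// (_ : a / b = 1 + (a - b) / b); last by field; rewrite gt_eqF.
by apply: le_ln1Dx; apply: (@lt_le_trans _ _ 0); rewrite ?ltrN10// divr_ge0 ?subr_ge0// ltW.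
Qed.

(** Apply ln(1 + s) <= s to square roots p > q: the result, 2 (p - q) / q, is controlled by the
    symmetric quotient, whereas applied to x and y it gives (x - y) / y, which is not. *)
Lemma lnB_sqr_le (x y : R) : 0 < x -> 0 < y ->
  (ln x - ln y) ^+ 2 <= 4 * ((x - y) ^+ 2 / (x * y)).
Proof.
wlog yx : x y / y <= x => [main x0 y0|x0 y0].
  have [yx|/ltW xy] := leP y x; first exact: main.
  by rewrite -sqrrN opprB -(sqrrN (x - y)) opprB (mulrC x); exact: main.
have [p0 q0] : 0 < Num.sqrt x /\ 0 < Num.sqrt y by rewrite !sqrtr_gt0.
have qp : Num.sqrt y <= Num.sqrt x by rewrite ler_wsqrtr.
have [xE yE] : x = Num.sqrt x ^+ 2 /\ y = Num.sqrt y ^+ 2 by rewrite !sqr_sqrtr// ltW.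
rewrite xE yE; move: (Num.sqrt x) (Num.sqrt y) p0 q0 qp => p q p0 q0 qp.
have l1 := lnB_le q0 qp.
have l0 : 0 <= ln p - ln q by rewrite subr_ge0 ler_ln.
rewrite !lnXn// (_ : _ ^+ 2 = 4 * (ln p - ln q) ^+ 2); last by ring.
rewrite ler_pM2l//; apply: (@le_trans _ _ (((p - q) / q) ^+ 2)).
  by rewrite ler_pXn2r ?nnegrE// (le_trans l0).
rewrite -subr_ge0 (_ : _ - _ = ((p - q) / q) ^+ 2 * (2 * (q / p) + (q / p) ^+ 2)).
  by apply: mulr_ge0; [exact: sqr_ge0|rewrite addr_ge0 ?sqr_ge0// mulr_ge0// divr_ge0// ltW].
by field; rewrite !gt_eqF.
Qed.

Lemma logcut_dist_le t r : (logcut t - logcut r) ^+ 2 <= K ^- 2 * (ln (Num.max t del) - ln (Num.max r del)) ^+ 2.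
Proof.
rewrite -[leLHS]real_normK ?num_real//.
apply: (@le_trans _ _ (`|K^-1 * (ln (Num.max t del) - ln (Num.max r del))| ^+ 2)).
  rewrite ler_pXn2r ?nnegrE//; apply: (le_trans (min1_lip _ _)).
  by rewrite -mulrBl opprB addrA subrK mulrC.
by rewrite real_normK ?num_real// exprMn exprVn.
Qed.

(** Unlike [logcut_edge], this holds where the arguments vanish, at the price of the large factor
    [del ^- 2]. *)
Lemma logcut_lip t r : (logcut t - logcut r) ^+ 2 <= K ^- 2 * del ^- 2 * (t - r) ^+ 2.
Proof.
apply: (le_trans (logcut_dist_le t r)); rewrite -mulrA; apply: ler_wpM2l.
  by rewrite invr_ge0 sqr_ge0.
have lip a b : del <= b -> b <= a -> (ln a - ln b) ^+ 2 <= del ^- 2 * (a - b) ^+ 2.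
  move=> db ba; have b0 := lt_le_trans del0 db; have a0 := lt_le_trans b0 ba.
  rewrite -exprVn -exprMn ler_pXn2r ?nnegrE//.
  - by apply: (le_trans (lnB_le b0 ba)); rewrite mulrC ler_wpM2r ?subr_ge0// lef_pV2.
  - by rewrite subr_ge0 ler_ln.
  - by rewrite mulr_ge0 ?invr_ge0 ?subr_ge0// ltW.
have maxlip : (Num.max t del - Num.max r del) ^+ 2 <= (t - r) ^+ 2.
  rewrite -real_normK ?num_real// -[leRHS]real_normK ?num_real// ler_pXn2r ?nnegrE//.
  by rewrite /Num.max; case: ltP => h1; case: ltP => h2; rewrite ler_norml; apply/andP; split;
    case: (ger0P (t - r)); lra.
have [h|/ltW h] := leP (Num.max r del) (Num.max t del).
  apply: (le_trans (lip _ _ _ h)); first by rewrite le_max lexx orbT.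
  by apply: ler_wpM2l => //; rewrite invr_ge0 sqr_ge0.
rewrite -sqrrN opprB; apply: (le_trans (lip _ _ _ h)); first by rewrite le_max lexx orbT.
by rewrite -(sqrrN (_ - _)) opprB; apply: ler_wpM2l => //; rewrite invr_ge0 sqr_ge0.
Qed.

Lemma logcut_edge t r : 0 < t -> 0 < r ->
  (logcut t - logcut r) ^+ 2 <= 4 * K ^- 2 * ((t - r) ^+ 2 / (t * r)).
Proof.
move=> t0 r0; apply: (le_trans (logcut_dist_le t r)).
rewrite [leRHS](_ : _ = K ^- 2 * (4 * ((t - r) ^+ 2 / (t * r)))); last by ring.
apply: ler_wpM2l; first by rewrite invr_ge0 sqr_ge0.
apply: le_trans (lnB_sqr_le t0 r0).
have mono a b : 0 < b -> b <= a -> 0 <= ln (Num.max a del) - ln (Num.max b del) <= ln a - ln b.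
  move=> b0 ba; have a0 := lt_le_trans b0 ba.
  rewrite subr_ge0 ler_ln ?posrE ?maxdel//.
  have lab : ln b <= ln a by rewrite ler_ln.
  have [ad|da] := leP a del.
    by rewrite max_r ?(le_trans ba)// lexx subrr subr_ge0.
  have [bd|db] := leP b del; last by rewrite ba lexx.
  by rewrite (ltW da) lerD2l lerN2 ler_ln.
have [h|/ltW h] := leP r t.
  by have /andP[? ?] := mono _ _ r0 h; rewrite ler_pXn2r ?nnegrE//; lra.
have /andP[? ?] := mono _ _ t0 h.
by rewrite -(sqrrN (_ - _)) opprB -(sqrrN (ln t - _)) opprB ler_pXn2r ?nnegrE//; lra.
Qed.

Variable th : I -> R.
Hypothesis th01 : forall i, 0 <= th i <= 1.

Let y i := th i * logcut (u i).

Lemma truncated_edge i j : (y i - y j) ^+ 2 <=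
  2 * del ^- 2 * (u i * u j * (th i - th j) ^+ 2) + 2 * (logcut (u i) - logcut (u j)) ^+ 2.
Proof.
have thi := th01 i; have thj := th01 j; have ci := logcut01 (u i); have cj := logcut01 (u j).
have uu : 0 <= 2 * del ^- 2 * (u i * u j * (th i - th j) ^+ 2).
  apply: mulr_ge0; first by rewrite mulr_ge0// invr_ge0 sqr_ge0.
  by apply: mulr_ge0; [exact: mulr_ge0|exact: sqr_ge0].
have zero k l : logcut (u l) = 0 -> (y k - y l) ^+ 2 <= 2 * (logcut (u k) - logcut (u l)) ^+ 2.
  move=> cl; rewrite /y cl mulr0 !subr0 exprMn; apply: ler_wpM2r; first exact: sqr_ge0.
  by have /andP[? ?] := th01 k; nra.
have [cj0|cj0] := eqVneq (logcut (u j)) 0; first by apply: (le_trans (zero i j cj0)); rewrite lerDr.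
have [ci0|ci0] := eqVneq (logcut (u i)) 0.
  rewrite -sqrrN opprB -(sqrrN (logcut _ - _)) opprB.
  by apply: (le_trans (zero j i ci0)); rewrite lerDr.
have ui := logcut_neq0 ci0; have uj := logcut_neq0 cj0.
apply: (@le_trans _ _ (2 * (th i - th j) ^+ 2 + 2 * (logcut (u i) - logcut (u j)) ^+ 2)).
  move: thi thj ci cj; rewrite /y; move: (th i) (th j) (logcut (u i)) (logcut (u j)) => a b p q /andP[? ?] /andP[? ?] /andP[? ?] /andP[? ?].
  have e1 : 0 <= (1 - p ^+ 2) * (a - b) ^+ 2 by apply: mulr_ge0; [nra|exact: sqr_ge0].
  have e2 : 0 <= (1 - b ^+ 2) * (p - q) ^+ 2 by apply: mulr_ge0; [nra|exact: sqr_ge0].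
  have e3 := sqr_ge0 (p * (a - b) - b * (p - q)).
  rewrite -subr_ge0 (_ : _ - _ = 2 * ((1 - p ^+ 2) * (a - b) ^+ 2) + 2 * ((1 - b ^+ 2) * (p - q) ^+ 2) +
    (p * (a - b) - b * (p - q)) ^+ 2); first by lra.
  by ring.
rewrite lerD2r -mulrA ler_pM2l// mulrA -[leLHS]mul1r; apply: ler_wpM2r; first exact: sqr_ge0.
by rewrite ler_pdivlMl ?exprn_gt0// mulr1 expr2; apply: ler_pM => //; exact: ltW.
Qed.

Lemma truncated_weighted_energy (phi : I -> R) : (forall i, 0 <= phi i) -> (forall i, u i = 0 -> phi i = 0) ->
  \sum_i \sum_j s i j * (Num.min (phi i) (phi j) ^+ 2 * (y i - y j) ^+ 2) <=
  2 * del ^- 2 * (\sum_i \sum_j s i j * (Num.min (phi i) (phi j) ^+ 2 * (u i * u j * (th i - th j) ^+ 2))) +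
  8 * K ^- 2 * \sum_i \sum_j s i j * (Num.min (phi i) (phi j) ^+ 2 * D i j).
Proof.
move=> phi0 uphi.
rewrite !mulr_sumr -big_split/=; apply: ler_sum => i _.
rewrite !mulr_sumr -big_split/=; apply: ler_sum => j _.
rewrite (mulrCA _ (s i j)) (mulrCA (8 * _) (s i j)) -mulrDr; apply: ler_wpM2l => //.
rewrite (mulrCA _ (_ ^+ 2)) (mulrCA (8 * _) (Num.min _ _ ^+ 2)) -mulrDr.
have [ui|ui] := eqVneq (u i) 0.
  by rewrite (uphi i)// min_l// expr0n !mul0r.
have [uj|uj] := eqVneq (u j) 0.
  by rewrite (uphi j)// min_r// expr0n !mul0r.
apply: ler_wpM2l; first exact: sqr_ge0.
apply: (le_trans (truncated_edge i j)); rewrite lerD2l.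
have pos k : u k != 0 -> 0 < u k by move=> uk; rewrite lt_neqAle eq_sym uk u0.
have := logcut_edge (pos _ ui) (pos _ uj); rewrite /D; lra.
Qed.

(** Crude bound valid up to the boundary; it will only occur multiplied by the mesh size. *)
Lemma truncated_energy :
  \sum_i \sum_j s i j * (y i - y j) ^+ 2 <=
  2 * del ^- 2 * (\sum_i \sum_j s i j * (u i * u j * (th i - th j) ^+ 2)) +
  2 * (K ^- 2 * del ^- 2) * \sum_i \sum_j s i j * (u i - u j) ^+ 2.
Proof.
rewrite !mulr_sumr -big_split/=; apply: ler_sum => i _.
rewrite !mulr_sumr -big_split/=; apply: ler_sum => j _.
rewrite (mulrCA _ (s i j)) (mulrCA (2 * (_ * _)) (s i j)) -mulrDr; apply: ler_wpM2l => //.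
apply: (le_trans (truncated_edge i j)); rewrite lerD2l -mulrA ler_pM2l//.
exact: logcut_lip.
Qed.
End log_cutoff.
End weighted_graph.

Lemma subrX_le (R : realType) (a b : R) n : 0 <= b -> b <= a ->
  a ^+ n - b ^+ n <= (a - b) * (n%:R * a ^+ n.-1).
Proof.
move=> b0 ba; have a0 := le_trans b0 ba; rewrite subrXX; apply: ler_wpM2l; first by rewrite subr_ge0.
apply: (@le_trans _ _ (\sum_(i < n) a ^+ n.-1)); last by rewrite sumr_const card_ord mulr_natl.
apply: ler_sum => i _; rewrite -[in leRHS](@subnK i n.-1); last by rewrite -ltnS prednK ?(leq_ltn_trans _ (ltn_ord i))//.
rewrite exprD -subn1 -subnDA add1n; apply: ler_wpM2l; first exact: exprn_ge0.
by rewrite lerXn2r ?nnegrE.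
Qed.

(** * Energy estimates on a single mesh *)

Section uniform_gap.
Context {R : realType} {d : nat} (L sigma Lam : R).
Hypothesis d0 : (0 < d)%N.
Hypothesis L0 : 0 < L.
Hypothesis Lam0 : 0 <= Lam.

Definition admissible_mesh (T : mesh R d) : Prop :=
  [/\ conforming_mesh T (cube L), shape_regular T sigma & (1 < d)%N -> monotone_mesh T].

(** The diagonal, where the conductance is nonpositive, is set to 0 so that all weights are
    nonnegative; sums against squared differences do not see it. *)
Definition edge_weight (T : mesh R d) (i j : 'I_(nvert T)) : R :=
  if i == j then 0 else conductance i j.

Definition form (T : mesh R d) (W : 'I_(nvert T) -> R) (lam : R) f : R :=
  dirichlet f + \sum_i mass i * (W i - lam) * f i ^+ 2.

(** All that the gap uses about a discrete ground state, [W] being the linearized potential and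
    [Lam] a bound common to all meshes. *)
Definition ground_data (T : mesh R d) (W u : 'I_(nvert T) -> R) (lam : R) : Prop :=
  [/\ forall i, 0 <= u i /\ (u i = 0 -> `|vert i| = L),
      forall i, u i != 0 ->
        \sum_j edge_weight i j * (u i - u j) + mass i * (W i - lam) * u i = 0,
      \sum_i mass i * u i ^+ 2 = 1,
      dirichlet u <= Lam
    & [/\ forall i, 0 <= W i, \sum_i mass i * W i <= Lam & 0 <= lam <= Lam]].

Section one_mesh.
Variables (T : mesh R d) (W u : 'I_(nvert T) -> R) (lam : R).
Hypothesis adm : admissible_mesh T.
Hypothesis data : ground_data W u lam.

Let conf : conforming_mesh T (cube L). Proof. by case: adm. Qed.

Lemma edge_weightC i j : edge_weight i j = @edge_weight T j i.
Proof. by rewrite /edge_weight eq_sym conductanceC. Qed.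

Lemma edge_weight_ge0 i j : 0 <= @edge_weight T i j.
Proof.
rewrite /edge_weight; case: eqP => // /eqP ij; case: adm => _ _ mono.
by apply: conductance_ge0 => // K KT; exact: (cell_simplex conf KT).
Qed.

Lemma sum_edge_weight (w : 'I_(nvert T) -> 'I_(nvert T) -> R) : (forall i, w i i = 0) ->
  \sum_i \sum_j edge_weight i j * w i j = \sum_i \sum_j conductance i j * w i j.
Proof.
move=> w0; apply: eq_bigr => i _; apply: eq_bigr => j _; rewrite /edge_weight.
by case: eqP => // ->; rewrite w0 !mulr0.
Qed.

Lemma dirichlet_edge_weight f :
  dirichlet f = 2^-1 * \sum_i \sum_j @edge_weight T i j * (f i - f j) ^+ 2.
Proof.
by rewrite (dirichlet_edges conf) sum_edge_weight// => i; rewrite subrr expr0n.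
Qed.

Let u0 i : 0 <= u i. Proof. by case: data => h _ _ _ _; have [] := h i. Qed.

Let eqn i : u i != 0 -> \sum_j edge_weight i j * (u i - u j) + mass i * (W i - lam) * u i = 0.
Proof. by case: data => _ h _ _ _; exact: h. Qed.

Lemma form_ground_multiple t :
  form W lam (fun i => u i * t i) =
  2^-1 * \sum_i \sum_j edge_weight i j * (u i * u j * (t i - t j) ^+ 2).
Proof.
rewrite /form dirichlet_edge_weight.
exact: (ground_state_transform edge_weightC eqn).
Qed.

(** The bound is independent of the mesh: the cutoff is Lipschitz, and [lam >= 0] leaves only the
    total of [mass i * W i]. The 12 is 6 times the 2 from the normalization of [dirichlet]. *)
Lemma ground_log_energy eta : 0 < eta ->
  \sum_i \sum_j edge_weight i j * (Num.min (cutoff L eta i) (cutoff L eta j) ^+ 2 *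
    ((u i - u j) ^+ 2 / (u i * u j))) <=
  12 * ((2 * (2 / eta) * sigma) ^+ 2 * (2 * L) ^+ d) + 4 * Lam.
Proof.
move=> eta0; case: (data) => u0' _ _ _ [W0 mW /andP[lam0 _]].
have phi01 (i : 'I_(nvert T)) := cutoff01 L0 conf i eta0.
have phi0 (i : 'I_(nvert T)) : 0 <= cutoff L eta i by have /andP[] := phi01 i.
have uphi (i : 'I_(nvert T)) : u i = 0 -> cutoff L eta i = 0.
  by move=> /(u0' i).2 Xi; rewrite /cutoff Xi subrr mulr0 min_r.
apply: (le_trans (log_caccioppoli edge_weightC edge_weight_ge0 u0 eqn phi0 uphi)).
apply: lerD; last first.
  rewrite ler_pM2l//; apply: le_trans mW; apply: ler_sum => i _.
  have m0 := mass_ge0 i; have /andP[? p1] := phi01 i.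
  apply: (@le_trans _ _ (mass i * W i * cutoff L eta i ^+ 2)).
    by apply: ler_wpM2r; [exact: sqr_ge0|apply: ler_wpM2l => //; lra].
  by rewrite -[leRHS]mulr1; apply: ler_wpM2l; [exact: mulr_ge0|rewrite expr_le1].
case: adm => _ shape _.
have : dirichlet (@cutoff R d T L eta) <= (2 * (2 / eta) * sigma) ^+ 2 * (2 * L) ^+ d.
  apply: (dirichlet_lipschitz_le d0 L0 conf shape) => [|i j]; last exact: cutoff_lip.
  by rewrite divr_ge0// ltW.
rewrite dirichlet_edge_weight; lra.
Qed.

(** The weighted estimate bounds the interior part; the last term is the price of localization,
    [mesh_size T] times the crude energy up to the boundary. *)
Lemma truncated_local_energy eta K del th E : 0 < eta -> eta <= L -> mesh_size T <= eta / 2 ->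
  0 < del -> 0 < K -> (forall i, 0 <= th i <= 1) ->
  \sum_i \sum_j edge_weight i j * (u i * u j * (th i - th j) ^+ 2) <= 2 * E ->
  local_energy (L - eta) (fun i => th i * logcut del K (u i)) <=
  2 * del ^- 2 * E +
  4 * K ^- 2 * (12 * ((2 * (2 / eta) * sigma) ^+ 2 * (2 * L) ^+ d) + 4 * Lam) +
  (d.+1%:R ^+ 2 * (2 / eta) * sigma ^+ 2) * mesh_size T *
    (2 * del ^- 2 * E + 2 * (K ^- 2 * del ^- 2) * Lam).
Proof.
move=> eta0 etaL hh del0 K0 th01 hE.
case: (adm) => _ shape _; case: (data) => u0' _ _ Du _.
have phi01 (i : 'I_(nvert T)) := cutoff01 L0 conf i eta0.
have phi0 (i : 'I_(nvert T)) : 0 <= cutoff L eta i by have /andP[] := phi01 i.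
have uphi (i : 'I_(nvert T)) : u i = 0 -> cutoff L eta i = 0.
  by move=> /(u0' i).2 Xi; rewrite /cutoff Xi subrr mulr0 min_r.
have e20 : 0 <= 2 / eta by rewrite divr_ge0// ltW.
have del20 : 0 <= del ^- 2 by rewrite invr_ge0 sqr_ge0.
have K20 : 0 <= K ^- 2 by rewrite invr_ge0 sqr_ge0.
set y := fun i => _.
apply: (le_trans (local_energy_le d0 conf shape y e20 phi01 _ _)).
- by move=> i j; exact: cutoff_lip.
- by move=> k i kT; apply: cutoff_inner.
have tw := truncated_weighted_energy edge_weight_ge0 u0 del0 K0 th01 phi0 uphi.
have te := truncated_energy edge_weight_ge0 u0 del0 K0 th01.
have ge := ground_log_energy eta0.
rewrite -sum_edge_weight; last by move=> i; rewrite subrr expr0n mulr0.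
have C0 : 0 <= d.+1%:R ^+ 2 * (2 / eta) * sigma ^+ 2 * mesh_size T.
  by rewrite mulr_ge0 ?(mesh_size_ge0 conf)// mulr_ge0 ?sqr_ge0// mulr_ge0 ?sqr_ge0.
apply: lerD; last first.
  apply: ler_wpM2l => //; rewrite dirichlet_edge_weight.
  have : (K ^- 2 * del ^- 2) * dirichlet u <= (K ^- 2 * del ^- 2) * Lam.
    by apply: ler_wpM2l => //; exact: mulr_ge0.
  rewrite dirichlet_edge_weight.
  have : 2 * del ^- 2 * (\sum_i \sum_j edge_weight i j * (u i * u j * (th i - th j) ^+ 2)) <=
     2 * del ^- 2 * (2 * E) by apply: ler_wpM2l => //; exact: mulr_ge0.
  move: te; set S1 := \sum_i _; set S2 := \sum_i _; set S3 := \sum_i _.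
  set a := K ^- 2 * _; set b := del ^- 2; lra.
have ms : \sum_i \sum_j edge_weight i j * (Num.min (cutoff L eta i) (cutoff L eta j) ^+ 2 * (u i * u j * (th i - th j) ^+ 2)) <=
   2 * E.
  apply: (le_trans _ hE); apply: ler_sum => i _; apply: ler_sum => j _.
  apply: ler_wpM2l; first exact: edge_weight_ge0.
  rewrite -[leRHS]mul1r; apply: ler_wpM2r.
    by apply: mulr_ge0; [exact: mulr_ge0|exact: sqr_ge0].
  have /andP[_ pi1] := phi01 i.
  by apply: exprn_ile1; [rewrite le_min !phi0|rewrite ge_min pi1].
have : 2 * del ^- 2 * (\sum_i \sum_j edge_weight i j * (Num.min (cutoff L eta i) (cutoff L eta j) ^+ 2 * (u i * u j * (th i - th j) ^+ 2))) <= 2 * del ^- 2 * (2 * E).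
  by apply: ler_wpM2l => //; exact: mulr_ge0.
have : 8 * K ^- 2 * (\sum_i \sum_j edge_weight i j * (Num.min (cutoff L eta i) (cutoff L eta j) ^+ 2 *
    ((u i - u j) ^+ 2 / (u i * u j)))) <= 8 * K ^- 2 * (12 * ((2 * (2 / eta) * sigma) ^+ 2 * (2 * L) ^+ d) + 4 * Lam).
  by apply: ler_wpM2l => //; exact: mulr_ge0.
move: tw; rewrite /y; lra.
Qed.
End one_mesh.
End uniform_gap.

(** * Constants uniform over the meshes *)

Section uniform_gap_bounds.
Context {R : realType} {d : nat} (L sigma Lam : R).
Hypothesis d0 : (0 < d)%N.
Hypothesis L0 : 0 < L.
Hypothesis Lam0 : 0 <= Lam.

Local Notation M := (d%:R * (2 * L) ^+ 2 * 2 ^+ d : R).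

Lemma exists_small_strip (mu : R) : 0 < mu -> exists eta : R, [/\ 0 < eta, eta <= L / 2 &
  forall h, 0 <= h -> h <= eta / 2 -> (2 * L) ^+ d - (2 * (L - eta - h)) ^+ d <= mu].
Proof.
move=> mu0; set q := d%:R * (2 * L) ^+ d.-1.
have q0 : 0 < q by rewrite mulr_gt0 ?ltr0n// exprn_gt0// mulr_gt0.
(* The side shrinks by [2 * (eta + h) <= 3 * eta], and [q] bounds the derivative of the volume. *)
exists (Num.min (L / 2) (mu / (3 * q))); set eta := Num.min _ _.
have e0 : 0 < eta by rewrite lt_min !divr_gt0//; lra.
have eL : eta <= L / 2 by rewrite ge_min lexx.
have q3 : 0 < 3 * q by lra.
have eq : eta * (3 * q) <= mu by rewrite -ler_pdivlMr// /eta ge_min lexx orbT.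
split => // h h0 hh; apply: (le_trans (subrX_le _ _ _)); [lra|lra|].
apply: (@le_trans _ _ (3 * eta * q)); last by lra.
by apply: ler_wpM2r; [exact: ltW|lra].
Qed.

(** The truncated function is 1 on [P] and 0 on [N], so two such sets of mass [mu] force its
    interior energy to be at least [q], while the constants keep it below three quarters of [q].
    Requiring [K1 <= K] lets the caller place the threshold e^(-K). *)
Lemma no_transition (mu K1 : R) : 0 < mu -> exists K eps del : R,
  [/\ 0 < K, K1 <= K, 0 < eps, 0 < del &
  forall (T : mesh R d) (W u : 'I_(nvert T) -> R) lam, admissible_mesh L sigma T ->
  ground_data L Lam W u lam -> mesh_size T < del ->
  forall th : 'I_(nvert T) -> R, (forall i, 0 <= th i <= 1) ->
  \sum_i \sum_j edge_weight i j * (u i * u j * (th i - th j) ^+ 2) <= 2 * eps ->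
  forall P N : pred 'I_(nvert T),
  (forall i, P i -> th i = 1 /\ expR (- K) <= u i) ->
  (forall i, N i -> th i = 0 \/ u i <= expR (- (2 * K))) ->
  mu <= \sum_(i | P i) mass i -> mu <= \sum_(i | N i) mass i -> False].
Proof.
move=> mu0; have [|eta [eta0 etaL strip]] := @exists_small_strip (mu / 2); first by rewrite divr_gt0.
pose C := 2 * (4 * L ^+ 2 + M) * (2 * L) ^+ d.
have C0 : 0 < C.
  rewrite /C mulr_gt0// ?exprn_gt0 ?mulr_gt0// ltr_wpDr//.
    by rewrite mulr_ge0// mulr_ge0// sqr_ge0.
  by rewrite mulr_gt0// exprn_gt0.
(* The boundary strip takes at most half of each mass, leaving [mu / 2] for the Poincare inequality
   with constant [C]. *)
pose q := (mu / 2) ^+ 2 / C.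
have q0 : 0 < q by rewrite divr_gt0// exprn_gt0// divr_gt0.
pose B := 12 * ((2 * (2 / eta) * sigma) ^+ 2 * (2 * L) ^+ d) + 4 * Lam.
have B0 : 0 <= B.
  rewrite addr_ge0//; last exact: mulr_ge0.
  by apply: mulr_ge0 => //; apply: mulr_ge0; [exact: sqr_ge0|rewrite exprn_ge0// mulr_ge0// ltW].
pose C1 := d.+1%:R ^+ 2 * (2 / eta) * sigma ^+ 2.
have C10 : 0 <= C1 by rewrite mulr_ge0 ?sqr_ge0// mulr_ge0 ?sqr_ge0// divr_ge0// ltW.
(* [K >= 1] gives [K ^- 2 <= K^-1], and the last summand makes the logarithmic term at most
   [q / 4]. *)
pose K := `|K1| + 1 + 16 * B / q.
have Bq : 0 <= 16 * B / q by apply: divr_ge0; [exact: mulr_ge0|exact: ltW].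
have K1K : K1 <= K by have := ler_norm K1; rewrite /K; lra.
have K1' : 1 <= K by have := normr_ge0 K1; rewrite /K; lra.
have K0 : 0 < K by lra.
pose dl := expR (- (2 * K)).
have dl0 : 0 < dl := expR_gt0 _.
(* Chosen after [dl], so that the contribution of the form is exactly [q / 4]. *)
pose eps := q * dl ^+ 2 / 8.
have eps0 : 0 < eps by rewrite divr_gt0// mulr_gt0// exprn_gt0.
have epsE : 2 * dl ^- 2 * eps = q / 4 by rewrite /eps; field; rewrite gt_eqF.
pose G := 2 * dl ^- 2 * eps + 2 * (K ^- 2 * dl ^- 2) * Lam.
have G0 : 0 <= G.
  rewrite /G epsE addr_ge0//; first by rewrite divr_ge0// ltW.
  apply: mulr_ge0 => //; apply: mulr_ge0 => //.
  by apply: mulr_ge0; rewrite invr_ge0 sqr_ge0.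
(* The mesh size is bounded last: [h * z < q / 4] makes the localization error at most [q / 4], and
   the summand 1 makes [z] positive. *)
pose z := 1 + C1 * G.
have z0 : 0 < z by rewrite ltr_wpDr// mulr_ge0.
exists K, eps, (Num.min (eta / 2) (q / 4 / z)); split => //.
  have q4 : 0 < q / 4 by lra.
  by rewrite lt_min; apply/andP; split; [lra|exact: divr_gt0].
move=> T W u lam adm data; rewrite lt_min => /andP[/ltW h1 h2] th th01 small P N hP hN mP mN.
have conf : conforming_mesh T (cube L) by case: adm.
have h0 := mesh_size_ge0 conf.
have etaL' : eta <= L by lra.
have loc := truncated_local_energy d0 L0 adm data eta0 etaL' h1 dl0 K0 th01 small.
have rL : L - eta <= L by lra.
have hr : mesh_size T <= L - eta by lra.
have st := strip _ h0 h1.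
have iP := inner_mass_ge d0 L0 conf P hr rL; have iN := inner_mass_ge d0 L0 conf N hr rL.
set y := (fun i => th i * logcut dl K (u i)) in loc.
have yP i : P i -> y i = 1.
  move=> /hP[t1 ui]; rewrite /y t1 mul1r logcut_eq1//.
  by rewrite /dl -expRD (_ : _ + _ = - K)//; clear; ring.
have yN i : N i -> y i = 0.
  by move=> /hN[t1|ui]; rewrite /y ?t1 ?mul0r// logcut_eq0// mulr0.
have := inner_poincare d0 L0 conf (f := y) (P := P) (N := N) rL.
have yPN i j : P i -> N j -> 1 <= (y i - y j) ^+ 2.
  by move=> /yP -> /yN ->; rewrite subr0 expr1n.
move=> /(_ yPN); apply/negP; rewrite -ltNge.
have E0 : 0 <= local_energy (L - eta) y.
  apply: sumr_ge0 => k _; apply: mulr_ge0; [exact: cell_energy_ge0|exact: vol_ge0].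
apply: (@le_lt_trans _ _ (C * local_energy (L - eta) y)).
  rewrite /C [leRHS]mulrAC; apply: ler_wpM2r; first by rewrite exprn_ge0// mulr_ge0// ltW.
  apply: ler_wpM2r => //.
  rewrite ler_pM2l// lerD2r ler_pM2l// ler_pXn2r ?nnegrE//; [clear -hr eta0; lra|exact: ltW].
apply: (@lt_le_trans _ _ ((mu / 2) ^+ 2)); last first.
  have mu2 : 0 <= mu / 2 by apply: divr_ge0 => //; exact: ltW.
  by rewrite expr2; apply: ler_pM => //; [clear -mP iP st|clear -mN iN st]; lra.
rewrite -ltr_pdivlMl// mulrC -/q.
apply: (le_lt_trans loc); rewrite epsE -/B -/C1.
have KB : 4 * K ^- 2 * B <= q / 4.
  have : 4 * K ^- 2 * B <= 4 * K^-1 * B.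
    apply: ler_wpM2r => //; rewrite ler_pM2l// -exprVn expr2 -[leRHS]mul1r.
    by apply: ler_wpM2r; [rewrite invr_ge0 ltW|rewrite invf_le1].
  move=> /le_trans; apply; rewrite mulrAC ler_pdivrMr//.
  have e : q * (16 * B / q) = 16 * B by field; rewrite gt_eqF.
  have : q * (16 * B / q) <= q * K by rewrite ler_pM2l// /K; have := normr_ge0 K1; clear; lra.
  by rewrite e; clear; lra.
have hG : C1 * mesh_size T * (q / 4 + 2 * (K ^- 2 * dl ^- 2) * Lam) <= q / 4.
  have -> : q / 4 + 2 * (K ^- 2 * dl ^- 2) * Lam = G by rewrite /G epsE.
  have h2' : mesh_size T * z < q / 4 by rewrite -ltr_pdivlMr.
  apply: (le_trans _ (ltW h2')).
  by rewrite (_ : _ * z = mesh_size T + C1 * mesh_size T * G) ?lerDr// /z; clear; ring.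
by move: KB hG; clear -q0; lra.
Qed.
End uniform_gap_bounds.

Section uniform_gap_main.
Context {R : realType} {d : nat} (L sigma Lam : R).
Hypothesis d0 : (0 < d)%N.
Hypothesis L0 : 0 < L.
Hypothesis Lam0 : 0 <= Lam.

Local Notation M := (d%:R * (2 * L) ^+ 2 * 2 ^+ d : R).

(** Equi-integrability read backwards: with bounded energy, a fixed part of the squared norm cannot
    sit on a set of small mass. *)
Lemma mass_ge_uniform (A s : R) : 0 <= A -> 0 < s -> exists mu del : R,
  [/\ 0 < mu, 0 < del & forall (T : mesh R d) f (S : pred 'I_(nvert T)),
    conforming_mesh T (cube L) -> mesh_size T < del -> dirichlet f <= A ->
    \sum_i mass i * f i ^+ 2 <= 1 -> s <= \sum_(i | S i) mass i * f i ^+ 2 ->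
    mu <= \sum_(i | S i) mass i].
Proof.
move=> A0 s0.
have M0 : 0 <= M by apply: mulr_ge0; [apply: mulr_ge0 => //; exact: sqr_ge0|exact: exprn_ge0].
have MA : 0 <= M * A by exact: mulr_ge0.
have z1 : 0 < 12 * (M * A + 1) by lra.
have z2 : 0 < 12 * (A + 1) by lra.
(* As [l] and [h] are at most 1 their squares are bounded by themselves; [l] and the mesh bound make
   the energy terms absorb at most half of [s]. *)
pose l := Num.min (1 / 2) (s / (12 * (M * A + 1))).
have l0 : 0 < l by rewrite lt_min; apply/andP; split; [lra|exact: divr_gt0].
have l12 : l <= 1 / 2 by rewrite /l ge_min lexx.
have l2 : l * (12 * (M * A + 1)) <= s by rewrite -ler_pdivlMr// /l ge_min lexx orbT.
pose P := l ^+ d * (2 * L) ^+ d.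
have P0 : 0 < P by rewrite /P mulr_gt0// exprn_gt0// mulr_gt0.
have D0 : 0 < d.+1%:R :> R by rewrite ltr0n.
exists (P * s / (6 * d.+1%:R)), (Num.min 1 (s / (12 * (A + 1)))); split.
- by rewrite divr_gt0// mulr_gt0.
- by rewrite lt_min ltr01 divr_gt0.
move=> T f S conf; rewrite lt_min => /andP[/ltW h1]; rewrite ltr_pdivlMr// => h2 Df f1 fS.
have h0 := mesh_size_ge0 conf.
have := nodal_equi_integrability d0 L0 conf S f (l := l).
rewrite l0 l12 -/P => /(_ isT).
have mS0 : 0 <= \sum_(i | S i) mass i by apply: sumr_ge0 => i _; exact: mass_ge0.
have D1 := dirichlet_ge0 f.
have e1 : mesh_size T ^+ 2 + l ^+ 2 * (d%:R * (2 * L) ^+ 2) * 2 ^+ d <= mesh_size T + l * M.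
  apply: lerD; first by rewrite expr2 -[leRHS]mul1r; apply: ler_wpM2r.
  rewrite -!(mulrA (l ^+ 2)) -mulrA expr2 -mulrA; apply: ler_wpM2l; first exact: ltW.
  by rewrite -[leRHS]mul1r -mulrA; apply: ler_wpM2r => //; lra.
have e2 : 3 * P * (mesh_size T ^+ 2 + l ^+ 2 * (d%:R * (2 * L) ^+ 2) * 2 ^+ d) * dirichlet f <=
   P * (3 * ((mesh_size T + l * M) * A)).
  rewrite -mulrA -[3 * P]mulrC -(mulrA P) ler_pM2l// ler_pM2l//; apply: ler_pM => //.
  by rewrite addr_ge0 ?sqr_ge0// -mulrA; apply: mulr_ge0 => //; exact: sqr_ge0.
have e3 : (mesh_size T + l * M) * A <= s / 6.
  have -> : (mesh_size T + l * M) * A = mesh_size T * A + l * (M * A) by ring.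
  by move: h2 l2 h0 (ltW l0); clear; lra.
have e4 : P * (3 * ((mesh_size T + l * M) * A)) <= P * (s / 2).
  by rewrite ler_pM2l//; move: e3; clear; lra.
have e5 : 3 * d.+1%:R * (\sum_(i | S i) mass i) * (\sum_i mass i * f i ^+ 2) <=
   3 * d.+1%:R * (\sum_(i | S i) mass i).
  rewrite -[leRHS]mulr1; apply: ler_wpM2l => //.
  by apply: mulr_ge0 => //; apply: mulr_ge0.
have e6 : P * s <= P * \sum_(i | S i) mass i * f i ^+ 2 by rewrite ler_pM2l.
rewrite ler_pdivrMr ?mulr_gt0//.
by move: e2 e4 e5 e6; clear; lra.
Qed.

(** Apply [no_transition] with [th = 1], for which the form is 0: since the normalized [u] is at
    least e^(-K) on a set of mass bounded below, the set where it is below e^(-2K) must be small. *)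
Lemma ground_mass_small (mu : R) : 0 < mu -> exists K del : R,
  [/\ 0 < K, 0 < del & forall (T : mesh R d) (W u : 'I_(nvert T) -> R) lam,
    admissible_mesh L sigma T -> ground_data L Lam W u lam -> mesh_size T < del ->
    \sum_(i | u i <= expR (- (2 * K))) mass i < mu].
Proof.
move=> mu0; have h12 : 0 < 1 / 2 :> R by lra.
have [mu1 [del1 [mu10 del10 ui]]] := mass_ge_uniform Lam0 h12.
have V0 : 0 < (2 * L) ^+ d by rewrite exprn_gt0// mulr_gt0.
pose t := Num.min 1 (1 / (2 * (2 * L) ^+ d)).
have t0 : 0 < t by rewrite lt_min ltr01 divr_gt0// mulr_gt0.
have t1 : t <= 1 by rewrite /t ge_min lexx.
have tV : t * (2 * (2 * L) ^+ d) <= 1 by rewrite -ler_pdivlMr ?mulr_gt0// /t ge_min lexx orbT.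
have mm0 : 0 < Num.min mu mu1 by rewrite lt_min mu0.
(* [K >= - ln t] gives e^(-K) <= t, so the nodes below e^(-K) carry at most half of the squared norm
   of [u]. *)
have [K [eps [del [K0 K1 eps0 del0 main]]]] := @no_transition R d L sigma Lam d0 L0 Lam0 _ (- ln t) mm0.
exists K, (Num.min del del1); split => //; first by rewrite lt_min del0.
move=> T W u lam adm data; rewrite lt_min => /andP[hdel hdel1].
rewrite ltNge; apply/negP => mN.
have conf : conforming_mesh T (cube L) by case: adm.
case: (data) => u0 _ u1 Du _.
apply: (main T W u lam adm data hdel (fun=> 1) _ _ (fun i => expR (- K) <= u i) (fun i => u i <= expR (- (2 * K)))).
- by move=> _; rewrite ler01 lexx.
- rewrite big1; first by rewrite mulr_ge0// ltW.
  by move=> i _; rewrite big1// => j _; rewrite subrr expr0n !mulr0.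
- by [].
- by move=> i; right.
- apply: (@le_trans _ _ mu1); first by rewrite ge_min lexx orbT.
  apply: (ui T u) => //; first by rewrite u1.
  have : \sum_(i | ~~ (expR (- K) <= u i)) mass i * u i ^+ 2 <= 1 / 2.
    apply: (@le_trans _ _ (\sum_(i | ~~ (expR (- K) <= u i)) mass i * t)).
      apply: ler_sum => i; rewrite -ltNge => /ltW hu; apply: ler_wpM2l; first exact: mass_ge0.
      have ut : u i <= t.
        apply: (le_trans hu); rewrite -[leRHS]lnK ?posrE// ler_expR; lra.
      have [ui0 _] := u0 i; rewrite expr2 -[leRHS]mul1r; apply: ler_pM => //.
      exact: (le_trans ut).
    rewrite -mulr_suml; apply: (@le_trans _ _ ((2 * L) ^+ d * t)); last by lra.
    apply: ler_wpM2r; first exact: ltW.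
    rewrite -(sum_mass_all d0 L0 conf) [leRHS](bigID (fun i => expR (- K) <= u i))/=.
    by rewrite lerDr sumr_ge0// => i _; exact: mass_ge0.
  move: u1; rewrite (bigID (fun i => expR (- K) <= u i))/=; lra.
- by rewrite ge_min mN.
Qed.

Lemma sqr_clamp_dist (a b : R) :
  (Num.max 0 (Num.min 1 a) - Num.max 0 (Num.min 1 b)) ^+ 2 <= (a - b) ^+ 2.
Proof.
rewrite -real_normK ?num_real// -[leRHS]real_normK ?num_real// ler_pXn2r ?nnegrE//.
apply: le_trans (min1_lip a b); move: (Num.min 1 a) (Num.min 1 b) => {}a {}b.
by rewrite /Num.max; case: ltP => h1; case: ltP => h2; rewrite ler_norml; apply/andP; split;
  case: (ger0P (a - b)); lra.
Qed.

(** A small form makes the clamped ratio [v / u] an admissible [th] for [no_transition]. It is 1 on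
    the nodes [P] where [v] is not small and [u] is neither small nor large, and 0 where [v < 0];
    both sets have mass bounded below. *)
Lemma uniform_gap_half : exists eps del : R, [/\ 0 < eps, 0 < del &
  forall (T : mesh R d) (W u : 'I_(nvert T) -> R) lam,
    admissible_mesh L sigma T -> ground_data L Lam W u lam -> mesh_size T < del ->
    forall v, (forall i, u i = 0 -> v i = 0) -> \sum_i mass i * (u i * v i) = 0 ->
    \sum_i mass i * v i ^+ 2 = 1 -> 1 / 2 <= \sum_(i | 0 < v i) mass i * v i ^+ 2 ->
    eps <= form W lam v].
Proof.
have V0 : 0 < (2 * L) ^+ d by rewrite exprn_gt0// mulr_gt0.
(* Nodes with [0 < v i < t] carry at most 1/8 of the squared norm, so those with [t <= v i] carry at
   least 1/2 - 1/8 = 3/8. *)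
pose t := Num.min 1 (1 / (8 * (2 * L) ^+ d)).
have t0 : 0 < t by rewrite lt_min ltr01 divr_gt0// mulr_gt0.
have t1 : t <= 1 by rewrite /t ge_min lexx.
have tV : t * (8 * (2 * L) ^+ d) <= 1 by rewrite -ler_pdivlMr ?mulr_gt0// /t ge_min lexx orbT.
have A0 : 0 <= 1 + Lam by rewrite addr_ge0.
have s38 : 0 < 3 / 8 :> R by lra.
have [mua [dela [mua0 dela0 uia]]] := mass_ge_uniform A0 s38.
(* By Chebyshev, [u] exceeds [N] on mass at most [mua / 4]; [K0] below discards another [mua / 4],
   and half of [mua] remains. *)
pose N := 1 + 4 / mua.
have mua4 : 0 < 4 / mua by rewrite divr_gt0.
have N1 : 1 <= N by rewrite /N lerDl ltW.
have N0 : 0 < N by lra.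
have Nmu : 1 <= mua / 4 * N ^+ 2.
  rewrite -ler_pdivrMl ?divr_gt0// mulr1 invf_div; apply: (@le_trans _ _ N); first by rewrite /N; lra.
  by rewrite expr2 -[leLHS]mul1r; apply: ler_wpM2r => //; exact: ltW.
have [K0 [del0 [K00 del00 small]]] := ground_mass_small (divr_gt0 mua0 (ltr0n _ 4)).
(* Lower bound for the pairing of [u] and [v] on [P]; by orthogonality the negative part of [v]
   pairs with [u] to at least as much. *)
pose s0 := expR (- (2 * K0)) * t * (mua / 2).
have s00 : 0 < s0 by rewrite /s0 mulr_gt0 ?mulr_gt0 ?expR_gt0 ?divr_gt0.
have [mub [delb [mub0 delb0 uib]]] := mass_ge_uniform Lam0 (exprn_gt0 2 s00).
(* On [P] the ratio [v / u] is at least [b], so dividing by [b] before clamping gives 1 there. *)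
pose b := t / N.
have b0 : 0 < b by rewrite divr_gt0.
have mm0 : 0 < Num.min (mua / 2) mub by rewrite lt_min mub0 divr_gt0.
have [K [eps [del [Kp K2 eps0 del1 main]]]] := @no_transition R d L sigma Lam d0 L0 Lam0 _ (2 * K0) mm0.
(* The bound 1 yields [dirichlet v <= 1 + Lam]; the factor [b ^+ 2] undoes the division of the ratio
   by [b]. *)
exists (Num.min 1 (b ^+ 2 * eps)), (Num.min (Num.min dela delb) (Num.min del0 del)); split.
- by rewrite lt_min ltr01 mulr_gt0// exprn_gt0.
- by rewrite !lt_min dela0 delb0 del00.
move=> T W u lam adm data; rewrite !lt_min => /andP[/andP[ha hb] /andP[h0 hd]] v uv orth v1 vhalf.
have conf : conforming_mesh T (cube L) by case: adm.
case: (data) => u0 _ u1 Du [W0 mW /andP[lam0 lamL]].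
have m0 i : 0 <= @mass R d T i := mass_ge0 i.
rewrite leNgt lt_min; apply/negP => /andP[/ltW f1 /ltW fe].
have Dv : dirichlet v <= 1 + Lam.
  have : form W lam v >= dirichlet v - lam * \sum_i mass i * v i ^+ 2.
    rewrite /form lerD2l mulr_sumr -sumrN; apply: ler_sum => i _.
    rewrite mulrCA -mulrN -mulrA; apply: ler_wpM2l => //.
    by rewrite -mulNr; apply: ler_wpM2r; [exact: sqr_ge0|rewrite lerBrDr addrC subrr W0].
  by rewrite v1; lra.
have sub3 (A B C S : pred 'I_(nvert T)) : (forall i, S i -> [|| A i, B i | C i]) ->
    \sum_(i | S i) mass i <= \sum_(i | A i) mass i + \sum_(i | B i) mass i + \sum_(i | C i) mass i.
  move=> SABC; rewrite (big_mkcond S) (big_mkcond A) (big_mkcond B) (big_mkcond C)/= -!big_split/=.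
  apply: ler_sum => i _; have mi := m0 i.
  have ite0 (p : bool) : 0 <= (if p then mass i else 0) by case: p.
  case: ifP => [/SABC/or3P|_]; last by rewrite !addr_ge0.
  case=> ->; first by rewrite -addrA lerDl addr_ge0.
  - by rewrite addrAC lerDr addr_ge0.
  - by rewrite lerDr addr_ge0.
pose P := [pred i | [&& t <= v i, u i <= N & expR (- (2 * K0)) < u i]].
have mP : mua / 2 <= \sum_(i | P i) mass i.
  have S1 : mua <= \sum_(i | t <= v i) mass i.
    apply: (uia T v) => //; first by rewrite v1.
    have st : \sum_(i | ~~ (t <= v i) && (0 < v i)) mass i * v i ^+ 2 <= 1 / 8.
      apply: (@le_trans _ _ (\sum_(i | ~~ (t <= v i) && (0 < v i)) mass i * t)).
        apply: ler_sum => i /andP[]; rewrite -ltNge => /ltW vt v0; apply: ler_wpM2l => //.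
        by rewrite expr2 -[leRHS]mul1r; apply: ler_pM => //; [exact: ltW|exact: ltW|exact: le_trans t1].
      rewrite -mulr_suml; apply: (@le_trans _ _ ((2 * L) ^+ d * t)); last by lra.
      apply: ler_wpM2r; first exact: ltW.
      rewrite -(sum_mass_all d0 L0 conf) [leRHS](bigID (fun i => ~~ (t <= v i) && (0 < v i)))/=.
      by rewrite lerDl sumr_ge0.
    have : \sum_(i | 0 < v i) mass i * v i ^+ 2 <= \sum_(i | t <= v i) mass i * v i ^+ 2 +
        \sum_(i | ~~ (t <= v i) && (0 < v i)) mass i * v i ^+ 2.
      rewrite (big_mkcond (fun i => 0 < v i)) (big_mkcond (fun i => t <= v i)) (big_mkcond (fun i => ~~ _ && _))/= -!big_split/=.
      apply: ler_sum => i _; have mi : 0 <= mass i * v i ^+ 2 by rewrite mulr_ge0// sqr_ge0.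
      by case: (t <= v i); case: (0 < v i); rewrite /= ?addr0 ?add0r.
    lra.
  have S2 : \sum_(i | N < u i) mass i <= mua / 4.
    rewrite -(ler_pM2r (exprn_gt0 2 N0)); apply: le_trans Nmu.
    rewrite -u1 mulr_suml [leRHS](bigID (fun i => N < u i))/=.
    apply: (@le_trans _ _ (\sum_(i | N < u i) mass i * u i ^+ 2)).
      apply: ler_sum => i /ltW Nu; apply: ler_wpM2l => //.
      by rewrite ler_pXn2r ?nnegrE// ltW// (lt_le_trans N0).
    by rewrite lerDl sumr_ge0// => i _; rewrite mulr_ge0// sqr_ge0.
  have S3 := small T W u lam adm data h0.
  have : \sum_(i | t <= v i) mass i <= \sum_(i | P i) mass i + \sum_(i | N < u i) mass i +
     \sum_(i | u i <= expR (- (2 * K0))) mass i.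
    apply: sub3 => i /= ->.
    by have [_|_] := leP (u i) N; have [_|_] := leP (u i) (expR (- (2 * K0))); rewrite ?orbT.
  by move: S1 S2 S3; clear; lra.
have pos i : P i -> expR (- (2 * K0)) * t <= u i * v i.
  move=> /and3P[vt _ /ltW uK]; apply: ler_pM => //; exact: ltW.
have uv0 i : 0 <= u i by have [] := u0 i.
have neg : s0 <= \sum_(i | v i < 0) mass i * (u i * - v i).
  have : \sum_i mass i * (u i * v i) >= s0 - \sum_(i | v i < 0) mass i * (u i * - v i).
    rewrite [leRHS](bigID (fun i => v i < 0))/= -sumrN.
    rewrite [X in _ <= X + _](_ : _ = \sum_(i | v i < 0) - (mass i * (u i * - v i))); last first.
      by apply: eq_bigr => i _; ring.
    rewrite addrC lerD2l; apply: (@le_trans _ _ (\sum_(i | P i) mass i * (u i * v i))).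
      apply: (@le_trans _ _ (\sum_(i | P i) mass i * (expR (- (2 * K0)) * t))).
        rewrite -mulr_suml mulrC /s0; apply: ler_wpM2l => //.
        by rewrite mulr_ge0 ?expR_ge0// ltW.
      by apply: ler_sum => i Pi; apply: ler_wpM2l => //; exact: pos.
    rewrite (big_mkcond P) [leRHS]big_mkcond/=; apply: ler_sum => i _.
    case: ifP => [/and3P[vt _ _]|_]; first by rewrite ltNge (le_trans (ltW t0) vt).
    by case: ltP => // v0; rewrite mulr_ge0// mulr_ge0.
  by rewrite orth; lra.
have mN : mub <= \sum_(i | v i < 0) mass i.
  apply: (uib T u) => //; first by rewrite u1.
  set A := \sum_(i | _) mass i * u i ^+ 2.
  (* Young's inequality with weight [s0]: it forces the squared norm of [u] on the nodes with
     [v i < 0] to be at least [s0 ^+ 2]. *)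
  have : 2 * s0 * \sum_(i | v i < 0) mass i * (u i * - v i) <= A + s0 ^+ 2.
    rewrite mulr_sumr; apply: (@le_trans _ _ (\sum_(i | v i < 0) (mass i * u i ^+ 2 + s0 ^+ 2 * (mass i * v i ^+ 2)))).
      apply: ler_sum => i _; rewrite -subr_ge0 (_ : _ - _ = mass i * (u i + s0 * v i) ^+ 2); last by ring.
      by rewrite mulr_ge0// sqr_ge0.
    rewrite big_split/= lerD2l -mulr_sumr -[leRHS]mulr1; apply: ler_wpM2l; first exact: sqr_ge0.
    rewrite -v1 [leRHS](bigID (fun i => v i < 0))/= lerDl sumr_ge0// => i _.
    by rewrite mulr_ge0// sqr_ge0.
  have : 2 * s0 * s0 <= 2 * s0 * \sum_(i | v i < 0) mass i * (u i * - v i).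
    by apply: ler_wpM2l => //; rewrite mulr_ge0// ltW.
  rewrite expr2; clear; lra.
pose w i := v i / u i.
have vE i : v i = u i * w i.
  have [e|un] := eqVneq (u i) 0; first by rewrite uv// e mul0r.
  by rewrite /w mulrCA mulfV// mulr1.
pose th i := Num.max 0 (Num.min 1 (w i / b)).
have formE : form W lam v = 2^-1 * \sum_i \sum_j edge_weight i j * (u i * u j * (w i - w j) ^+ 2).
  by rewrite -(form_ground_multiple adm data); congr form; apply/funext.
apply: (main T W u lam adm data hd th _ _ P (fun i => v i < 0)).
- by move=> i; rewrite /th le_max lexx/= ge_max ler01 ge_min lexx.
- apply: (@le_trans _ _ (b ^- 2 * (2 * form W lam v))).
    rewrite formE (mulrA 2) mulfV// mul1r mulr_sumr; apply: ler_sum => i _.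
    rewrite mulr_sumr; apply: ler_sum => j _; rewrite [leRHS]mulrCA; apply: ler_wpM2l.
      exact: edge_weight_ge0 adm i j.
    rewrite [leRHS]mulrCA; apply: ler_wpM2l; first exact: mulr_ge0.
    apply: (le_trans (sqr_clamp_dist _ _)); rewrite -mulrBl exprMn mulrC exprVn//.
  by rewrite ler_pdivrMl ?exprn_gt0// mulrCA ler_pM2l.
- move=> i /and3P[vt uN uK]; split.
    have ui : 0 < u i by apply: lt_trans uK; exact: expR_gt0.
    rewrite /th min_l ?max_r// ler_pdivlMr// mul1r /w ler_pdivlMr//.
    apply: le_trans vt; rewrite /b mulrAC ler_pdivrMr//; apply: ler_wpM2l => //; exact: ltW.
  by apply: le_trans (ltW uK); rewrite ler_expR lerN2.
- move=> i v0; left; rewrite /th max_l//; apply: (@le_trans _ _ (w i / b)); first by rewrite ge_min lexx orbT.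
  rewrite /w ler_pdivrMr// mul0r.
  by rewrite mulr_le0_ge0 ?invr_ge0// ltW.
- by apply: le_trans mP; rewrite ge_min lexx.
- by apply: le_trans mN; rewrite ge_min lexx orbT.
Qed.

(** Both hypotheses and form are even in [v], and one of [v], [- v] has a positive part carrying
    half of the squared norm. *)
Lemma uniform_gap : exists eps del : R, [/\ 0 < eps, 0 < del &
  forall (T : mesh R d) (W u : 'I_(nvert T) -> R) lam,
    admissible_mesh L sigma T -> ground_data L Lam W u lam -> mesh_size T < del ->
    forall v, (forall i, u i = 0 -> v i = 0) -> \sum_i mass i * (u i * v i) = 0 ->
    \sum_i mass i * v i ^+ 2 = 1 -> eps <= form W lam v].
Proof.
have [eps [del [eps0 del0 main]]] := uniform_gap_half.
exists eps, del; split => // T W u lam adm data hd v uv orth v1.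
have conf : conforming_mesh T (cube L) by case: adm.
have [vp|vn] := leP (1 / 2) (\sum_(i | 0 < v i) mass i * v i ^+ 2).
  exact: (main T W u lam adm data hd v).
have -> : form W lam v = form W lam (fun i => - v i).
  rewrite /form !(dirichlet_edge_weight adm); congr (_ * _ + _).
    by apply: eq_bigr => i _; apply: eq_bigr => j _; ring.
  by apply: eq_bigr => i _; ring.
apply: (main T W u lam adm data hd).
- by move=> i /uv ->; rewrite oppr0.
- under eq_bigr => i _ do rewrite !mulrN.
  by rewrite sumrN orth oppr0.
- by under eq_bigr => i _ do rewrite sqrrN.
under eq_bigr => i _ do rewrite sqrrN.
under eq_bigl => i do rewrite oppr_gt0.
have : \sum_i mass i * v i ^+ 2 <= \sum_(i | 0 < v i) mass i * v i ^+ 2 + \sum_(i | v i < 0) mass i * v i ^+ 2.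
  rewrite (big_mkcond (fun i => 0 < v i)) (big_mkcond (fun i => v i < 0))/= -big_split/=.
  apply: ler_sum => i _; case: ltgtP => [v0|v0|<-]; rewrite ?addr0 ?add0r ?expr0n ?mulr0//.
by rewrite v1; lra.
Qed.
End uniform_gap_main.

(** * Finite element matrices and the second eigenvalue *)

Section finite_elements.
Context {R : realType} {d : nat} (T : mesh R d) (L : R).
Local Notation node := 'I_(nvert T).
Local Notation X := (@vert R d T).
Local Notation D := (cube L : set 'rV[R]_d).
Implicit Types (i j : node) (K F : {set node}).
Hypothesis d0 : (0 < d)%N.
Hypothesis L0 : 0 < L.
Hypothesis conf : conforming_mesh T D.

Let cs K : K \in cells T -> #|K| = d.+1 /\ aff_indep K := @cell_simplex _ _ T L conf K.

Lemma continuous_dotp (g : 'rV[R]_d) : continuous (dotp g).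
Proof.
apply: continuous_big; first exact: add_continuous.
move=> i _ x; apply: (@cvgM _ _ (nbhs x) _ (fun=> g ord0 i) (fun y : 'rV[R]_d => y ord0 i)).
  exact: cvg_cst.
exact: coord_continuous.
Qed.

Lemma continuous_affine (a : R) (g : 'rV[R]_d) : continuous (fun x => a + dotp g x).
Proof.
move=> x; apply: (@cvgD _ _ _ (nbhs x) _ (fun=> a) (dotp g)); first exact: cvg_cst.
exact: continuous_dotp.
Qed.

Lemma closed_hull K : K \in cells T -> closed (hull K).
Proof.
move=> KT; have [cK aK] := cs KT.
rewrite (_ : hull K = \bigcap_(i in [set i | i \in K]) (bary K i @^-1` [set y | 0 <= y])).
  apply: closed_bigI => i _; apply: (continuous_closedP _).1; last exact: closed_ge.
  exact: continuous_affine.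
by apply/seteqP; split=> [x /(hullP cK aK) h i|x h]; [exact: h|apply/(hullP cK aK) => i; exact: h].
Qed.

Lemma cellwise_affine_continuous (f : 'rV[R]_d -> R) :
  (forall K, K \in cells T -> exists (a : R) (g : 'rV[R]_d), forall x, hull K x -> f x = a + dotp g x) ->
  {within D, continuous f}.
Proof.
move=> faff; case: conf => _ _ _ -> _.
rewrite (_ : \bigcup_(K in _) hull K = \big[setU/set0]_(K <- enum (cells T)) hull K); last first.
  by rewrite -bigcup_seq; apply: eq_bigcupl; split=> K /=; rewrite mem_enum.
have : all (mem (cells T)) (enum (cells T)) by apply/allP => K; rewrite mem_enum.
elim: (enum _) => [_|K s IHs /= /andP[KT sT]]; first by rewrite big_nil; exact: continuous_subspace0.
rewrite big_cons; apply: withinU_continuous; [exact: closed_hull| |  |exact: IHs].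
  elim: s sT {IHs} => [_|K' s IHs /= /andP[K'T sT]]; first by rewrite big_nil; exact: closed0.
  by rewrite big_cons; apply: closedU; [exact: closed_hull|exact: IHs].
have [a [g fE]] := faff K KT.
apply: (@subspace_eq_continuous _ _ _ (fun x => a + dotp g x)).
  by move=> x /set_mem Kx; rewrite /= /from_subspace fE.
by apply: continuous_subspaceT; exact: continuous_affine.
Qed.

Lemma p1_affine f K : K \in cells T -> exists a : R, forall x, hull K x -> p1 f x = a + dotp (pgrad f K) x.
Proof.
move=> KT; have [i iK] := cell_nonempty conf KT; have [cK aK] := cs KT.
have Ki := vert_hull cK aK iK.
exists (p1 f (X i) - dotp (pgrad f K) (X i)) => x Kx.
have := p1B conf f KT Kx Ki; rewrite dotpBr; lra.
Qed.

Lemma vert_cube i : D (X i).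
Proof.
have [K KT iK] : exists2 K, K \in cells T & i \in K by case: conf => _ h _ _ _; exact: h.
have [cK aK] := cs KT; exact: (hull_sub_cube conf KT (vert_hull cK aK iK)).
Qed.

Lemma boundary_bary K i x : K \in cells T -> hull K x -> `|x| = L -> i \in K -> 0 < bary K i x -> `|X i| = L.
Proof.
move=> KT Kx xL iK bi; have [cK aK] := cs KT.
apply/eqP; rewrite eq_le; apply/andP; split; first by apply/cube_normP; [exact: ltW|exact: vert_cube].
have b0 := (hullP cK aK x).1 Kx; have sx := sum_bary_vert cK aK x; have s1 := sum_bary cK aK x.
(* A coordinate attaining its extremal value on the cube at [x] does so at all vertices of the face of [x]. *)
have key (e : R) k : `|e| = 1 -> e * x ord0 k = L -> `|X i| >= L.
  move=> e1 xk.
  have Xk j : e * X j ord0 k <= L.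
    apply: (le_trans (ler_norm _)); rewrite normrM e1 mul1r ler_norml; exact: vert_cube.
  have : \sum_(j in K) bary K j x * (L - e * X j ord0 k) = 0.
    under eq_bigr => j _ do rewrite mulrBr.
    rewrite sumrB -mulr_suml s1 mul1r -{1}xk -{1}sx summxE mulr_sumr -sumrB big1// => j _.
    by rewrite mxE; ring.
  move=> /eqP; rewrite psumr_eq0; last first.
    by move=> j jK; rewrite mulr_ge0 ?b0// subr_ge0.
  move=> /allP/(_ i (mem_index_enum _)); rewrite iK/= mulf_eq0 (gt_eqF bi)/= subr_eq0 => /eqP Le.
  have : `|X i ord0 k| = L by rewrite -[LHS]mul1r -e1 -normrM -Le ger0_norm// ltW.
  by move=> <-; have := (cube_normP (X i) (normr_ge0 (X i))).2 (lexx _) k; rewrite -ler_norml.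
have [k xk] : exists k, `|x ord0 k| = L.
  apply: contrapT => /forallNP h; have : `|x| < L.
    have xin : D x := hull_sub_cube conf KT Kx.
    have h' k : `|x ord0 k| < L by rewrite lt_neqAle (introN eqP (h k)) ler_norml; exact: xin.
    pose r := \big[Num.max/0]_k `|x ord0 k|.
    have r0 : 0 <= r by rewrite /r; elim/big_rec: _ => // k y _ y0; rewrite le_max y0 orbT.
    have rL : r < L by rewrite /r; elim/big_ind: _ => // y z yL zL; rewrite gt_max yL.
    apply: le_lt_trans rL; apply/cube_normP => // k; rewrite -ler_norml.
    exact: (le_bigmax _ (fun k => `|x ord0 k|) k).
  by rewrite xL ltxx.
have [x0|/ltW x0] := leP 0 (x ord0 k).
  by apply: (key 1 k); rewrite ?normr1// mul1r -xk ger0_norm.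
by apply: (key (-1) k); rewrite ?normrN1// mulN1r -xk ler0_norm.
Qed.

Definition vanishing (f : node -> R) := forall i, ~ D° (X i) -> f i = 0.

Lemma interior_vertP i : D° (X i) <-> `|X i| < L.
Proof. exact: cube_interiorP. Qed.

Lemma boundary_norm x : D x -> ~ D° x -> `|x| = L.
Proof.
move=> Dx nDx; apply/eqP; rewrite eq_le; apply/andP; split; first by apply/cube_normP => //; exact: ltW.
by rewrite leNgt; apply/negP => xL; apply: nDx; apply/cube_interiorP.
Qed.

(** At a boundary point only boundary vertices have positive barycentric coordinates, and there the
    nodal values are 0. *)
Lemma V0h_p1 f : vanishing f -> V0h T D (p1 f).
Proof.
move=> fv; split.
- by apply: cellwise_affine_continuous => K KT; have [a h] := p1_affine f KT; exists a, (pgrad f K).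
- move=> x Dx nDx; have [K KT Kx] := cube_cover conf Dx; have [cK aK] := cs KT.
  rewrite (p1E conf f KT Kx) big1// => i iK.
  have := (hullP cK aK x).1 Kx i iK; rewrite le_eqVlt => /predU1P[<-|bi]; first by rewrite mulr0.
  rewrite fv ?mul0r//; move/interior_vertP.
  by rewrite (boundary_bary KT Kx (boundary_norm Dx nDx) iK bi) ltxx.
- by move=> K KT; have [a h] := p1_affine f KT; exists a, (pgrad f K).
Qed.

(** [cell_grad] comes from a choice; expanding it by [bgrad_dual] expresses it through vertex
    values, the constant dropping out because the gradients sum to 0. *)
Lemma cell_gradE (f : 'rV[R]_d -> R) K : V0h T D f -> K \in cells T ->
  cell_grad f K = pgrad (fun i => f (X i)) K.
Proof.
move=> [_ _ faff] KT; have [cK aK] := cs KT; have [a [g fE]] := faff K KT.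
have [b bE] : exists b : R, forall x, hull K x -> f x = b + dotp (cell_grad f K) x.
  apply: (@xgetPex _ 0 [set g | exists a : R, forall x, hull K x -> f x = a + dotp g x]).
  by exists g, a.
rewrite [LHS](bgrad_dual cK aK) /pgrad; apply/eqP; rewrite -subr_eq0 -sumrB.
rewrite (eq_bigr (fun i => - b *: bgrad K i)); last first.
  move=> i iK; rewrite (bE (X i)); last exact: vert_hull.
  by rewrite -scalerBl; congr (_ *: _); ring.
by rewrite -scaler_sumr sum_bgrad// scaler0.
Qed.

Lemma hatE i : D° (X i) -> V0h T D (hat D i) /\ forall j, hat D i (X j) = (j == i)%:R.
Proof.
move=> Di; apply: (@xgetPex _ (fun=> 0) [set f | V0h T D f /\ forall j, f (X j) = (j == i)%:R]).
exists (p1 (fun j => (j == i)%:R)); split; last by move=> j; exact: (p1_vert conf).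
apply: V0h_p1.
move=> j Dj.
have -> : (j == i) = false; last exact: mulr0n.
by apply/negbTE/eqP => ji; apply: Dj; rewrite ji; exact: Di.
Qed.

Lemma quad_cell_const (F : {set node} -> R) : quad (fun K (_ : 'rV[R]_d) => F K) = \sum_(K in cells T) vol K * F K.
Proof.
apply: eq_bigr => K KT; have [cK _] := cs KT.
by rewrite sumr_const cK -[F K *+ _]mulr_natl mulrA divfK// pnatr_eq0.
Qed.

Lemma quad_nodal (F : 'rV[R]_d -> R) : quad (fun (_ : {set node}) x => F x) = \sum_i mass i * F (X i).
Proof. by rewrite (sum_mass predT); apply: eq_bigr => K _; under [in RHS]eq_bigl => i do rewrite andbT. Qed.

Lemma quad_dirichlet (f : 'rV[R]_d -> R) : V0h T D f ->
  quad (fun K (_ : 'rV[R]_d) => dotp (cell_grad f K) (cell_grad f K)) = dirichlet (fun i => f (X i)).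
Proof. by move=> Vf; rewrite quad_cell_const; apply: eq_bigr => K KT; rewrite cell_gradE. Qed.

Lemma energy_hE V beta (f : 'rV[R]_d -> R) : V0h T D f -> energy_h T V beta f =
  2^-1 * dirichlet (fun i => f (X i)) + 2^-1 * (\sum_i mass i * (V (X i) * f (X i) ^+ 2)) +
  beta / 4 * \sum_i mass i * f (X i) ^+ 4.
Proof.
move=> Vf; rewrite /energy_h quad_dirichlet// !quad_nodal; congr (_ + _ * _ + _ * _).
  by apply: eq_bigr => i _; ring.
by apply: eq_bigr => i _; ring.
Qed.
End finite_elements.

(** * Matrix form of the discrete problem *)

Section discrete_operator.
Context {R : realType} {d : nat} (T : mesh R d) (L : R).
Local Notation node := 'I_(nvert T).
Local Notation X := (@vert R d T).
Local Notation D := (cube L : set 'rV[R]_d).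
Local Notation N := (ndof T D).
Implicit Types (i j : node) (K F : {set node}) (k l : 'I_N) (v w : 'cV[R]_N).
Hypothesis d0 : (0 < d)%N.
Hypothesis L0 : 0 < L.
Hypothesis conf : conforming_mesh T D.

Let cs K : K \in cells T -> #|K| = d.+1 /\ aff_indep K := @cell_simplex _ _ T L conf K.

Definition extend v i : R := \sum_k (if dof k == i then v k ord0 else 0).

Lemma dof_interior k : D° (X (dof k)).
Proof. by have := enum_valP k; rewrite inE => /asboolP. Qed.

Lemma dof_inj : injective (@dof R d T D).
Proof. exact: enum_val_inj. Qed.

Lemma extend_dof v k : extend v (dof k) = v k ord0.
Proof.
rewrite /extend (bigD1 k)//= eqxx big1 ?addr0// => l lk.
by rewrite (inj_eq dof_inj) (negPf lk).
Qed.

Lemma extend_vanishing v : vanishing L (extend v).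
Proof.
move=> i Di; rewrite /extend big1// => k _; case: eqP => // e.
by case: Di; rewrite -e; exact: dof_interior.
Qed.

Lemma sum_dof (G : node -> R) : (forall i, ~ D° (X i) -> G i = 0) -> \sum_i G i = \sum_(k < N) G (dof k).
Proof.
move=> G0; rewrite (bigID (mem (interior_vert T D)))/= [X in _ + X]big1 ?addr0; last first.
  by move=> i; rewrite inE => /asboolP; exact: G0.
by rewrite big_enum_val.
Qed.

Lemma extend_nodal (f : 'rV[R]_d -> R) : V0h T D f -> extend (nodal T D f) = fun i => f (X i).
Proof.
move=> [_ f0 _]; apply/funext => i; have [Di|Di] := pselect (D° (X i)).
  have iI : i \in interior_vert T D by rewrite inE; apply/asboolP.
  have -> : i = dof (enum_rank_in iI i) by rewrite /dof enum_rankK_in.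
  by rewrite extend_dof mxE.
by rewrite extend_vanishing// f0//; exact: (vert_cube conf).
Qed.

Lemma weight_gt0 k : 0 < weight k.
Proof.
have [K KT iK] : exists2 K, K \in cells T & dof k \in K by case: conf => _ h _ _ _; exact: h.
rewrite /weight (bigD1 K)/= ?KT//; apply: ltr_pwDl; first by rewrite divr_gt0 ?ltr0n ?(vol_gt0 conf KT).
by apply: sumr_ge0 => K' _; rewrite divr_ge0 ?vol_ge0.
Qed.

Lemma massM_unit : massM T D \in unitmx.
Proof.
rewrite unitmxE det_diag unitfE; apply/prodf_neq0 => k _.
by rewrite mxE gt_eqF// weight_gt0.
Qed.

Lemma pgrad_delta K i : K \in cells T -> pgrad (fun j => (j == i)%:R) K = bgrad K i.
Proof.
move=> KT; have [cK aK] := cs KT; rewrite /pgrad; have [iK|iK] := boolP (i \in K).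
  by rewrite (bigD1 i)//= eqxx scale1r big1 ?addr0// => j /andP[_ /negPf ->]; rewrite scale0r.
rewrite bgrad_notin// big1// => j jK; case: eqP => [ji|_]; last by rewrite scale0r.
by move: iK; rewrite -ji jK.
Qed.

Lemma stiffME k l : stiffM T D k l = - conductance (dof k) (dof l).
Proof.
have [Vk hk] := hatE d0 L0 conf (dof_interior k); have [Vl hl] := hatE d0 L0 conf (dof_interior l).
rewrite mxE (quad_cell_const conf) opprK; apply: eq_bigr => K KT.
rewrite !(cell_gradE conf)//; congr (_ * dotp _ _); rewrite -(pgrad_delta _ KT).
  by apply: eq_bigr => j _; rewrite hk.
by apply: eq_bigr => j _; rewrite hl.
Qed.

Lemma sum_conductance i : \sum_j conductance i j = 0.
Proof.
rewrite /conductance sumrN exchange_big big1 ?oppr0//= => K KT; have [cK aK] := cs KT.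
rewrite -mulr_sumr -dotp_sumr (_ : \sum_j bgrad K j = 0) ?dotp0r ?mulr0//.
rewrite -[RHS](sum_bgrad cK aK) [RHS]big_mkcond; apply: eq_bigr => j _.
by case: ifPn => // jK; rewrite bgrad_notin.
Qed.

Lemma dirichlet_nodes (f : node -> R) :
  dirichlet f = - \sum_i \sum_j conductance i j * (f i * f j).
Proof.
rewrite (weighted_edges_cells conf) opprK; apply: eq_bigr => K KT; congr (_ * _).
rewrite /pgrad dotp_suml; apply: eq_bigr => i _; rewrite dotp_sumr; apply: eq_bigr => j _.
by rewrite dotpZl dotpZr; ring.
Qed.

Lemma dot_hE v w : dot_h v w = \sum_i mass i * (extend v i * extend w i).
Proof.
rewrite sum_dof; last by move=> i Di; rewrite extend_vanishing// mul0r mulr0.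
rewrite /dot_h -mulmxA mxE; apply: eq_bigr => k _.
rewrite mul_diag_mx !mxE !extend_dof; rewrite /mass /weight; ring.
Qed.

Variables (V : 'rV[R]_d -> R) (beta : R) (uh : 'rV[R]_d -> R).
Hypothesis Vu : V0h T D uh.

Definition potential i : R := V (X i) + beta * uh (X i) ^+ 2.

Let A := hamilt_h V beta (nodal T D uh).

(** Multiplication by the mass matrix removes its inverse from the discrete Laplacian and leaves a
    symmetric matrix. *)
Lemma mass_hamilt k l : (massM T D *m A) k l =
  - conductance (dof k) (dof l) + (k == l)%:R * (mass (dof k) * potential (dof k)).
Proof.
rewrite /A /hamilt_h /lapl_h !mulmxDr opprK mulKVmx ?massM_unit// -addrA mxE stiffME; congr (_ + _).
rewrite -scalemxAr !mulmx_diag !mxE /potential.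
by case: eqP => [->|_]; rewrite ?mulr1n ?mulr0n ?mul1r ?mul0r ?mulr0 ?addr0// /mass /weight; ring.
Qed.

Lemma mass_hamilt_sym : (massM T D *m A)^T = massM T D *m A.
Proof.
apply/matrixP => k l; rewrite mxE !mass_hamilt conductanceC eq_sym.
by case: eqP => [->//|_]; rewrite !mul0r.
Qed.

Lemma dot_h_hamilt v : dot_h v (A *m v) = form potential 0 (extend v).
Proof.
rewrite /dot_h -!mulmxA (mulmxA (massM T D)) /form dirichlet_nodes.
rewrite (@sum_dof (fun i => \sum_j _)); last first.
  by move=> i Di; rewrite big1// => j _; rewrite extend_vanishing// mul0r mulr0.
rewrite sum_dof; last by move=> i Di; rewrite extend_vanishing// expr0n mulr0.
rewrite -sumrN -big_split mxE/=; apply: eq_bigr => k _.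
rewrite [v^T _ _]mxE [(_ *m v) _ _]mxE; under [in LHS]eq_bigr => l _ do rewrite mass_hamilt mulrDl.
rewrite big_split/= (bigD1 k (F := fun l => _ * _ * v l ord0))//= eqxx [X in _ + (_ + X)]big1; last first.
  by move=> l lk; rewrite eq_sym (negPf lk) !mul0r.
rewrite sum_dof; last by move=> j Dj; rewrite (extend_vanishing _ Dj) !mulr0.
rewrite addr0 mul1r mulrDr -sumrN mulr_sumr !extend_dof subr0; congr (_ + _); last by ring.
by apply: eq_bigr => l _; rewrite extend_dof; ring.
Qed.

Lemma hamilt_nodal : A *m nodal T D uh = - lapl_h T D *m nodal T D uh +
  diag_cV (nodal T D V) *m nodal T D uh + beta *: map_mx (fun t => t ^+ 3) (nodal T D uh).
Proof.
rewrite /A /hamilt_h !mulmxDl -scalemxAl; congr (_ + _ *: _).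
by apply/matrixP => k l; rewrite mul_diag_mx !mxE; ring.
Qed.

(** A row of the eigenvalue equation, put in terms of differences because the conductances at a
    vertex sum to 0. *)
Lemma nodal_equation lam i : A *m nodal T D uh = lam *: nodal T D uh -> D° (X i) ->
  \sum_j edge_weight i j * (uh (X i) - uh (X j)) + mass i * (potential i - lam) * uh (X i) = 0.
Proof.
move=> eigen Di.
have iI : i \in interior_vert T D by rewrite inE; apply/asboolP.
have -> : i = dof (enum_rank_in iI i) by rewrite /dof enum_rankK_in.
move: (enum_rank_in iI i) => k.
have uE := extend_nodal Vu; have uEi j : uh (X j) = extend (nodal T D uh) j by rewrite uE.
have -> : \sum_j edge_weight (dof k) j * (uh (X (dof k)) - uh (X j)) = - \sum_j conductance (dof k) j * uh (X j).
  transitivity (\sum_j conductance (dof k) j * (uh (X (dof k)) - uh (X j))).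
    apply: eq_bigr => j _; rewrite /edge_weight; case: eqP => // <-; rewrite subrr !mulr0//.
  under eq_bigr => j _ do rewrite mulrBr.
  by rewrite sumrB -mulr_suml sum_conductance mul0r sub0r.
have := congr1 (fun B => (massM T D *m B) k ord0) eigen.
have Mu : (massM T D *m nodal T D uh) k ord0 = weight k * uh (X (dof k)) by rewrite mul_diag_mx !mxE.
rewrite mulmxA -scalemxAr [LHS]mxE [RHS]mxE Mu.
under eq_bigr => l _ do rewrite mass_hamilt mulrDl.
rewrite big_split/= (bigD1 k (F := fun l => _ * _ * nodal T D uh l ord0))//= eqxx [X in _ + (_ + X)]big1; last first.
  by move=> l lk; rewrite eq_sym (negPf lk) !mul0r.
rewrite sum_dof; last by move=> j Dj; rewrite uEi (extend_vanishing _ Dj) mulr0.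
rewrite addr0 mul1r !mxE -sumrN => e.
have -> : \sum_(l < N) - (conductance (dof k) (dof l) * uh (X (dof l))) =
   \sum_l - conductance (dof k) (dof l) * nodal T D uh l ord0.
  by apply: eq_bigr => l _; rewrite mxE; ring.
have -> : mass (dof k) * (potential (dof k) - lam) * uh (X (dof k)) =
  mass (dof k) * potential (dof k) * uh (X (dof k)) - lam * (weight k * uh (X (dof k))).
  by rewrite /mass /weight; ring.
by rewrite addrA e subrr.
Qed.
End discrete_operator.

(** * A priori bounds for the discrete ground state *)

Section discrete_ground_state.
Context {R : realType} {d : nat} (L sigma : R).
Local Notation D := (cube L : set 'rV[R]_d).
Hypothesis d0 : (0 < d)%N.
Hypothesis L0 : 0 < L.

Lemma cube_upper_bound (V : 'rV[R]_d -> R) : {within D, continuous V} ->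
  exists Vm : R, 0 <= Vm /\ forall x, D x -> V x <= Vm.
Proof.
move=> cV; have cD : compact D.
  have -> : D = [set v | forall i, `[- L, L]%classic (v ord0 i)].
    by apply/seteqP; split=> x h i; have := h i; rewrite /= in_itv.
  by apply: (@rV_compact R d (fun=> `[- L, L]%classic)) => i; exact: segment_compact.
have D0 : D !=set0 by exists 0 => i; rewrite mxE oppr_le0 ltW.
have [z _ zmax] := compact_EVT_max D0 cD cV.
exists (Num.max 0 (V z)); split; first by rewrite le_max lexx.
by move=> x Dx; rewrite le_max zmax ?orbT// inE.
Qed.

Lemma dirichletZ (T : mesh R d) (a : R) f : conforming_mesh T D ->
  dirichlet (fun i : 'I_(nvert T) => a * f i) = a ^+ 2 * dirichlet f.
Proof.
move=> conf; rewrite !(dirichlet_edges conf) mulrCA; congr (_ * _).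
rewrite mulr_sumr; apply: eq_bigr => i _; rewrite mulr_sumr; apply: eq_bigr => j _; ring.
Qed.

(** The nodes outside [cube (L / 2)] have no inner mass in it, so the others have mass at least that
    of a slightly smaller cube; at those the distance to the boundary is at least [L / 2]. *)
Lemma trial_mass_ge (T : mesh R d) : conforming_mesh T D -> mesh_size T <= L / 4 ->
  (L / 2) ^+ 2 * (L / 2) ^+ d <= \sum_(i < nvert T) mass i * (L - `|vert i|) ^+ 2.
Proof.
move=> conf h4; have h0 := mesh_size_ge0 conf.
pose A : pred 'I_(nvert T) := fun i => L / 2 < `|vert i|.
have h2 : mesh_size T <= L / 2 by lra.
have L2 : L / 2 <= L by lra.
have := inner_mass_ge d0 L0 conf A h2 L2.
have -> : inner_mass (L / 2) A = 0.
  rewrite /inner_mass big1// => K KT; case: asboolP => KL; last by rewrite mulr0 mul0r.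
  have [cK aK] := cell_simplex conf KT.
  rewrite /frac (_ : [set i in K | A i]%SET = finset.set0) ?cards0 ?mul0r//.
  apply/setP => i; rewrite !inE; apply/negbTE/negP => /andP[iK]; rewrite /A ltNge => /negP; apply.
  have L20 : 0 <= L / 2 by lra.
  by apply/(cube_normP _ L20)/KL; exact: vert_hull.
rewrite add0r => mA.
have : (L / 2) ^+ d <= (2 * (L / 2 - mesh_size T)) ^+ d by rewrite lerXn2r ?nnegrE; lra.
have := sum_mass_all d0 L0 conf; rewrite (bigID A)/= => mass1 hd.
apply: (@le_trans _ _ (\sum_(i | ~~ A i) mass i * (L / 2) ^+ 2)).
  by rewrite -mulr_suml mulrC; apply: ler_wpM2r; [exact: sqr_ge0|lra].
rewrite [leRHS](bigID A)/= -[leLHS]add0r; apply: lerD.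
  by apply: sumr_ge0 => i _; rewrite mulr_ge0 ?mass_ge0// sqr_ge0.
apply: ler_sum => i; rewrite /A -leNgt => hi; apply: ler_wpM2l; first exact: mass_ge0.
by rewrite lerXn2r ?nnegrE; lra.
Qed.

(** The three terms of the energy of the trial function: (L / 2)^2 (L / 2)^d bounds its squared norm
    from below before normalization, its Lipschitz constant is 1 and its maximum at most [L]. *)
Definition trial_energy (beta Vm : R) : R :=
  2^-1 * (((L / 2) ^+ 2 * (L / 2) ^+ d)^-1 * ((2 * 1 * sigma) ^+ 2 * (2 * L) ^+ d)) + 2^-1 * Vm +
  beta / 4 * (L ^+ 2 * ((L / 2) ^+ 2 * (L / 2) ^+ d)^-1).

(* The trial function is the (normalized) distance to the boundary in the sup norm. *)
Lemma exists_trial (T : mesh R d) (V : 'rV[R]_d -> R) beta Vm :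
  conforming_mesh T D -> shape_regular T sigma -> mesh_size T <= L / 4 -> 0 <= beta ->
  (forall x, D x -> 0 <= V x <= Vm) ->
  exists g, [/\ V0h T D g, quad (fun (_ : {set 'I_(nvert T)}) x => g x * g x) = 1
    & energy_h T V beta g <= trial_energy beta Vm].
Proof.
move=> conf shape h4 beta0 V0.
pose f (i : 'I_(nvert T)) := L - `|vert i|.
have Dv i : D (vert i) := vert_cube conf i.
have XL i : `|@vert R d T i| <= L by apply/cube_normP; [exact: ltW|exact: Dv].
have f0 i : 0 <= f i by rewrite subr_ge0.
have fL i : f i <= L by rewrite lerBlDr lerDl.
have N2 := trial_mass_ge conf h4; rewrite -/f in N2.
set c0 := _ * _ in N2; set S := \sum_i _ in N2.
have c00 : 0 < c0 by rewrite /c0 mulr_gt0// exprn_gt0// divr_gt0.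
have S0 : 0 < S := lt_le_trans c00 N2.
pose a := (Num.sqrt S)^-1.
have a2 : a ^+ 2 = S^-1 by rewrite /a exprVn sqr_sqrtr// ltW.
have Sc : S^-1 <= c0^-1 by rewrite lef_pV2.
pose g := p1 (fun i => a * f i).
have gX i : g (vert i) = a * f i := p1_vert conf _ i.
have Vg : V0h T D g.
  apply: V0h_p1 => // i Di; rewrite /f (boundary_norm d0 L0 (Dv i) Di) subrr mulr0//.
have mass1 : \sum_i mass i * (a * f i) ^+ 2 = 1.
  under eq_bigr => i _ do rewrite exprMn mulrCA.
  by rewrite -mulr_sumr a2 mulVf// gt_eqF.
exists g; split => //.
  rewrite quad_nodal -mass1; apply: eq_bigr => i _; rewrite gX expr2//.
rewrite (energy_hE conf _ _ Vg) /trial_energy.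
have -> : dirichlet (fun i : 'I_(nvert T) => g (vert i)) = a ^+ 2 * dirichlet f.
  by rewrite -dirichletZ//; congr dirichlet; apply/funext => i; exact: gX.
have Df : dirichlet f <= (2 * 1 * sigma) ^+ 2 * (2 * L) ^+ d.
  apply: (dirichlet_lipschitz_le d0 L0 conf shape) => // i j; rewrite mul1r.
  rewrite /f opprB addrC addrA subrK distrC; apply: (le_trans (ler_dist_dist _ _)).
  exact: norm_le_enorm.
apply: lerD; first apply: lerD.
- rewrite ler_pM2l// a2; apply: ler_pM => //; first by rewrite invr_ge0 ltW.
  exact: dirichlet_ge0.
- rewrite ler_pM2l// -[leRHS]mulr1 -mass1 mulr_sumr; apply: ler_sum => i _.
  rewrite gX [leRHS]mulrCA; apply: ler_wpM2l; first exact: mass_ge0.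
  by apply: ler_wpM2r; [exact: sqr_ge0|have /andP[] := V0 _ (Dv i)].
- apply: ler_wpM2l; first exact: divr_ge0.
  apply: (@le_trans _ _ (L ^+ 2 * S^-1)); last by apply: ler_wpM2l => //; exact: sqr_ge0.
  rewrite -[leRHS]mulr1 -mass1 mulr_sumr; apply: ler_sum => i _.
  rewrite gX (_ : (a * f i) ^+ 4 = a ^+ 2 * f i ^+ 2 * (a * f i) ^+ 2); last by ring.
  rewrite [leRHS]mulrCA; apply: ler_wpM2l; first exact: mass_ge0.
  apply: ler_wpM2r; first exact: sqr_ge0.
  rewrite a2 mulrC; apply: ler_wpM2r; first by rewrite invr_ge0 ltW.
  by rewrite lerXn2r ?nnegrE// (le_trans (f0 i)).
Qed.

(** Testing the equation with the ground state writes [lam] as a sum of nonnegative terms, at most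
    four times the energy, which minimality compares with the trial function. This bounds both [lam]
    and the Dirichlet energy. *)
Lemma ground_dataP (T : mesh R d) (V uh : 'rV[R]_d -> R) beta Vm lam :
  conforming_mesh T D -> shape_regular T sigma -> mesh_size T <= L / 4 -> 0 < beta ->
  (forall x, D x -> 0 <= V x <= Vm) -> ground_state_h T D V beta uh ->
  hamilt_h V beta (nodal T D uh) *m nodal T D uh = lam *: nodal T D uh ->
  ground_data L (Vm * (2 * L) ^+ d + beta + 4 * trial_energy beta Vm)
    (potential V beta uh) (fun i : 'I_(nvert T) => uh (vert i)) lam.
Proof.
move=> conf shape h4 /ltW beta0 V0 [Vu u1 umin upos] eigen.
have Dv i : D (vert i) := vert_cube conf i.
have [g [Vg g1 gE]] := exists_trial conf shape h4 beta0 V0.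
have Eu := le_trans (umin g Vg g1) gE.
have V0' i : 0 <= V (@vert R d T i) by have /andP[] := V0 _ (Dv i).
have mass1 : \sum_(i < nvert T) mass i * uh (vert i) ^+ 2 = 1.
  by rewrite -u1 quad_nodal; apply: eq_bigr => i _; rewrite expr2.
have uE := extend_nodal conf Vu.
have lamE : lam = dirichlet (fun i : 'I_(nvert T) => uh (vert i)) +
    \sum_(i < nvert T) mass i * potential V beta uh i * uh (vert i) ^+ 2.
  have := dot_h_hamilt d0 L0 conf V beta uh (nodal T D uh).
  rewrite eigen /form uE (_ : dot_h _ _ = lam) => [->|].
    by congr (_ + _); apply: eq_bigr => i _; rewrite subr0.
  rewrite /dot_h -scalemxAr mxE -/(dot_h _ _) (dot_hE) uE.
  by under eq_bigr => i _ do rewrite -expr2; rewrite mass1 mulr1.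
have D0 := dirichlet_ge0 (fun i : 'I_(nvert T) => uh (vert i)).
have m0 := @mass_ge0 R d T.
have W0 (i : 'I_(nvert T)) : 0 <= potential V beta uh i :> R.
  by rewrite /potential; apply: addr_ge0 => //; apply: mulr_ge0 => //; exact: sqr_ge0.
have Wsum0 : 0 <= \sum_(i < nvert T) mass i * potential V beta uh i * uh (vert i) ^+ 2.
  by apply: sumr_ge0 => i _; rewrite mulr_ge0 ?sqr_ge0// mulr_ge0.
have L20 : 0 < 2 * L by rewrite mulr_gt0.
have Dz : D 0 by move=> i; rewrite mxE oppr_le0 ltW//= ltW.
have Vm0 : 0 <= Vm by have /andP[] := V0 0 Dz; exact: le_trans.
have E0 : 0 <= energy_h T V beta uh.
  rewrite (energy_hE conf _ _ Vu) addr_ge0//; first rewrite addr_ge0//.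
  - by rewrite mulr_ge0.
  - by rewrite mulr_ge0// sumr_ge0// => i _; rewrite mulr_ge0// mulr_ge0// sqr_ge0.
  - rewrite mulr_ge0//; first exact: divr_ge0.
    by apply: sumr_ge0 => i _; rewrite mulr_ge0// exprn_even_ge0.
have lamE4 : lam <= 4 * energy_h T V beta uh.
  rewrite (energy_hE conf _ _ Vu) lamE.
  have -> : \sum_(i < nvert T) mass i * potential V beta uh i * uh (vert i) ^+ 2 =
    \sum_(i < nvert T) mass i * (V (vert i) * uh (vert i) ^+ 2) +
    beta * \sum_(i < nvert T) mass i * uh (vert i) ^+ 4.
    by rewrite mulr_sumr -big_split; apply: eq_bigr => i _; rewrite /potential/=; ring.
  have : 0 <= \sum_(i < nvert T) mass i * (V (vert i) * uh (vert i) ^+ 2).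
    by apply: sumr_ge0 => i _; rewrite mulr_ge0// mulr_ge0// sqr_ge0.
  set q := beta * _; set p := \sum_i _; move: D0; set z := dirichlet _.
  rewrite (_ : beta / 4 * _ = q / 4); last by rewrite /q; field.
  by clear; lra.
have lam0 : 0 <= lam by rewrite lamE addr_ge0.
have VV : 0 <= Vm * (2 * L) ^+ d by rewrite mulr_ge0// exprn_ge0// ltW.
have T0 : 0 <= trial_energy beta Vm := le_trans E0 Eu.
split.
- move=> i; have [Di|Di] := pselect (D° (vert i)).
    by have := upos i Di => ui; split; [exact: ltW|move=> e; move: ui; rewrite e ltxx].
  case: Vu => _ ub _; rewrite (ub _ (Dv i) Di); split=> // _.
  exact: boundary_norm.
- move=> i ui; apply: (nodal_equation d0 L0 conf Vu eigen).
  apply: contrapT => Di; case: Vu => _ ub _; by rewrite (ub _ (Dv i) Di) eqxx in ui.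
- exact: mass1.
- apply: (@le_trans _ _ lam); first by rewrite lamE lerDl.
  by move: lamE4 Eu VV beta0; clear; lra.
split => //.
  rewrite (_ : \sum_i _ = \sum_(i < nvert T) mass i * V (vert i) + beta); last first.
    rewrite -[beta in RHS]mulr1 -mass1 mulr_sumr -big_split; apply: eq_bigr => i _.
    by rewrite /potential/=; ring.
  have : \sum_(i < nvert T) mass i * V (vert i) <= Vm * (2 * L) ^+ d.
    rewrite -(sum_mass_all d0 L0 conf) mulr_sumr; apply: ler_sum => i _.
    by rewrite mulrC; apply: ler_wpM2r; [exact: m0|have /andP[] := V0 _ (Dv i)].
  by move: T0; clear; lra.
rewrite lam0/=; by move: lamE4 Eu VV beta0; clear; lra.
Qed.
End discrete_ground_state.
(* The factor x on the left avoids the exponent n - 1. Both sides are determinants of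
   triangular factorizations of the bordered matrix [x%:M, u; w, 1]. *)
Lemma det_scalar_sub_rank1 (R : comRingType) n (x : R) (u : 'cV[R]_n) (w : 'rV[R]_n) :
  x * \det (x%:M - u *m w) = x ^+ n * (x - (w *m u) ord0 ord0).
Proof.
have e1 : block_mx x%:M u w 1%:M *m block_mx 1%:M 0 (- w) 1%:M = block_mx (x%:M - u *m w) u 0 (1%:M : 'M[R]_1).
  by rewrite mulmx_block !mulmx1 !mulmx0 !mulmxN !mul1mx !add0r subrr.
have e2 : block_mx x%:M u w 1%:M *m block_mx 1%:M (- u) 0 x%:M = block_mx x%:M 0 w (x%:M - w *m u).
  rewrite mulmx_block !mulmx1 !mulmx0 !mulmxN !addr0 mul1mx mul_scalar_mx mul_mx_scalar.
  by rewrite addNr addrC.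
have := congr1 determinant e1; have := congr1 determinant e2.
rewrite !det_mulmx !det_lblock !det_ublock !det_scalar !expr1n !mul1r !mulr1 expr1 det_mx11 => e <-.
by rewrite mulrC e !mxE.
Qed.

(** As [w] is a left eigenvector, ['X - lam%:P] times the deflated characteristic matrix is a
    rank-one perturbation of a scalar matrix times that of [A]; take determinants and cancel the
    power of ['X - lam%:P]. *)
Lemma char_poly_deflation (F : fieldType) n (A : 'M[F]_n) (u : 'cV[F]_n) (w : 'rV[F]_n) (lam tau : F) :
  w *m A = lam *: w -> (w *m u) ord0 ord0 = 1 ->
  char_poly (A + tau *: (u *m w)) * ('X - lam%:P) = char_poly A * ('X - (lam + tau)%:P).
Proof.
move=> wA wu; pose u' := map_mx polyC u; pose w' := map_mx polyC w; pose x : {poly F} := 'X - lam%:P.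
have wP : w' *m char_poly_mx A = x *: w'.
  rewrite /char_poly_mx mulmxBr mul_mx_scalar -map_mxM wA map_mxZ -scalerBl//.
have cE : char_poly_mx (A + tau *: (u *m w)) = char_poly_mx A - tau%:P *: (u' *m w').
  by rewrite /char_poly_mx map_mxD map_mxZ map_mxM opprD addrA.
have E : x *: char_poly_mx (A + tau *: (u *m w)) = (x%:M - (tau%:P *: u') *m w') *m char_poly_mx A.
  by rewrite mulmxBl mul_scalar_mx -mulmxA wP cE scalerBr -!scalemxAl -scalemxAr !scalerA mulrC.
have x0 : x != 0 by rewrite polyXsubC_eq0.
have := congr1 determinant E; rewrite detZ det_mulmx => dE.
have r1 := det_scalar_sub_rank1 x (tau%:P *: u') w'.
apply: (mulfI (expf_neq0 n x0)).
rewrite mulrA [x ^+ n * _]dE mulrC mulrA r1 -mulrA; congr (_ * _).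
have wu' : (w' *m u') ord0 ord0 = 1 by rewrite -map_mxM mxE wu.
by rewrite mulrC; congr (_ * _); rewrite -scalemxAr mxE wu' mulr1 /x polyCD; ring.
Qed.

(** * From the gap of the form to the gap of the eigenvalues *)

Section second_eigenpair.
Context {R : realType} {n : nat} (M A : 'M[R]_n) (u : 'cV[R]_n) (lam eps : R).
Local Notation dot v w := ((v^T *m M *m w) ord0 ord0).
Hypothesis MT : M^T = M.
Hypothesis Mu : M \in unitmx.
Hypothesis Mpos : forall v : 'cV[R]_n, v != 0 -> 0 < dot v v.
Hypothesis MA : (M *m A)^T = M *m A.
Hypothesis eigen : A *m u = lam *: u.
Hypothesis u1 : dot u u = 1.
Hypothesis eps0 : 0 < eps.
Hypothesis gap : forall v : 'cV[R]_n, dot u v = 0 -> dot v v = 1 -> lam + eps <= dot v (A *m v).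

(** A root of the characteristic polynomial provides a row eigenvector; symmetry of [M *m B] turns
    it into a column eigenvector through [invmx M]. *)
Lemma selfadjoint_eigenvector B a : (M *m B)^T = M *m B -> root (char_poly B) a ->
  exists2 v : 'cV[R]_n, v != 0 & B *m v = a *: v.
Proof.
move=> MB; rewrite -eigenvalue_root_char => /eigenvalueP[w wB w0].
exists (invmx M *m w^T).
  apply: contraNneq w0 => e; rewrite -(trmxK w) -[w^T](mulKVmx Mu) e mulmx0 trmx0//.
have : M *m (B *m (invmx M *m w^T)) = M *m (a *: (invmx M *m w^T)).
  rewrite mulmxA -MB trmx_mul MT -mulmxA mulKVmx// -trmx_mul wB linearZ/= -scalemxAr mulKVmx//.
by move/(can_inj (mulKmx Mu)).
Qed.

Lemma left_eigen : u^T *m M *m A = lam *: (u^T *m M).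
Proof.
rewrite -mulmxA -MA -trmx_mul -mulmxA eigen -scalemxAr linearZ/= trmx_mul MT//.
Qed.

Lemma orthogonal_eigenvalue_ge (v : 'cV[R]_n) a : v != 0 -> A *m v = a *: v -> dot u v = 0 -> lam + eps <= a.
Proof.
move=> v0 Av uv; have p := Mpos v0; set q := dot v v in p.
pose c := (Num.sqrt q)^-1.
have cq : c * (c * q) = 1 by rewrite mulrA -expr2 exprVn sqr_sqrtr ?ltW// mulVf// gt_eqF.
have nrm : dot (c *: v) (c *: v) = 1.
  by rewrite -scalemxAr mxE [(c *: v)^T]linearZ/= -!scalemxAl mxE.
have := gap (v := c *: v); rewrite nrm -scalemxAr mxE uv mulr0 => /(_ erefl erefl).
rewrite -[A *m _]scalemxAr Av scalerA mulrC -scalerA -scalemxAr mxE nrm mulr1//.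
Qed.

(* If lam were a double root of char_poly A, it would remain an eigenvalue of A + u u^T M,
   which moves the eigenvalue of u to lam + 1, with an eigenvector orthogonal to u. *)
Lemma second_eigenvalue_gap (lam1 : R) (v : 'cV[R]_n) : second_eigenvalue A lam1 ->
  A *m v = lam1 *: v -> dot v v = 1 -> eps <= lam1 - lam.
Proof.
move=> [s [cA ss]] + + Av v1.
have v0 : v != 0.
  by apply: contra_eq_neq v1 => ->; rewrite mulmx0 mxE eq_sym oner_eq0.
have orth a (w : 'cV[R]_n) : a != lam -> A *m w = a *: w -> dot u w = 0.
  move=> al Aw; have := congr1 (fun z : 'M[R]_1 => z ord0 ord0) (congr1 (mulmx (u^T *m M)) Aw).
  rewrite mulmxA left_eigen -scalemxAl -scalemxAr mxE [RHS]mxE => /eqP.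
  by rewrite -subr_eq0 -mulrBl mulf_eq0 subr_eq0 eq_sym (negPf al)/= => /eqP.
case: s cA ss => [|s0 [|s1 s]]//= cA /andP[s01 _] _ s1E.
(* If [lam1 = lam], the given [v] may be a multiple of [u], so another eigenvector has to be found;
   otherwise [v] is orthogonal to [u]. *)
have [e|ne] := eqVneq lam1 lam; last first.
  by rewrite lerBrDl; exact: orthogonal_eigenvalue_ge v0 Av (orth _ _ ne Av).
rewrite {}s1E {}e {lam1 v Av v1 v0} in cA s01 *.
suff [a [w [al w0 Aw uw]]] : exists a (w : 'cV[R]_n), [/\ a <= lam, w != 0, A *m w = a *: w & dot u w = 0].
  by have := orthogonal_eigenvalue_ge w0 Aw uw; rewrite leNgt (le_lt_trans al)// ltrDl.
(* A smallest root different from [lam] has an eigenvector orthogonal to [u]; if it equals [lam],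
   then [lam] is a double root. *)
have [e|ne] := eqVneq s0 lam; last first.
  have [|w w0 Aw] := selfadjoint_eigenvector (a := s0) MA.
    by rewrite cA big_cons rootM root_XsubC eqxx.
  by exists s0, w; split => //; exact: orth Aw.
pose w := u^T *m M; pose B := A + 1 *: (u *m w).
have MB : (M *m B)^T = M *m B.
  rewrite /B scale1r mulmxDr linearD/= MA; congr (_ + _).
  by rewrite /w !trmx_mul trmxK MT !mulmxA.
have x0 : 'X - lam%:P != 0 :> {poly R} by rewrite polyXsubC_eq0.
have rB : root (char_poly B) lam.
  have := char_poly_deflation 1 left_eigen u1; rewrite -/w -/B cA !big_cons e.
  have -> : forall p q : {poly R}, ('X - lam%:P) * (('X - lam%:P) * p) * q = (('X - lam%:P) * p * q) * ('X - lam%:P).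
    by move=> p q; ring.
  move=> /(mulIf x0) ->; by rewrite -mulrA rootM root_XsubC eqxx.
have [y y0 By] := selfadjoint_eigenvector MB rB.
have uy : dot u y = 0.
  have := congr1 (fun z : 'M[R]_1 => z ord0 ord0) (congr1 (mulmx w) By).
  rewrite /B scale1r mulmxDl mulmxDr (mulmxA w A) left_eigen -scalemxAl -scalemxAr.
  have -> : w *m (u *m w *m y) = w *m y.
    by rewrite !mulmxA [w *m u]mx11_scalar u1 mul1mx.
  rewrite mxE [X in X + _]mxE [RHS]mxE => /eqP; rewrite addrC -subr_eq0 addrK => /eqP//.
exists lam, y; split => //.
move: By; rewrite /B scale1r mulmxDl -(mulmxA u) [w *m y]mx11_scalar uy.
by rewrite -[0%:M]scalemx1 scale0r mulmx0 addr0.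
Qed.
End second_eigenpair.

Lemma liminf_h0_gt0 (R : realType) (I : Type) (h a : I -> R) (eps del : R) : 0 < eps -> 0 < del ->
  (forall i, h i < del -> eps <= a i) -> (0 < liminf_h0 h a)%E.
Proof.
move=> e0 d0 main; apply: (@lt_le_trans _ _ eps%:E); first by rewrite lte_fin.
apply: (@le_trans _ _ (ereal_inf [set (a i)%:E | i in [set i | h i < del]])).
  by apply/ereal_infP => _ [i hi <-]; rewrite lee_fin; exact: main.
by apply: ereal_sup_ubound; exists del.
Qed.

Lemma hamilt_gap (R : realType) (d : nat) (L : R) (T : mesh R d) (V uh : 'rV[R]_d -> R) (beta lam lam1 eps : R)
    (v : 'cV[R]_(ndof T (cube L))) : (0 < d)%N -> 0 < L -> conforming_mesh T (cube L) -> 0 < eps ->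
  ground_state_h T (cube L) V beta uh ->
  let u := nodal T (cube L) uh in let A := hamilt_h V beta u in
  A *m u = lam *: u ->
  (forall f : 'I_(nvert T) -> R, (forall i, uh (vert i) = 0 -> f i = 0) ->
    \sum_i mass i * (uh (vert i) * f i) = 0 -> \sum_i mass i * f i ^+ 2 = 1 ->
    eps <= form (potential V beta uh) lam f) ->
  second_eigenvalue A lam1 -> A *m v = lam1 *: v -> dot_h v v = 1 -> eps <= lam1 - lam.
Proof.
move=> d0 L0 conf eps0 [Vu u1 _ upos] u A eigen gap sA Av v1.
have uE := extend_nodal conf Vu.
apply: (@second_eigenvalue_gap _ _ (massM T (cube L)) A u lam eps) Av v1 => //.
- exact: tr_diag_mx.
- exact: (massM_unit conf).
- move=> w w0; rewrite -mulmxA mxE; under eq_bigr => k _ do rewrite mul_diag_mx !mxE mulrCA -expr2.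
  have [k wk] : exists k, w k ord0 != 0.
    apply: contrapT => /forallNP h; case/eqP: w0; apply/colP => k; rewrite mxE.
    by apply/eqP; apply: contrapT => /negP; exact: h.
  rewrite (bigD1 k)//= ltr_pwDl//.
    by rewrite mulr_gt0 ?(weight_gt0 conf)// exprn_even_gt0.
  by apply: sumr_ge0 => l _; rewrite mulr_ge0 ?sqr_ge0// ltW// (weight_gt0 conf).
- exact: mass_hamilt_sym.
- rewrite -/(dot_h u u) dot_hE uE -u1 quad_nodal//.
- move=> w; rewrite -/(dot_h u w) -/(dot_h w w) -/(dot_h _ _) !dot_hE uE => uw ww.
  have ww' : \sum_i mass i * extend w i ^+ 2 = 1.
    by rewrite -ww; apply: eq_bigr => i _; rewrite expr2.
  have fv i : uh (vert i) = 0 -> extend w i = 0.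
    move=> ui; apply: extend_vanishing => Di; have := upos i Di; rewrite ui ltxx//.
  have := gap (extend w) fv uw ww'.
  rewrite -dot_hE dot_h_hamilt// /form.
  have -> : \sum_i mass i * (potential V beta uh i - lam) * extend w i ^+ 2 =
     \sum_i mass i * (potential V beta uh i - 0) * extend w i ^+ 2 - lam * \sum_i mass i * extend w i ^+ 2.
    by rewrite mulr_sumr -sumrB; apply: eq_bigr => i _; ring.
  by rewrite ww'; lra.
Qed.

Theorem theoremE8 (R : realType) (d : nat) (L beta c sigma : R)
    (V u : 'rV[R]_d -> R) (lam : R)
    (I : Type) (T : I -> mesh R d) (uh : I -> 'rV[R]_d -> R) (lamh lamh1 : I -> R)
    (u1 : forall i : I, 'cV[R]_(ndof (T i) (cube L))) :
  (1 <= d <= 3)%N -> 0 < L -> 0 < beta ->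
  0 < c -> (forall x, cube L x -> c <= V x) -> C1_closure (cube L) V ->
  ground_state (cube L) V beta u -> H2 (cube L) u ->
  weak_eigenfun (cube L) (fun x => V x + beta * `|u x| ^+ 2) lam u ->
  multiplicity_one (cube L) (fun x => V x + beta * `|u x| ^+ 2) lam ->
  0 < sigma ->
  (forall i, conforming_mesh (T i) (cube L)) ->
  (forall i, shape_regular (T i) sigma) ->
  ((2 <= d)%N -> forall i, monotone_mesh (T i)) ->
  (forall i (v : 'cV[R]_(ndof (T i) (cube L))),
    irreducible_mx (hamilt_h V beta v)) ->
  (forall i, ground_state_h (T i) (cube L) V beta (uh i)) ->
  (forall i, let ui := nodal (T i) (cube L) (uh i) in
    - lapl_h (T i) (cube L) *m ui + diag_cV (nodal (T i) (cube L) V) *m ui +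
      beta *: map_mx (fun t => t ^+ 3) ui = lamh i *: ui) ->
  (forall i, let A := hamilt_h V beta (nodal (T i) (cube L) (uh i)) in
    [/\ second_eigenvalue A (lamh1 i), A *m u1 i = lamh1 i *: u1 i
      & dot_h (u1 i) (u1 i) = 1]) ->
  (0 < liminf_h0 (fun i => mesh_size (T i)) (fun i => lamh1 i - lamh i)%R)%E.
Proof.
move=> /andP[d0 _] L0 beta0 c0 Vc [cV _] _ _ _ _ _ conf shape mono _ ground eigen eigen1.
have [Vm [Vm0 VVm]] := cube_upper_bound L0 cV.
have V0 x : cube L x -> 0 <= V x <= Vm.
  by move=> Dx; rewrite VVm// andbT (le_trans (ltW c0))// Vc.
pose Lam := Num.max 0 (Vm * (2 * L) ^+ d + beta + 4 * @trial_energy R d L sigma beta Vm).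
have Lam0 : 0 <= Lam by rewrite le_max lexx.
have [eps [del [eps0 del0 gap]]] := @uniform_gap R d L sigma Lam d0 L0 Lam0.
(* The mesh size must also be at most [L / 4] for the trial function to have norm bounded below. *)
have del1 : 0 < Num.min del (L / 4) by rewrite lt_min del0 divr_gt0.
apply: (liminf_h0_gt0 eps0 del1) => i; rewrite lt_min => /andP[hi /ltW h4].
have [sA Au1 u11] := eigen1 i.
have eigen' := eigen i; rewrite /= -hamilt_nodal in eigen'.
apply: (hamilt_gap d0 L0 (conf i) eps0 (ground i) eigen' _ sA Au1 u11).
have adm : admissible_mesh L sigma (T i) by split => // d2; exact: mono.
have := ground_dataP d0 L0 (conf i) (shape i) h4 beta0 V0 (ground i) eigen'.
set Lam' := _ + _ => data; apply: (gap _ _ _ _ adm _ hi).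
have LL : Lam' <= Lam by rewrite le_max lexx orbT.
case: data => D1 D2 D3 D4 [D5 D6 /andP[D7 D8]]; split => //; first exact: le_trans LL.
by split => //; rewrite ?D7 (le_trans _ LL).
Qed.
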